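(* For all $x,\alpha>0$, $$W_{-\frac14,0}(x)\,W_{\frac14,0}(x)+2\sum_{n=1}^{\infty}W_{-\frac14,i\alpha n}(x)\,W_{\frac14,i\alpha n}(x)=\frac{x}{\sqrt{2}\,\alpha}\left\{e^{-\frac{x}{2}}K_{0}\left(\frac{x}{2}\right)+2\sum_{n=1}^{\infty}e^{-\frac{x}{2}\cosh\left(\frac{\pi n}{\alpha}\right)}K_{0}\left(\frac{x}{2}\cosh\left(\frac{\pi n}{\alpha}\right)\right)\right\}.$$ Moreover, the following pair of Fourier transforms holds: for every $x>0$ and $\xi\in\mathbb{R}$, $$\int_{-\infty}^{\infty}W_{-\frac14,i\tau}(x)\,W_{\frac14,i\tau}(x)\,e^{-i\tau\xi}\,d\tau=\frac{x}{\sqrt{2}}\,e^{-\frac{x}{2}\cosh\left(\frac{\xi}{2}\right)}K_{0}\left(\frac{x}{2}\cosh\left(\frac{\xi}{2}\right)\right),$$ and, for every $x>0$ and $\tau\in\mathbb{R}$, $$W_{-\frac14,i\tau}(x)\,W_{\frac14,i\tau}(x)=\frac{x}{2\sqrt{2}\,\pi}\int_{-\infty}^{\infty}e^{-\frac{x}{2}\cosh\left(\frac{\xi}{2}\right)}K_{0}\left(\frac{x}{2}\cosh\left(\frac{\xi}{2}\right)\right)e^{i\tau\xi}\,d\xi.$$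
   Context: For $z>0$, Tricomi's function is $\Psi(a,c;z)=\frac{\Gamma(1-c)}{\Gamma(a-c+1)}\,{}_1F_1(a;c;z)+z^{1-c}\frac{\Gamma(c-1)}{\Gamma(a)}\,{}_1F_1(a-c+1;2-c;z)$ (for integer $c$ defined by continuity in $c$), where ${}_1F_1(a;c;z)=\sum_{k\ge 0}\frac{(a)_k}{(c)_k}\frac{z^k}{k!}$. The Whittaker function is $W_{\mu,\nu}(z)=e^{-z/2}z^{\nu+\frac12}\,\Psi\left(\tfrac12+\nu-\mu,\,2\nu+1;\,z\right)$; it is entire in $\mu$ and in $\nu$. $K_\nu$ is the modified Bessel function of the second kind (Macdonald function), $K_{\nu}(z)=\int_0^\infty e^{-z\cosh u}\cosh(\nu u)\,du$ for $z>0$, $\nu\in\mathbb{C}$. *)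

(* Defs.v *)
From HB Require Import structures.
From mathcomp Require Import all_boot all_order all_algebra.
From mathcomp Require Import all_classical all_reals all_analysis.
From mathcomp Require Import complex.

Set Implicit Arguments.
Unset Strict Implicit.
Unset Printing Implicit Defensive.

Import Order.TTheory GRing.Theory Num.Theory.
Import numFieldNormedType.Exports.

Local Open Scope classical_set_scope.
Local Open Scope ring_scope.
Local Open Scope complex_scope.

(* [R[i]] carries no canonical topology; its copy [(R[i])^o] carries the one
   of the modulus, and is used below wherever a limit is taken. *)

Section ComplexAnalysis.
Context {R : realType}.
Implicit Types (x : R) (z : R[i]) (u : nat -> R[i]) (D : set R) (f : R -> R[i]).

Definition cosh x : R := (expR x + expR (- x)) / 2.

Definition cexp z : R[i] :=
  (expR (complex.Re z))%:C * (cos (complex.Im z) +i* sin (complex.Im z)).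

Definition ccosh z : R[i] := (cexp z + cexp (- z)) / 2.

(* [x ^ z] with the principal branch; meaningful for [0 < x] only. *)
Definition cpow x z : R[i] := cexp (z * (ln x)%:C).

(* \sum_(k >= m) u k: like every [lim], a junk value unless [csummable m u]. *)
Definition csummable (m : nat) u : Prop :=
  cvgn (fun n => \sum_(m <= k < n) u k : (R[i])^o).

Definition csum (m : nat) u : R[i] :=
  limn (fun n => \sum_(m <= k < n) u k : (R[i])^o).

Definition cintegrable D f : Prop :=
  lebesgue_measure.-integrable D (fun t => (complex.Re (f t))%:E) /\
  lebesgue_measure.-integrable D (fun t => (complex.Im (f t))%:E).

Definition cintegral D f : R[i] :=
  (\int[lebesgue_measure]_(t in D) complex.Re (f t)) +i*
  (\int[lebesgue_measure]_(t in D) complex.Im (f t)).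

End ComplexAnalysis.

Section SpecialFunctions.
Context {R : realType}.
Implicit Types (x : R) (a c z mu nu : R[i]).

Definition pochhammer a (k : nat) : R[i] := \prod_(j < k) (a + j%:R).

(* Euler's integral, convergent for [0 < Re z]. *)
Definition euler_gamma z : R[i] :=
  cintegral `]0, +oo[ (fun t => (expR (- t))%:C * cpow t (z - 1)).

(* Continuation of Euler's integral by Gamma(z) = Gamma(z + m) / (z)_m, where
   [m] is the least natural number with [0 < Re z + m] ([m = 0] when
   [0 < Re z]).  At the poles z = 0, -1, -2, ... one has (z)_m = 0, so that
   both [cgamma z] and [(cgamma z)^-1] are 0: the latter is the value of the
   entire function 1 / Gamma. *)
Definition cgamma z : R[i] :=
  let m := Num.truncn (1 - complex.Re z) in
  euler_gamma (z + m%:R) / pochhammer z m.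

Definition hyp1F1 a c z : R[i] :=
  csum 0 (fun k => pochhammer a k / pochhammer c k * (z ^+ k / k`!%:R)).

(* The defining formula of Tricomi's function, for [c] not an integer. *)
Definition tricomi_nonint a c x : R[i] :=
  cgamma (1 - c) / cgamma (a - c + 1) * hyp1F1 a c x%:C +
  cpow x (1 - c) * (cgamma (c - 1) / cgamma a) *
    hyp1F1 (a - c + 1) (2 - c) x%:C.

(* The limit is over complex [c'] tending to [c] with [c' != c]; such [c'] are
   eventually non-integers. *)
Definition tricomi a c x : R[i] :=
  if `[< exists m : int, c = m%:~R >]
  then lim ((tricomi_nonint a c' x : (R[i])^o) @[c' --> (c : (R[i])^o)^'])
  else tricomi_nonint a c x.

Definition whittakerW mu nu x : R[i] :=
  (expR (- x / 2))%:C * cpow x (nu + 1 / 2) *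
  tricomi (1 / 2 + nu - mu) (2 * nu + 1) x.

Definition besselK nu x : R[i] :=
  cintegral `[0, +oo[
    (fun u => (expR (- x * cosh u))%:C * ccosh (nu * u%:C)).

End SpecialFunctions.

(* Main.v *)
Require Import Defs.
From HB Require Import structures.
From mathcomp Require Import all_boot all_order all_algebra.
From mathcomp Require Import all_classical all_reals all_analysis.
From mathcomp Require Import complex measurable_realfun.
From mathcomp Require Import ring lra.

Set Implicit Arguments.
Unset Strict Implicit.
Unset Printing Implicit Defensive.

Import Order.TTheory GRing.Theory Num.Theory.
Import numFieldNormedType.Exports.

Local Open Scope classical_set_scope.
Local Open Scope ring_scope.
Local Open Scope complex_scope.

(** Everything follows from one product formula. Put X = (x/2) cosh y and g(y) = e^{-X} K_0(X).
    Since cosh^2 d = (1 + cosh 2d)/2, also g(y) = int exp(-x cosh y cosh^2 d) dd over the line,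
    which is [gbessel x y]. The formula is W_{-1/4,it}(x) W_{1/4,it}(x) = x/(sqrt 2 pi) int g(y)
    cos(2ty) dy ([whittaker_product]). With y = xi/2 it is the second Fourier integral; the first
    one is Fourier inversion for the even function g ([cosine_inversion]); the summation formula is
    Poisson summation for g with frequency step 2 alpha and sample step pi/alpha
    ([poisson_summation]).

    The product formula comes from Gamma(a) Psi(a,c;x) = int_0^oo e^{-xt} t^{a-1} (1+t)^{c-a-1} dt.
    The substitution t = sinh^2(p/2) turns W_{mu,it}(x), up to elementary and gamma factors, into
    the integral over p > 0 of e^{-(x/2) cosh p} tanh(p/2)^{-2 mu} (sinh(p/2) cosh(p/2))^{2it}
    ([wker_int]). In the product for mu = -1/4 and mu = 1/4, set p = P + d and q = P - d. The powers
    of tanh combine into a multiple of sinh P + sinh d, and adding the contribution of -d removes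
    sinh d ([wkerM_sym]). What is left in P is the classical integral int_1^oo (T^2-1)^{v-1/2}
    e^{-zT} dT for K_v(z), at v = 2it and z = x cosh^2 d ([sker_substitution], [knu_rep]). Writing
    K_v as int e^{-z cosh y + vy} dy and exchanging integrals gives g; the duplication formula
    removes the gamma factors.

    The integral for Psi has to be derived from its definition by two series 1F1. Let M_v(y) =
    int_0^oo t^{v-1} e^{-t-y/t} dt ([kint]), a rescaled Macdonald function. Its three-term
    recurrence in v and that of 0F1 have a Casoratian that can be evaluated at infinity, and this
    expresses v M_v by the two series 0F1(;1-v;y) and 0F1(;1+v;y) ([kint_connection]). Integration
    of this identity at y = xt against t^{a-1} e^{-t} turns each 0F1 into a 1F1, and turns the left
    side into the wanted integral by Fubini ([tricomi_nonint_tint]). The value c = 1 is a limit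
    ([tricomi_one]). Division by gamma values uses [egamma_neq0].

    For the Fourier side, g and its second differences are bounded by constants times e^{-|y|} and
    h^2 e^{-|y|}, so its transform is O(1/(1+s^2)). Inversion is then Abel summation, and Poisson
    summation compares two evaluations of the limit of integrals of g against Fejer kernels. *)

Local Notation Re := complex.Re.
Local Notation Im := complex.Im.

(** * Integrals over the real line and affine changes of variable *)

Section LineIntegrals.
Context {R : realType}.
Local Notation leb := (@lebesgue_measure R).
Implicit Types (f g : R -> R) (k : R).

Definition rint f : R := \int[leb]_x f x.
Definition rintegrable f : Prop := leb.-integrable setT (EFin \o f).

Lemma rintegrable_meas f : rintegrable f -> measurable_fun setT f.
Proof. by move=> /measurable_int /measurable_EFinP. Qed.

Lemma rintegrable_le f g : measurable_fun setT f ->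
  (forall x, `|f x| <= g x) -> rintegrable g -> rintegrable f.
Proof.
move=> mf fg; apply: le_integrable => //; first exact/measurable_EFinP.
by move=> x _ /=; rewrite lee_fin (le_trans (fg x))// ler_norm.
Qed.

Lemma rintegrable_norm f : rintegrable f -> rintegrable (fun x => `|f x|).
Proof. exact: integrable_norm. Qed.

Lemma rintegrableD f g : rintegrable f -> rintegrable g ->
  rintegrable (fun x => f x + g x).
Proof. by move=> /(integrableD measurableT) h /h. Qed.

Lemma rintegrableZ k f : rintegrable f -> rintegrable (fun x => k * f x).
Proof. exact: (integrableZl measurableT). Qed.

Lemma rintegrableB f g : rintegrable f -> rintegrable g ->
  rintegrable (fun x => f x - g x).
Proof. by move=> /(integrableB measurableT) h /h. Qed.

Lemma rintD f g : rintegrable f -> rintegrable g ->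
  rint (fun x => f x + g x) = rint f + rint g.
Proof. exact: RintegralD. Qed.

Lemma rintB f g : rintegrable f -> rintegrable g ->
  rint (fun x => f x - g x) = rint f - rint g.
Proof. exact: RintegralB. Qed.

Lemma rintZ k f : rintegrable f -> rint (fun x => k * f x) = k * rint f.
Proof. exact: RintegralZl. Qed.

Lemma le_rint f g : rintegrable f -> rintegrable g ->
  (forall x, f x <= g x) -> rint f <= rint g.
Proof. by move=> ? ? fg; apply: le_Rintegral. Qed.

Lemma rint_ge0 f : (forall x, 0 <= f x) -> 0 <= rint f.
Proof. by move=> f0; apply: Rintegral_ge0. Qed.

Lemma le_norm_rint f : rintegrable f -> `|rint f| <= rint (fun x => `|f x|).
Proof. exact: le_normr_Rintegral. Qed.

Lemma EFin_rint f : rintegrable f -> (\int[leb]_x (f x)%:E)%E = (rint f)%:E.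
Proof. by move=> fi; rewrite /rint /Rintegral fineK//; exact: integrable_fin_num. Qed.

Lemma rintegrableP f : measurable_fun setT f ->
  (\int[leb]_x `|(f x)%:E| < +oo)%E -> rintegrable f.
Proof. by move=> mf h; apply/integrableP; split=> //; exact/measurable_EFinP. Qed.

(** Lebesgue measure is [|a|] times its image under x -> ax + b. By uniqueness this is checked on
    intervals []c, d]], whose preimages are half-open on the left or on the right according to the
    sign of [a]. *)
Lemma ge0_integral_affine (a b : R) (h : R -> \bar R) :
  a != 0 -> measurable_fun setT h -> (forall x, 0 <= h x)%E ->
  (\int[leb]_x h x = `|a|%:E * \int[leb]_x h (a * x + b)%R)%E.
Proof.
move=> a0 mh h0.
pose phi : measurableTypeR R -> measurableTypeR R := fun x : R => a * x + b.
have mphi : measurable_fun setT phi.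
  by apply: measurable_funD => //; exact: measurable_funM.
have -> : (\int[leb]_x h (a * x + b)%R)%E = (\int[leb]_(x in phi @^-1` setT) (h \o phi) x)%E.
  by rewrite preimage_setT.
rewrite -(ge0_integral_pushforward mphi leb measurableT)//.
rewrite -[X in (X%:E * _)%E]/((NngNum (normr_ge0 a))%:num).
rewrite -ge0_integral_mscale//.
apply: eq_measure_integral => A mA _.
apply: lebesgue_measure_unique => // _ [[c d] _ <-].
change (leb `]c, d]%classic = (`|a|%:E * leb (phi @^-1` `]c, d]%classic))%E).
have [apos|aneg|/eqP] := ltgtP a 0; last by rewrite (negbTE a0).
- have -> : phi @^-1` [set` `]c, d]] = [set` `[(d - b) / a, (c - b) / a[].
    apply/seteqP; split => x /=; rewrite !in_itv/= /phi => /andP[h1 h2].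
      rewrite ler_ndivrMr// ltr_ndivlMr//; apply/andP; split; lra.
    by move: h1 h2; rewrite ler_ndivrMr// ltr_ndivlMr// => *; apply/andP; split; lra.
  rewrite !lebesgue_measure_itv/= !lte_fin ltr_nM2r ?invr_lt0// ltrBlDr subrK.
  case: ifP => cd; last by rewrite mule0.
  rewrite -!EFinB -EFinM ltr0_norm//; congr (_%:E); field.
  by rewrite lt_eqF.
- have -> : phi @^-1` [set` `]c, d]] = [set` `](c - b) / a, (d - b) / a]].
    apply/seteqP; split => x /=; rewrite !in_itv/= /phi => /andP[h1 h2].
      rewrite ler_pdivlMr// ltr_pdivrMr//; apply/andP; split; lra.
    by move: h1 h2; rewrite ler_pdivlMr// ltr_pdivrMr// => *; apply/andP; split; lra.
  rewrite !lebesgue_measure_itv/= !lte_fin ltr_pM2r ?invr_gt0// ltrBlDr subrK.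
  case: ifP => cd; last by rewrite mule0.
  rewrite -!EFinB -EFinM gtr0_norm//; congr (_%:E); field.
  by rewrite gt_eqF.
Qed.

Lemma measurable_fun_affine (a b : R) d (T : measurableType d) (h : R -> T) :
  measurable_fun setT h -> measurable_fun setT (fun x : R => h (a * x + b)).
Proof.
move=> mh; apply: (measurableT_comp mh).
exact: measurable_funD.
Qed.

Lemma rintegrable_affine (a b : R) f : a != 0 -> rintegrable f ->
  rintegrable (fun x => f (a * x + b)).
Proof.
move=> a0 fi; have mf := rintegrable_meas fi; apply: rintegrableP.
  exact: (measurable_fun_affine a b mf).
case/integrableP: fi => _ /=.
rewrite (@ge0_integral_affine a b (fun x => `|(f x)%:E|%E))//; last first.
  by apply: measurableT_comp => //; exact/measurable_EFinP.
have : (0 <= \int[leb]_x `|(f (a * x + b)%R)%:E|)%E by exact: integral_ge0.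
(* An infinite integral of the transformed function would stay infinite after multiplication by
   [|a|]. *)
case: (integral _ _ _) => [r _ _||]; rewrite ?ltry//.
by rewrite gt0_muley// lte_fin normr_gt0.
Qed.

Lemma rint_affine (a b : R) f : a != 0 -> rintegrable f ->
  rint f = `|a| * rint (fun x => f (a * x + b)).
Proof.
move=> a0 fi; have mf := rintegrable_meas fi.
have mp : measurable_fun setT (EFin \o f)^\+%E by apply: measurable_funepos; exact/measurable_EFinP.
have mn : measurable_fun setT (EFin \o f)^\-%E by apply: measurable_funeneg; exact/measurable_EFinP.
have ai := rintegrable_affine b a0 fi.
have fp := integrable_pos_fin_num measurableT ai.
have fn := integrable_neg_fin_num measurableT ai.
rewrite /rint /Rintegral integralE [in RHS]integralE.
have -> : (\int[leb]_x (fun x : R => (f x)%:E)^\+ x =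
    `|a|%:E * \int[leb]_x (EFin \o (fun x : R => f (a * x + b)%R))^\+ x)%E.
  etransitivity; first exact: (ge0_integral_affine b a0 mp (funepos_ge0 _)).
  by congr (_ * _)%E; apply: eq_integral => x _; rewrite !funepos.unlock.
have -> : (\int[leb]_x (fun x : R => (f x)%:E)^\- x =
    `|a|%:E * \int[leb]_x (EFin \o (fun x : R => f (a * x + b)%R))^\- x)%E.
  etransitivity; first exact: (ge0_integral_affine b a0 mn (funeneg_ge0 _)).
  by congr (_ * _)%E; apply: eq_integral => x _; rewrite !funeneg.unlock.
by rewrite -(fineK fp) -(fineK fn) -!EFinM -!EFinB /= mulrBr.
Qed.

End LineIntegrals.

(** * Change of variables by an increasing C^1 bijection from an open set onto the line *)

Section Substitution.
Context {R : realType}.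
Local Notation leb := (@lebesgue_measure R).

Section PositiveSubstitution.
Variables (D : set R) (al be : nat -> R) (phi dphi : R -> R).
Hypotheses (albe : forall n, al n < be n) (al_noninc : nonincreasing_seq al)
  (be_nondec : nondecreasing_seq be)
  (DE : D = \bigcup_n `[al n, be n]%classic) (openD : open D).
Hypotheses (dphiE : forall x, D x -> is_derive x 1 phi (dphi x))
  (dphic : forall x, D x -> {for x, continuous dphi})
  (dphi_gt0 : forall x, D x -> 0 < dphi x).
Hypotheses (phi_al : forall A, exists n, phi (al n) <= A)
  (phi_be : forall A, exists n, A <= phi (be n)).

Let derphi x : D x -> (derive1 phi) x = dphi x.
Proof. by move=> Dx; rewrite derive1E; apply: derive_val; exact: dphiE. Qed.

Let contphi' x : D x -> {for x, continuous (derive1 phi)}.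
Proof.
move=> Dx; rewrite /prop_for /continuous_at derphi//.
apply: cvg_trans (dphic Dx); apply: near_eq_cvg.
have : \forall y \near x, D y by exact: open_nbhs_nbhs.
by apply: filterS => y Dy; rewrite derphi.
Qed.

Let contphi x : D x -> {for x, continuous phi}.
Proof.
move=> Dx; apply: differentiable_continuous; apply/derivable1_diffP.
by apply: ex_derive; exact: dphiE.
Qed.

Let subD n : `[al n, be n] `<=` D.
Proof. by move=> x; rewrite DE => ?; exists n. Qed.

Let withinphi n : {within `[al n, be n], continuous phi}.
Proof.
by apply: derivable_within_continuous => x xn; apply: ex_derive; apply: dphiE; exact: (subD xn).
Qed.

Let incphi n : {in `[al n, be n] &, {homo phi : x y / x < y}}.
Proof.
apply: gtr0_derive1_lt_cc => // x /subset_itv_oo_cc xn.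
  by apply: ex_derive; apply: dphiE; exact: (subD xn).
by rewrite derphi ?dphi_gt0//; exact: (subD xn).
Qed.

Let mono_al n m : (n <= m)%N -> phi (al m) <= phi (al n).
Proof.
move=> nm; have := al_noninc nm; rewrite le_eqVlt => /predU1P[->//|h].
have h2 : al n <= be m by rewrite (le_trans (ltW (albe n)))// be_nondec.
by apply/ltW/(@incphi m) => //; rewrite in_itv/= ?lexx ?(ltW (albe m)) ?(ltW h).
Qed.

Let mono_be n m : (n <= m)%N -> phi (be n) <= phi (be m).
Proof.
move=> nm; have := be_nondec nm; rewrite le_eqVlt => /predU1P[->//|h].
have h2 : al m <= be n by rewrite (le_trans _ (ltW (albe n)))// al_noninc.
by apply/ltW/(@incphi m) => //; rewrite in_itv/= ?lexx ?(ltW (albe m)) ?h2 ?(ltW h).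
Qed.

(** Substitution on each compact interval [[al n, be n]], followed by monotone convergence on both
    sides. The hypotheses [phi_al] and [phi_be] make the image intervals exhaust the line. *)
Lemma ge0_substitution (g : R -> R) : continuous g -> (forall x, 0 <= g x) ->
  (\int[leb]_x (g x)%:E = \int[leb]_(x in D) (g (phi x) * dphi x)%:E)%E.
Proof.
move=> cg g0.
have mg : measurable_fun setT g by exact: continuous_measurable_fun.
have compact_subst n : (\int[leb]_(x in `[phi (al n), phi (be n)]) (g x)%:E =
    \int[leb]_(x in `[al n, be n]) (g (phi x) * dphi x)%:E)%E.
  have aD : D (al n) by apply: (@subD n); rewrite /= in_itv/= lexx ltW.
  have bD : D (be n) by apply: (@subD n); rewrite /= in_itv/= lexx ltW.
  rewrite (@integration_by_substitution_increasing _ phi)//; first last.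
  - exact: continuous_subspaceT.
  - split.
    + by move=> x /subset_itv_oo_cc xn; apply: ex_derive; apply: dphiE; exact: (subD xn).
    + by apply: cvg_at_right_filter; exact: contphi.
    + by apply: cvg_at_left_filter; exact: contphi.
  - by apply/cvg_ex; exists ((derive1 phi) (be n)); apply: cvg_at_left_filter; exact: contphi'.
  - by apply/cvg_ex; exists ((derive1 phi) (al n)); apply: cvg_at_right_filter; exact: contphi'.
  - by move=> x /subset_itv_oo_cc xn; apply: contphi'; exact: (subD xn).
  - exact: ltW.
  apply: eq_integral => x; rewrite inE => xn /=.
  by rewrite !fctE derphi//; exact: (subD xn).
have cup : \bigcup_n `[phi (al n), phi (be n)]%classic = setT.
  apply/seteqP; split => // A _.
  have [n hn] := phi_al A; have [m hm] := phi_be A.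
  exists (maxn n m) => //=; rewrite in_itv/=; apply/andP; split.
    by apply: le_trans hn; apply: mono_al; rewrite leq_maxl.
  by apply: (le_trans hm); apply: mono_be; rewrite leq_maxr.
have mD : measurable D by exact: open_measurable.
have mgD : measurable_fun D (fun x => (g (phi x) * dphi x)%:E).
  apply/measurable_EFinP/measurable_funM.
    apply: measurableT_comp => //; apply: open_continuous_measurable_fun => //.
    by move=> x; rewrite inE; exact: contphi.
  by apply: open_continuous_measurable_fun => // x; rewrite inE; exact: dphic.
have L1 : (\int[leb]_(x in `[phi (al n), phi (be n)]) (g x)%:E @[n --> \oo] -->
    \int[leb]_x (g x)%:E)%E.
  rewrite -cup; apply: ge0_nondecreasing_set_cvg_integral => //.
  - move=> n m nm; rewrite subsetEset => x /=; rewrite !in_itv/= => /andP[h1 h2].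
    by rewrite (le_trans (mono_al nm) h1) (le_trans h2 (mono_be nm)).
  - by move=> n; apply/measurable_EFinP; exact: measurable_funS mg.
  - by move=> *; rewrite lee_fin.
have L2 : (\int[leb]_(x in `[al n, be n]) (g (phi x) * dphi x)%:E @[n --> \oo] -->
    \int[leb]_(x in D) (g (phi x) * dphi x)%:E)%E.
  rewrite [X in integral _ X _](DE); apply: ge0_nondecreasing_set_cvg_integral => //.
  - move=> n m nm; rewrite subsetEset => x /=; rewrite !in_itv/= => /andP[h1 h2].
    by rewrite (le_trans (al_noninc nm) h1) (le_trans h2 (be_nondec nm)).
  - by move=> n; apply: measurable_funS mgD => //; exact: subD.
  - by move=> n x xn; rewrite lee_fin mulr_ge0// ltW// dphi_gt0//; exact: (subD xn).
have E : (fun n => \int[leb]_(x in `[phi (al n), phi (be n)]) (g x)%:E)%E =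
    (fun n => \int[leb]_(x in `[al n, be n]) (g (phi x) * dphi x)%:E)%E.
  by apply/funext => n; exact: compact_subst.
by rewrite E in L1; exact: (cvg_unique _ L1 L2).
Qed.

Lemma substitution_integrable (g : R -> R) : continuous g -> rintegrable g ->
  leb.-integrable D (fun x => (g (phi x) * dphi x)%:E).
Proof.
move=> cg gi.
have mD : measurable D by exact: open_measurable.
have mgD : measurable_fun D (fun x => (g (phi x) * dphi x)%:E).
  apply/measurable_EFinP/measurable_funM.
    apply: measurableT_comp => //; first exact: continuous_measurable_fun.
    apply: open_continuous_measurable_fun => //.
    by move=> x; rewrite inE; exact: contphi.
  by apply: open_continuous_measurable_fun => // x; rewrite inE; exact: dphic.
apply/integrableP; split => //.
case/integrableP: gi => _ /=.
rewrite (@ge0_substitution (fun x => `|g x|))//; last first.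
  by move=> x; apply: continuous_comp; [exact: cg|exact: norm_continuous].
apply: le_lt_trans; rewrite le_eqVlt; apply/orP; left; apply/eqP.
apply: eq_integral => x; rewrite inE => Dx /=.
by rewrite normrM (gtr0_norm (dphi_gt0 Dx)).
Qed.

(** Multiplication by the positive [dphi x] commutes with taking positive and negative parts, so the
    nonnegative case applies to each part. *)
Lemma substitution (g : R -> R) : continuous g -> rintegrable g ->
  rint g = \int[leb]_(x in D) (g (phi x) * dphi x).
Proof.
move=> cg gi; rewrite /rint /Rintegral integralE [in RHS]integralE.
have cp : continuous (fun x => Num.max (g x) 0).
  by move=> x; apply: (@continuous_max _ _ g (cst 0) x); [exact: cg|exact: cst_continuous].
have cn : continuous (fun x => Num.max (- g x) 0).
  move=> x; apply: (@continuous_max _ _ (fun x => - g x) (cst 0) x); last exact: cst_continuous.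
  by apply: continuousN; exact: cg.
have ge0m (r : R) : 0 <= Num.max r 0 by rewrite le_max lexx orbT.
congr (fine (_ - _)%E).
- transitivity (\int[leb]_x (Num.max (g x) 0)%:E)%E.
    by apply: eq_integral => x _; rewrite funeposE EFin_max.
  rewrite (@ge0_substitution (fun x => Num.max (g x) 0))//.
  apply: eq_integral => x; rewrite inE => Dx; rewrite funeposE -EFin_max.
  by rewrite maxr_pMl ?mul0r// ltW// dphi_gt0.
- transitivity (\int[leb]_x (Num.max (- g x) 0)%:E)%E.
    by apply: eq_integral => x _; rewrite funenegE EFin_max.
  rewrite (@ge0_substitution (fun x => Num.max (- g x) 0))//.
  apply: eq_integral => x; rewrite inE => Dx; rewrite funenegE -EFinN -EFin_max.
  by rewrite maxr_pMl ?mulNr ?mul0r// ltW// dphi_gt0.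
Qed.

End PositiveSubstitution.
End Substitution.

(** * Complex numbers: coordinates, the real-valued modulus [normc], the exponential *)

Notation normc := ComplexField.Normc.normc.

Section ComplexNumbers.
Context {R : realType}.
Implicit Types (z w : R[i]) (x : R).

Lemma complex_eqP z w : Re z = Re w -> Im z = Im w -> z = w.
Proof. by case: z w => [a b] [c d] /= -> ->. Qed.

Lemma cReD z w : Re (z + w) = Re z + Re w. Proof. by case: z w => [a b] []. Qed.
Lemma cImD z w : Im (z + w) = Im z + Im w. Proof. by case: z w => [a b] []. Qed.
Lemma cReN z : Re (- z) = - Re z. Proof. by case: z. Qed.
Lemma cImN z : Im (- z) = - Im z. Proof. by case: z. Qed.
Lemma cReB z w : Re (z - w) = Re z - Re w. Proof. by rewrite cReD cReN. Qed.
Lemma cImB z w : Im (z - w) = Im z - Im w. Proof. by rewrite cImD cImN. Qed.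
Lemma cReM z w : Re (z * w) = Re z * Re w - Im z * Im w.
Proof. by case: z w => [a b] []. Qed.
Lemma cImM z w : Im (z * w) = Re z * Im w + Im z * Re w.
Proof. by case: z w => [a b] []. Qed.
Lemma cReMr z x : Re (z * x%:C) = Re z * x.
Proof. by rewrite cReM /= mulr0 subr0. Qed.
Lemma cImMr z x : Im (z * x%:C) = Im z * x.
Proof. by rewrite cImM /= mulr0 add0r. Qed.

Lemma Re_sum I (r : seq I) (P : pred I) (F : I -> R[i]) :
  Re (\sum_(i <- r | P i) F i) = \sum_(i <- r | P i) Re (F i).
Proof. by elim/big_rec2 : _ => // i _ z _ <-; rewrite cReD. Qed.

Lemma Im_sum I (r : seq I) (P : pred I) (F : I -> R[i]) :
  Im (\sum_(i <- r | P i) F i) = \sum_(i <- r | P i) Im (F i).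
Proof. by elim/big_rec2 : _ => // i _ z _ <-; rewrite cImD. Qed.

Lemma normcE2 z : normc z = Num.sqrt (Re z ^+ 2 + Im z ^+ 2).
Proof. by case: z. Qed.

Lemma normc_ge0 z : 0 <= normc z. Proof. by rewrite normcE2 sqrtr_ge0. Qed.
Lemma normcR x : normc x%:C = `|x|.
Proof. by rewrite normcE2 /= expr0n /= addr0 sqrtr_sqr. Qed.
Lemma normc_nat n : normc (n%:R : R[i]) = n%:R.
Proof. by rewrite -(rmorph_nat (real_complex R)) normcR ger0_norm. Qed.
Lemma normcX z n : normc (z ^+ n) = normc z ^+ n.
Proof.
elim: n => [|n IH]; first by rewrite !expr0 ComplexField.Normc.normc1.
by rewrite !exprS ComplexField.Normc.normcM IH.
Qed.
Lemma normc_eq0P z : (normc z == 0) = (z == 0).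
Proof.
apply/eqP/eqP => [/ComplexField.Normc.eq0_normc//|->].
exact: ComplexField.Normc.normc0.
Qed.
Lemma normc_gt0 z : (0 < normc z) = (z != 0).
Proof. by rewrite lt0r normc_ge0 andbT normc_eq0P. Qed.

Lemma ler_Re_normc z : `|Re z| <= normc z.
Proof. by rewrite normcE2 -sqrtr_sqr ler_sqrt ?addr_ge0 ?sqr_ge0// lerDl sqr_ge0. Qed.
Lemma ler_Im_normc z : `|Im z| <= normc z.
Proof. by rewrite normcE2 -sqrtr_sqr ler_sqrt ?addr_ge0 ?sqr_ge0// lerDr sqr_ge0. Qed.
Lemma normc_le_ReIm z : normc z <= `|Re z| + `|Im z|.
Proof.
rewrite normcE2 -[leRHS]ger0_norm ?addr_ge0// -sqrtr_sqr ler_sqrt ?sqr_ge0//.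
by rewrite sqrrD !real_normK ?num_real// -addrA lerD2l lerDr mulrn_wge0// mulr_ge0.
Qed.

Lemma normc_sum I (r : seq I) (P : pred I) (F : I -> R[i]) :
  normc (\sum_(i <- r | P i) F i) <= \sum_(i <- r | P i) normc (F i).
Proof.
elim/big_rec2 : _ => [|i x z _ h]; first by rewrite ComplexField.Normc.normc0.
by rewrite (le_trans (le_normcD _ _))// lerD2l.
Qed.

Lemma normcB z w : normc (z - w) = normc (w - z).
Proof. by rewrite -normcN opprB. Qed.

Lemma cexpD z w : cexp (z + w) = cexp z * cexp w.
Proof.
apply: complex_eqP; rewrite /cexp !(cReM, cImM) /= cReD cImD expRD cosD sinD; ring.
Qed.
Lemma cexpR x : cexp x%:C = (expR x)%:C.
Proof. by apply: complex_eqP; rewrite /cexp !(cReM, cImM) /= cos0 sin0; ring. Qed.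
Lemma cexp0 : cexp 0 = 1 :> R[i].
Proof. by rewrite -[0]/(0%:C) cexpR expR0. Qed.
Lemma normc_cexp z : normc (cexp z) = expR (Re z).
Proof.
rewrite /cexp ComplexField.Normc.normcM normcR ger0_norm ?expR_ge0//.
by rewrite normcE2 /= cos2Dsin2 sqrtr1 mulr1.
Qed.
Lemma cexp_neq0 z : cexp z != 0.
Proof. by rewrite -normc_gt0 normc_cexp expR_gt0. Qed.
Lemma cexpN z : cexp (- z) = (cexp z)^-1.
Proof.
by apply: (mulfI (cexp_neq0 z)); rewrite -cexpD subrr cexp0 divff ?cexp_neq0.
Qed.
Lemma cexpB z w : cexp (z - w) = cexp z / cexp w.
Proof. by rewrite cexpD cexpN. Qed.
Lemma cexpMn z n : cexp (n%:R * z) = cexp z ^+ n.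
Proof.
elim: n => [|n IH]; first by rewrite mul0r cexp0 expr0.
by rewrite exprS -IH -cexpD mulrS mulrDl mul1r.
Qed.

End ComplexNumbers.

(** * Measurability and integration of complex functions *)

Section ComplexMeasurability.
Context {R : realType} d (T : measurableType d).
Implicit Types F G : T -> R[i].

Definition cmeas F : Prop := measurable_fun setT (fun t => Re (F t)) /\
  measurable_fun setT (fun t => Im (F t)).

Lemma cmeas_cst (c : R[i]) : cmeas (fun=> c).
Proof. by split; exact: measurable_cst. Qed.

Lemma cmeas_real (f : T -> R) : measurable_fun setT f -> cmeas (fun t => (f t)%:C).
Proof. by move=> mf; split => //=; exact: measurable_cst. Qed.

Lemma cmeasD F G : cmeas F -> cmeas G -> cmeas (fun t => F t + G t).
Proof.
move=> [F1 F2] [G1 G2]; split.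
- by under eq_fun do rewrite cReD; exact: measurable_funD.
- by under eq_fun do rewrite cImD; exact: measurable_funD.
Qed.

Lemma cmeasM F G : cmeas F -> cmeas G -> cmeas (fun t => F t * G t).
Proof.
move=> [F1 F2] [G1 G2]; split.
- under eq_fun do rewrite cReM.
  by apply: measurable_funB; exact: measurable_funM.
- under eq_fun do rewrite cImM.
  by apply: measurable_funD; exact: measurable_funM.
Qed.

Lemma cmeasN F : cmeas F -> cmeas (fun t => - F t).
Proof.
move=> [F1 F2]; split.
- by under eq_fun do rewrite cReN; exact: measurable_funN.
- by under eq_fun do rewrite cImN; exact: measurable_funN.
Qed.

Lemma cmeasB F G : cmeas F -> cmeas G -> cmeas (fun t => F t - G t).
Proof. by move=> mF mG; apply: cmeasD => //; exact: cmeasN. Qed.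

Lemma cmeas_sum I (r : seq I) (F : I -> T -> R[i]) :
  (forall i, cmeas (F i)) -> cmeas (fun t => \sum_(i <- r) F i t).
Proof.
move=> mF; elim: r => [|i r IH].
  by under eq_fun do rewrite big_nil; exact: cmeas_cst.
by under eq_fun do rewrite big_cons; exact: cmeasD.
Qed.

Lemma cmeas_cexp F : cmeas F -> cmeas (fun t => cexp (F t)).
Proof.
move=> [F1 F2]; apply: cmeasM.
  by apply: cmeas_real; apply: measurableT_comp.
split => /=; apply: measurableT_comp => //.
  by apply: continuous_measurable_fun; exact: continuous_cos.
by apply: continuous_measurable_fun; exact: continuous_sin.
Qed.

Lemma cmeas_norm F : cmeas F -> measurable_fun setT (fun t => normc (F t)).
Proof.
move=> [F1 F2]; under eq_fun do rewrite normcE2.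
apply: (@measurableT_comp _ _ _ _ _ _ (@Num.sqrt R)).
  by apply: continuous_measurable_fun; exact: sqrt_continuous.
by apply: measurable_funD; apply: measurable_funX.
Qed.

End ComplexMeasurability.

Lemma cmeas_comp {R : realType} d (T : measurableType d) d' (T' : measurableType d')
    (F : T -> R[i]) (h : T' -> T) :
  cmeas F -> measurable_fun setT h -> cmeas (fun t => F (h t)).
Proof. by move=> [F1 F2] mh; split; [exact: (measurableT_comp F1)|exact: (measurableT_comp F2)]. Qed.

Section ComplexIntegral.
Context {R : realType}.
Local Notation leb := (@lebesgue_measure R).
Implicit Types (F G : R -> R[i]) (c : R[i]).
Local Notation cint := (cintegral setT).
Local Notation cintg := (cintegrable setT).

Lemma cintg_meas F : cintg F -> cmeas F.
Proof. by move=> [F1 F2]; split; exact: rintegrable_meas. Qed.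

Lemma cintg_le F (g : R -> R) : cmeas F -> (forall x, normc (F x) <= g x) ->
  rintegrable g -> cintg F.
Proof.
move=> [F1 F2] Fg gi; split.
- by apply: (rintegrable_le _ _ gi) => // x; exact: le_trans (ler_Re_normc _) (Fg x).
- by apply: (rintegrable_le _ _ gi) => // x; exact: le_trans (ler_Im_normc _) (Fg x).
Qed.

Lemma cintg_norm F : cintg F -> rintegrable (fun x => normc (F x)).
Proof.
move=> Fi; have [F1 F2] := Fi.
apply: (@rintegrable_le R _ (fun x => `|Re (F x)| + `|Im (F x)|)).
- by apply: cmeas_norm; exact: cintg_meas.
- by move=> x; rewrite ger0_norm ?normc_ge0// normc_le_ReIm.
- by apply: rintegrableD; exact: rintegrable_norm.
Qed.

Lemma cintgD F G : cintg F -> cintg G -> cintg (fun x => F x + G x).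
Proof.
move=> Fi Gi; apply: (@cintg_le _ (fun x => normc (F x) + normc (G x))).
- by apply: cmeasD; exact: cintg_meas.
- by move=> x; exact: le_normcD.
- by apply: rintegrableD; exact: cintg_norm.
Qed.

Lemma cintgZ c F : cintg F -> cintg (fun x => c * F x).
Proof.
move=> Fi; apply: (@cintg_le _ (fun x => normc c * normc (F x))).
- by apply: cmeasM; [exact: cmeas_cst|exact: cintg_meas].
- by move=> x; rewrite ComplexField.Normc.normcM.
- by apply: rintegrableZ; exact: cintg_norm.
Qed.

Lemma cintgN F : cintg F -> cintg (fun x => - F x).
Proof. by move=> Fi; under eq_fun do rewrite -mulN1r; exact: cintgZ. Qed.

Lemma cintgB F G : cintg F -> cintg G -> cintg (fun x => F x - G x).
Proof. by move=> Fi Gi; apply: cintgD => //; exact: cintgN. Qed.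

Lemma cintD F G : cintg F -> cintg G ->
  cint (fun x => F x + G x) = cint F + cint G.
Proof.
move=> [F1 F2] [G1 G2]; apply: complex_eqP; rewrite ?(cReD, cImD) /=.
- by rewrite -RintegralD//; apply: eq_Rintegral => x _; rewrite cReD.
- by rewrite -RintegralD//; apply: eq_Rintegral => x _; rewrite cImD.
Qed.

Lemma cintZ c F : cintg F -> cint (fun x => c * F x) = c * cint F.
Proof.
move=> [F1 F2]; apply: complex_eqP; rewrite ?(cReM, cImM) /=.
- rewrite -!RintegralZl// -RintegralB//; last 2 first.
    + exact: (rintegrableZ _ F1).
    + exact: (rintegrableZ _ F2).
  by apply: eq_Rintegral => x _; rewrite cReM.
- rewrite -!RintegralZl// -RintegralD//; last 2 first.
    + exact: (rintegrableZ _ F2).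
    + exact: (rintegrableZ _ F1).
  by apply: eq_Rintegral => x _; rewrite cImM.
Qed.

Lemma cintZr c F : cintg F -> cint (fun x => F x * c) = cint F * c.
Proof. by move=> Fi; rewrite [RHS]mulrC -cintZ//; congr (cint _); apply/funext => x; rewrite mulrC. Qed.

Lemma cintN F : cintg F -> cint (fun x => - F x) = - cint F.
Proof. by move=> Fi; under eq_fun do rewrite -mulN1r; rewrite cintZ// mulN1r. Qed.

Lemma cintB F G : cintg F -> cintg G ->
  cint (fun x => F x - G x) = cint F - cint G.
Proof. by move=> Fi Gi; rewrite cintD ?cintN//; exact: cintgN. Qed.

Lemma cintg0 : cintg (fun=> 0 : R[i]).
Proof. by split => /=; exact: integrable0. Qed.

Lemma cint0 : cint (fun=> 0 : R[i]) = 0.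
Proof. by apply: complex_eqP => /=; rewrite Rintegral_cst// mul0r. Qed.

Lemma cintg_sum I (r : seq I) (F : I -> R -> R[i]) :
  (forall i, cintg (F i)) -> cintg (fun t => \sum_(i <- r) F i t).
Proof.
move=> Fi; elim: r => [|i r IH].
  by under eq_fun do rewrite big_nil; exact: cintg0.
by under eq_fun do rewrite big_cons; exact: cintgD.
Qed.

Lemma cint_sum I (r : seq I) (F : I -> R -> R[i]) :
  (forall i, cintg (F i)) ->
  cint (fun t => \sum_(i <- r) F i t) = \sum_(i <- r) cint (F i).
Proof.
move=> Fi; elim: r => [|i r IH].
  by under eq_fun do rewrite big_nil; rewrite big_nil cint0.
under eq_fun do rewrite big_cons.
by rewrite cintD ?big_cons ?IH//; exact: cintg_sum.
Qed.

Lemma cintR (f : R -> R) : cint (fun x => (f x)%:C) = (rint f)%:C.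
Proof. by apply: complex_eqP => //=; rewrite Rintegral_cst// mul0r. Qed.

Lemma cintgR (f : R -> R) : rintegrable f -> cintg (fun x => (f x)%:C).
Proof. by move=> fi; split => //=; exact: integrable0. Qed.

(** After multiplication by the phase [u] that makes the integral real and nonnegative, only the
    real part of the integrand counts, and it is at most the modulus. *)
Lemma le_normc_cint F : cintg F -> normc (cint F) <= rint (fun x => normc (F x)).
Proof.
move=> Fi; set I := cint F.
have [I0|I0] := eqVneq I 0.
  by rewrite I0 ComplexField.Normc.normc0 rint_ge0// => x; exact: normc_ge0.
pose u := (normc I)%:C / I.
have uI : u * I = (normc I)%:C by rewrite /u divfK.
have nu : normc u = 1.
  rewrite /u ComplexField.Normc.normcM ComplexField.Normc.normcV normcR.
  by rewrite ger0_norm ?normc_ge0// divff// normc_eq0P.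
have : Re (cint (fun x => u * F x)) = normc I by rewrite cintZ// uI.
move=> <- /=; apply: le_rint; [by case: (cintgZ u Fi)|exact: cintg_norm|].
move=> x; apply: le_trans (ler_norm _) _; apply: le_trans (ler_Re_normc _) _.
by rewrite ComplexField.Normc.normcM nu mul1r.
Qed.

Lemma cint_le F (g : R -> R) : cmeas F -> (forall x, normc (F x) <= g x) ->
  rintegrable g -> normc (cint F) <= rint g.
Proof.
move=> mF Fg gi; have Fi := cintg_le mF Fg gi.
by apply: le_trans (le_normc_cint Fi) _; apply: le_rint => //; exact: cintg_norm.
Qed.

Lemma cintg_affine (a b : R) F : a != 0 -> cintg F -> cintg (fun x => F (a * x + b)).
Proof.
by move=> a0 [F1 F2]; split; [exact: (rintegrable_affine b a0 F1)|exact: (rintegrable_affine b a0 F2)].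
Qed.

Lemma cint_affine (a b : R) F : a != 0 -> cintg F ->
  cint F = `|a|%:C * cint (fun x => F (a * x + b)).
Proof.
move=> a0 [F1 F2]; apply: complex_eqP; rewrite ?(cReM, cImM) /= mul0r ?subr0 ?addr0.
- exact: (rint_affine b a0 F1).
- exact: (rint_affine b a0 F2).
Qed.

Lemma cint_shift (b : R) F : cintg F -> cint (fun x => F (x + b)) = cint F.
Proof.
move=> Fi; rewrite [RHS](@cint_affine 1 b F)// normr1 mul1r.
by congr (cint _); apply/funext => x; rewrite mul1r.
Qed.

Lemma cintg_shift (b : R) F : cintg F -> cintg (fun x => F (x + b)).
Proof.
move=> Fi; have := @cintg_affine 1 b F (oner_neq0 _) Fi.
by under eq_fun do rewrite mul1r.
Qed.

Lemma cint_reflect (b : R) F : cintg F -> cint (fun x => F (b - x)) = cint F.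
Proof.
move=> Fi; rewrite [RHS](@cint_affine (-1) b F)// ?oppr_eq0 ?oner_eq0// normrN normr1 mul1r.
by congr (cint _); apply/funext => x; rewrite mulN1r addrC.
Qed.

Lemma cintg_reflect (b : R) F : cintg F -> cintg (fun x => F (b - x)).
Proof.
move=> Fi; have := @cintg_affine (-1) b F _ Fi; rewrite oppr_eq0 oner_eq0 => /(_ isT).
by under eq_fun do rewrite mulN1r addrC.
Qed.

End ComplexIntegral.

(** * Exchange of integrals *)

Section RealFubini.
Context {R : realType}.
Local Notation leb := (@lebesgue_measure R).
Local Notation RR := (measurableTypeR R * measurableTypeR R)%type.

(** Partial integrals in Fubini's theorem are extended reals that are finite only almost everywhere;
    [fine] makes them real functions without changing the integral. *)
Lemma fine_integral (G : R -> \bar R) : leb.-integrable setT G ->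
  rintegrable (fun y => fine (G y)) /\
  (\int[leb]_y (fine (G y))%:E = \int[leb]_y G y)%E.
Proof.
move=> Gi; have mG : measurable_fun setT G by case/integrableP: Gi.
have mf : measurable_fun setT (EFin \o (fun y => fine (G y))).
  by apply/measurable_EFinP; exact: (measurableT_comp (@fine_measurable R _ measurableT) mG).
have E : ae_eq leb setT (EFin \o (fun y => fine (G y))) G.
  have := integrable_ae measurableT Gi.
  by apply: filterS => y /(_ I) h _ /=; rewrite fineK.
split; last exact: ae_eq_integral.
apply/integrableP; split => //.
case/integrableP : Gi => _; apply: le_lt_trans; rewrite le_eqVlt; apply/orP; left; apply/eqP.
apply: ae_eq_integral => //.
- by apply: measurableT_comp.
- by apply: measurableT_comp.
- by move: E; apply: filterS => y h /h ->.
Qed.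

(** A dominating [g] whose iterated integral exists in a single order suffices: Tonelli turns it
    into joint integrability of [f]. *)
Lemma rint_fubini (f : R -> R -> R) (g : R -> R -> R) :
  measurable_fun setT (fun p : RR => f p.1 p.2) ->
  (forall x, rintegrable (g x)) -> rintegrable (fun x => rint (g x)) ->
  (forall x y, `|f x y| <= g x y) ->
  [/\ rintegrable (fun x => rint (f x)),
      rintegrable (fun y => rint (f^~ y)) &
      rint (fun x => rint (f x)) = rint (fun y => rint (f^~ y))].
Proof.
move=> mf gi Igi fg.
pose h : RR -> \bar R := EFin \o (fun p : RR => f p.1 p.2).
have mh : measurable_fun setT h by exact/measurable_EFinP.
have mfx x : measurable_fun setT (f x).
  exact: (measurableT_comp mf (@pair1_measurable _ _ (measurableTypeR R) (measurableTypeR R) x)).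
have fxi x : rintegrable (f x).
  by apply: (rintegrable_le (mfx x) _ (gi x)).
have hi : (leb \x leb)%E.-integrable setT h.
  apply/integrable12ltyP => //.
  apply: (@le_lt_trans _ _ (\int[leb]_x (rint (g x))%:E)%E); last first.
    by rewrite EFin_rint// ltry.
  apply: ge0_le_integral => //.
  - by move=> x _; exact: integral_ge0.
  - have mabs : measurable_fun setT (abse \o h) by exact: measurableT_comp.
    by have := @measurable_fun_fubini_tonelli_F _ _ _ _ R leb _ mabs (fun=> abse_ge0 _).
  - by apply/measurable_EFinP; have := rintegrable_meas Igi.
  - move=> x _; rewrite -EFin_rint//; apply: ge0_le_integral => //.
    + apply: measurableT_comp => //.
      exact: (measurableT_comp mh (@pair1_measurable _ _ (measurableTypeR R) (measurableTypeR R) x)).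
    + by apply/measurable_EFinP; have := rintegrable_meas (gi x).
    + by move=> y _; rewrite lee_fin.
have hF := integrable_fubini_F hi.
have mabs : measurable_fun setT (abse \o h) by exact: measurableT_comp.
have hG : leb.-integrable setT (fubini_G leb h).
  apply/integrableP; split; first exact: measurable_fubini_G hi.
  apply: le_lt_trans (iffLR (integrable21ltyP leb leb mh) hi).
  apply: ge0_le_integral => //.
  - by apply: measurableT_comp => //; exact: measurable_fubini_G hi.
  - by have := @measurable_fun_fubini_tonelli_G _ _ _ _ R leb _ mabs (fun=> abse_ge0 _).
  - move=> y _; apply: le_abse_integral => //.
    exact: (measurableT_comp mh (@pair2_measurable _ _ (measurableTypeR R) (measurableTypeR R) y)).
have [Fi FE] := fine_integral hF.
have [Gi GE] := fine_integral hG.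
split=> //.
have := Fubini hi; rewrite /rint /Rintegral.
move=> E; congr fine; etransitivity; first exact: FE.
by etransitivity; last exact: esym GE.
Qed.

End RealFubini.

Section ComplexFubini.
Context {R : realType}.
Local Notation RR := (measurableTypeR R * measurableTypeR R)%type.
Local Notation cint := (cintegral setT).
Local Notation cintg := (cintegrable setT).

Lemma cint_fubini (F : R -> R -> R[i]) (g : R -> R -> R) :
  cmeas (fun p : RR => F p.1 p.2) ->
  (forall x, rintegrable (g x)) -> rintegrable (fun x => rint (g x)) ->
  (forall x y, normc (F x y) <= g x y) ->
  [/\ cintg (fun x => cint (F x)), cintg (fun y => cint (F^~ y)) &
      cint (fun x => cint (F x)) = cint (fun y => cint (F^~ y))].
Proof.
move=> [F1 F2] gi Igi Fg.
have [] := @rint_fubini R (fun x y => Re (F x y)) g F1 gi Igi.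
  by move=> x y; exact: le_trans (ler_Re_normc _) (Fg x y).
have [] := @rint_fubini R (fun x y => Im (F x y)) g F2 gi Igi.
  by move=> x y; exact: le_trans (ler_Im_normc _) (Fg x y).
by move=> a1 a2 a3 b1 b2 b3; split => //; apply: complex_eqP.
Qed.

Lemma cint_fubini_prod (F : R -> R -> R[i]) (f g : R -> R) :
  cmeas (fun p : RR => F p.1 p.2) -> rintegrable f -> rintegrable g ->
  (forall x y, normc (F x y) <= f x * g y) ->
  [/\ cintg (fun x => cint (F x)), cintg (fun y => cint (F^~ y)) &
      cint (fun x => cint (F x)) = cint (fun y => cint (F^~ y))].
Proof.
move=> mF fi gi Fg; apply: (@cint_fubini F (fun x y => f x * g y)) => //.
- by move=> x; exact: rintegrableZ.
- under eq_fun do rewrite rintZ// mulrC.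
  exact: rintegrableZ.
Qed.

Lemma cmeas_sect2 (F : R -> R -> R[i]) x :
  cmeas (fun p : RR => F p.1 p.2) -> cmeas (F x).
Proof.
move=> mF; have mx := @pair1_measurable _ _ (measurableTypeR R) (measurableTypeR R) x.
exact: (cmeas_comp mF mx).
Qed.

Lemma cmeas_sect1 (F : R -> R -> R[i]) y :
  cmeas (fun p : RR => F p.1 p.2) -> cmeas (F^~ y).
Proof.
move=> mF; have my := @pair2_measurable _ _ (measurableTypeR R) (measurableTypeR R) y.
exact: (cmeas_comp mF my).
Qed.

End ComplexFubini.

(** * Complex limits and dominated convergence *)

Section ComplexSequences.
Context {R : realType}.
Implicit Types (u v : nat -> R[i]) (l m : R[i]).

(** Convergence is stated through the real modulus so that the theory of real limits applies to it;
    [ccvg_topology] carries it to the topology of [(R[i])^o] in which [csum] and [tricomi] take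
    their limits. *)
Definition ccvg u l : Prop := normc (u n - l) @[n --> \oo] --> (0 : R).

Lemma ccvg_le u l (w : R ^nat) : (forall n, normc (u n - l) <= w n) ->
  w @ \oo --> (0 : R) -> ccvg u l.
Proof.
move=> h w0; apply: (@squeeze_cvgr _ _ _ _ (fun=> 0) w) => //.
  by near=> n; rewrite normc_ge0 h.
exact: cvg_cst.
Unshelve. all: by end_near. Qed.

Lemma ccvg_near_le u l (w : R ^nat) : (\forall n \near \oo, normc (u n - l) <= w n) ->
  w @ \oo --> (0 : R) -> ccvg u l.
Proof.
move=> h w0; apply: (@squeeze_cvgr _ _ _ _ (fun=> 0) w) => //.
  by apply: filterS h => n ->; rewrite normc_ge0.
exact: cvg_cst.
Qed.

Lemma ccvg_ReIm u l : Re (u n) @[n --> \oo] --> Re l ->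
  Im (u n) @[n --> \oo] --> Im l -> ccvg u l.
Proof.
move=> h1 h2; apply: (@ccvg_le _ _ (fun n => `|Re (u n) - Re l| + `|Im (u n) - Im l|)).
  by move=> n; rewrite -cReB -cImB normc_le_ReIm.
rewrite -[X in _ --> X]addr0; apply: cvgD.
  by apply/norm_cvg0P/subr_cvg0.
by apply/norm_cvg0P/subr_cvg0.
Qed.

Lemma ccvg_Re u l : ccvg u l -> Re (u n) @[n --> \oo] --> Re l.
Proof.
move=> h; apply/subr_cvg0; apply/norm_cvg0P; apply: (squeeze_cvgr _ (cvg_cst 0) h).
by near=> n; rewrite normr_ge0/= -cReB ler_Re_normc.
Unshelve. all: by end_near. Qed.

Lemma ccvg_Im u l : ccvg u l -> Im (u n) @[n --> \oo] --> Im l.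
Proof.
move=> h; apply/subr_cvg0; apply/norm_cvg0P; apply: (squeeze_cvgr _ (cvg_cst 0) h).
by near=> n; rewrite normr_ge0/= -cImB ler_Im_normc.
Unshelve. all: by end_near. Qed.

Lemma ccvg_unique u l m : ccvg u l -> ccvg u m -> l = m.
Proof.
move=> h1 h2; apply: complex_eqP.
- by apply: (cvg_unique _ (ccvg_Re h1) (ccvg_Re h2)).
- by apply: (cvg_unique _ (ccvg_Im h1) (ccvg_Im h2)).
Qed.

Lemma ccvgD u v l m : ccvg u l -> ccvg v m -> ccvg (fun n => u n + v n) (l + m).
Proof.
move=> h1 h2; apply: (ccvg_le (w := fun n => normc (u n - l) + normc (v n - m))).
  by move=> n; rewrite opprD addrACA le_normcD.
by rewrite -[X in _ --> X]addr0; apply: cvgD.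
Qed.

Lemma ccvgM u v l m : ccvg u l -> ccvg v m -> ccvg (fun n => u n * v n) (l * m).
Proof.
move=> h1 h2; apply: ccvg_ReIm.
- rewrite cReM; under eq_fun do rewrite cReM.
  by apply: cvgB; apply: cvgM; do ?[exact: ccvg_Re|exact: ccvg_Im].
- rewrite cImM; under eq_fun do rewrite cImM.
  by apply: cvgD; apply: cvgM; do ?[exact: ccvg_Re|exact: ccvg_Im].
Qed.

Lemma ccvg_cst l : ccvg (fun=> l) l.
Proof. by apply: ccvg_ReIm; exact: cvg_cst. Qed.

Lemma ccvgZ c u l : ccvg u l -> ccvg (fun n => c * u n) (c * l).
Proof. by apply: ccvgM; exact: ccvg_cst. Qed.

Lemma ccvgR (u : nat -> R) (l : R) : u n @[n --> \oo] --> l -> ccvg (fun n => (u n)%:C) l%:C.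
Proof. by move=> h; apply: ccvg_ReIm => //=; exact: cvg_cst. Qed.

Lemma ccvg_shiftn N u l : ccvg u l <-> ccvg (fun n => u (n + N)%N) l.
Proof.
by rewrite /ccvg -(cvg_shiftn N (fun n => normc (u n - l))).
Qed.

Lemma ccvg_topology u l : ccvg u l -> (u n : (R[i])^o) @[n --> \oo] --> (l : (R[i])^o).
Proof.
move=> h; apply/cvgrPdist_lt => e e0.
have [r r0 eE] : exists2 r : R, 0 < r & e = r%:C.
  by case: e e0 => [a b]; rewrite ltcE/= => /andP[/eqP -> a0]; exists a.
have /cvgrPdist_lt/(_ r r0) := h; apply: filterS => n.
rewrite sub0r normrN ger0_norm ?normc_ge0// eE => hn.
by rewrite distrC normc_def -normcE2 ltcR.
Qed.

End ComplexSequences.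

Section DominatedConvergence.
Context {R : realType}.
Local Notation leb := (@lebesgue_measure R).
Local Notation cint := (cintegral setT).
Local Notation cintg := (cintegrable setT).

Lemma rint_dominated (f : nat -> R -> R) (h g : R -> R) :
  (forall n, measurable_fun setT (f n)) ->
  (forall x, f n x @[n --> \oo] --> h x) ->
  (forall n x, `|f n x| <= g x) -> rintegrable g ->
  rintegrable h /\ rint (f n) @[n --> \oo] --> rint h.
Proof.
move=> mf fh fg gi.
have mh : measurable_fun setT h by apply: (measurable_fun_cvg mf) => x _; exact: fh.
have hg x : `|h x| <= g x.
  apply: (@ler_cvg_to _ \oo _ _ (fun n => `|f n x|) (fun=> g x)); [exact: cvg_norm|exact: cvg_cst|].
  by near=> n.
have hi : rintegrable h by exact: rintegrable_le gi.
split => //.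
have fi n : rintegrable (f n) by apply: rintegrable_le gi.
have := @dominated_cvg _ _ R leb setT measurableT (fun n x => (f n x)%:E) (EFin \o h) (EFin \o g).
move=> /(_ _ _ _ gi) H.
have {H} : (\int[leb]_x (f n x)%:E @[n --> \oo] --> \int[leb]_x (h x)%:E)%E.
  apply: H => //.
  - by move=> n; have /measurable_EFinP := mf n.
  - by move=> x _; apply: cvg_EFin; [near=> n|exact: fh].
  - by move=> n x _; rewrite lee_fin.
rewrite (EFin_rint hi); under eq_fun do rewrite (EFin_rint (fi _)).
by move=> /fine_cvgP [_].
Unshelve. all: by end_near. Qed.

Lemma cint_dominated (F : nat -> R -> R[i]) (H : R -> R[i]) (g : R -> R) :
  (forall n, cmeas (F n)) -> (forall x, ccvg (F^~ x) (H x)) ->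
  (forall n x, normc (F n x) <= g x) -> rintegrable g ->
  cintg H /\ ccvg (fun n => cint (F n)) (cint H).
Proof.
move=> mF FH Fg gi.
have [||||h1 c1] := @rint_dominated (fun n x => Re (F n x)) (fun x => Re (H x)) g; last 1 first.
have [||||h2 c2] := @rint_dominated (fun n x => Im (F n x)) (fun x => Im (H x)) g; last 1 first.
- by split=> //; exact: ccvg_ReIm.
- by move=> n; exact: (mF n).2.
- by move=> x; exact: ccvg_Im.
- by move=> n x; exact: le_trans (ler_Im_normc _) (Fg n x).
- by [].
- by move=> n; exact: (mF n).1.
- by move=> x; exact: ccvg_Re.
- by move=> n x; exact: le_trans (ler_Re_normc _) (Fg n x).
- by [].
Qed.

End DominatedConvergence.

(** * Complex substitution and the fundamental theorem of calculus on the line *)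

Section ComplexSubstitution.
Context {R : realType}.
Local Notation leb := (@lebesgue_measure R).
Local Notation cint := (cintegral setT).
Local Notation cintg := (cintegrable setT).

Definition ccont (F : R -> R[i]) := continuous (fun x => Re (F x)) /\ continuous (fun x => Im (F x)).

Lemma ccont_meas F : ccont F -> cmeas F.
Proof. by move=> [F1 F2]; split; exact: continuous_measurable_fun. Qed.

Lemma ccont_cst c : ccont (fun=> c).
Proof. by split => x; exact: cvg_cst. Qed.
Lemma ccontR (f : R -> R) : continuous f -> ccont (fun x => (f x)%:C).
Proof. by move=> cf; split => //= x; exact: cvg_cst. Qed.
Lemma ccontD F G : ccont F -> ccont G -> ccont (fun x => F x + G x).
Proof.
move=> [F1 F2] [G1 G2]; split => x.
- under eq_fun do rewrite cReD.
  by rewrite /prop_for /continuous_at; apply: cvgD; [exact: F1|exact: G1].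
- under eq_fun do rewrite cImD.
  by rewrite /prop_for /continuous_at; apply: cvgD; [exact: F2|exact: G2].
Qed.
Lemma ccontM F G : ccont F -> ccont G -> ccont (fun x => F x * G x).
Proof.
move=> [F1 F2] [G1 G2]; split => x.
- under eq_fun do rewrite cReM.
  rewrite /prop_for /continuous_at.
  by apply: cvgB; apply: cvgM; do ?[exact: F1|exact: G1|exact: F2|exact: G2].
- under eq_fun do rewrite cImM.
  rewrite /prop_for /continuous_at.
  by apply: cvgD; apply: cvgM; do ?[exact: F1|exact: G1|exact: F2|exact: G2].
Qed.
Lemma ccont_cexp F : ccont F -> ccont (fun x => cexp (F x)).
Proof.
move=> [F1 F2]; apply: ccontM.
  apply: ccontR => x; apply: continuous_comp; [exact: F1|exact: continuous_expR].
split=> x /=; apply: continuous_comp => /=.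
- exact: F2.
- exact: continuous_cos.
- exact: F2.
- exact: continuous_sin.
Qed.

Variables (D : set R) (al be : nat -> R) (phi dphi : R -> R).
Hypotheses (albe : forall n, al n < be n) (al_noninc : nonincreasing_seq al)
  (be_nondec : nondecreasing_seq be)
  (DE : D = \bigcup_n `[al n, be n]%classic) (openD : open D).
Hypotheses (dphiE : forall x, D x -> is_derive x 1 phi (dphi x))
  (dphic : forall x, D x -> {for x, continuous dphi})
  (dphi_gt0 : forall x, D x -> 0 < dphi x).
Hypotheses (phi_al : forall A, exists n, phi (al n) <= A)
  (phi_be : forall A, exists n, A <= phi (be n)).

Lemma cint_substitution F : ccont F -> cintg F ->
  cintegrable D (fun x => F (phi x) * (dphi x)%:C) /\
  cint F = cintegral D (fun x => F (phi x) * (dphi x)%:C).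
Proof.
move=> [F1 F2] [Fi1 Fi2]; split.
  split; under eq_fun do rewrite ?(cReMr,cImMr).
  - exact: (substitution_integrable albe al_noninc be_nondec DE openD dphiE dphic dphi_gt0 phi_al phi_be F1 Fi1).
  - exact: (substitution_integrable albe al_noninc be_nondec DE openD dphiE dphic dphi_gt0 phi_al phi_be F2 Fi2).
apply: complex_eqP => /=.
- rewrite -[LHS]/(rint (fun x => Re (F x))) (substitution albe al_noninc be_nondec DE openD dphiE dphic dphi_gt0 phi_al phi_be F1 Fi1).
  by apply: eq_Rintegral => x _; rewrite cReMr.
- rewrite -[LHS]/(rint (fun x => Im (F x))) (substitution albe al_noninc be_nondec DE openD dphiE dphic dphi_gt0 phi_al phi_be F2 Fi2).
  by apply: eq_Rintegral => x _; rewrite cImMr.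
Qed.

End ComplexSubstitution.

Section LineFTC.
Context {R : realType}.
Local Notation leb := (@lebesgue_measure R).

Lemma rint_itv_cvg (f : R -> R) : rintegrable f ->
  (\int[leb]_(x in `[- n%:R, n%:R]) f x) @[n --> \oo] --> rint f.
Proof.
move=> fi.
pose fn (n : nat) := f \_ `[- n%:R, n%:R]%classic.
have -> : (fun n => \int[leb]_(x in `[- n%:R, n%:R]) f x) = (fun n => rint (fn n)).
  by apply/funext => n; rewrite Rintegral_mkcond.
apply: (rint_dominated (g := fun x => `|f x|) _ _ _ _).2.
- move=> n; rewrite /fn; apply/(measurable_restrictT f) => //.
  apply: measurable_funTS; exact: (rintegrable_meas fi).
- move=> x; apply: cvg_near_cst.
  near=> n; rewrite /fn patchE ifT//.
  rewrite inE/= in_itv/= -ler_norml; near: n; exact: nbhs_infty_ger.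
- by move=> n x; rewrite /fn patchE; case: ifP => //; rewrite normr0.
- exact: rintegrable_norm.
Unshelve. all: by end_near. Qed.

(** Integrability of [f] makes its integrals over [[-n, n]] converge, so limits of [F] along the
    integers are enough. *)
Lemma rint_derive (F f : R -> R) (a b : R) :
  (forall x : R, is_derive x 1 F (f x)) -> continuous f -> rintegrable f ->
  F n%:R @[n --> \oo] --> a -> F (- n%:R) @[n --> \oo] --> b ->
  rint f = a - b.
Proof.
move=> dF cf fi Fa Fb.
have h := rint_itv_cvg fi.
have hF : (F n%:R - F (- n%:R)) @[n --> \oo] --> a - b by exact: cvgB.
apply: (cvg_unique _ h) => //.
apply: cvg_trans hF; apply: near_eq_cvg; near=> n.
have n0 : (0 < n%:R :> R) by rewrite ltr0n; near: n; exact: nbhs_infty_gt.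
have nn : (- n%:R < n%:R :> R) by rewrite gtrN.
have cF : continuous F.
  move=> x; apply: differentiable_continuous; apply/derivable1_diffP.
  by have [] := dF x.
rewrite /Rintegral (@continuous_FTC2 _ _ F)//.
- exact: continuous_subspaceT.
- split=> [x _||]; [by have [] := dF x| |].
  + by apply: cvg_at_right_filter; exact: cF.
  + by apply: cvg_at_left_filter; exact: cF.
- by move=> x _; rewrite derive1E; apply: derive_val.
Unshelve. all: by end_near. Qed.

Lemma is_derive_expcos (p q : R -> R) (p' q' x : R) :
  is_derive x 1 p p' -> is_derive x 1 q q' ->
  is_derive x 1 (fun u => expR (p u) * cos (q u))
    (expR (p x) * (p' * cos (q x) - q' * sin (q x))).
Proof.
move=> dp dq.
have d1 : is_derive x 1 (expR \o p) (expR (p x) * p').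
  exact: is_derive1_comp.
have d2 : is_derive x 1 (cos \o q) (- sin (q x) * q').
  exact: is_derive1_comp.
have d3 := is_deriveM d1 d2.
apply: is_derive_eq; rewrite /GRing.scale /=; ring.
Qed.

Lemma is_derive_expsin (p q : R -> R) (p' q' x : R) :
  is_derive x 1 p p' -> is_derive x 1 q q' ->
  is_derive x 1 (fun u => expR (p u) * sin (q u))
    (expR (p x) * (p' * sin (q x) + q' * cos (q x))).
Proof.
move=> dp dq.
have d1 : is_derive x 1 (expR \o p) (expR (p x) * p').
  exact: is_derive1_comp.
have d2 : is_derive x 1 (sin \o q) (cos (q x) * q').
  exact: is_derive1_comp.
have d3 := is_deriveM d1 d2.
apply: is_derive_eq; rewrite /GRing.scale /=; ring.
Qed.

End LineFTC.

(** * Exponential decay and elementary inequalities *)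

Section ExponentialBounds.
Context {R : realType}.
Local Notation leb := (@lebesgue_measure R).

Lemma expX_le (x : R) m : 0 <= x -> x ^+ m <= m`!%:R * expR x.
Proof.
move=> x0; case: m => [|m]; first by rewrite expr0 mul1r -[leLHS]expR0 ler_expR.
have := expR_ge1Dxn m x0 => h.
have f0 : 0 < (m.+1)`!%:R :> R by rewrite ltr0n fact_gt0.
by rewrite mulrC -ler_pdivrMr// (le_trans _ h)// lerDr.
Qed.

(** This is the bound t^m <= m! e^t at t = y e^u. *)
Lemma exp_exp_le (y u : R) m : 0 < y ->
  expR (- (y * expR u)) * expR (m%:R * u) <= m`!%:R / y ^+ m.
Proof.
move=> y0; rewrite ler_pdivlMr ?exprn_gt0//.
have := @expX_le (y * expR u) m (mulr_ge0 (ltW y0) (expR_ge0 _)).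
rewrite exprMn -expRM_natl => h.
rewrite -mulrA mulrC [X in X * _]mulrC -ler_pdivlMr ?expR_gt0//.
by rewrite expRN invrK.
Qed.

Lemma rintegrable_expabs (k : R) : 0 < k -> rintegrable (fun u => expR (- k * `|u|)).
Proof.
move=> k0.
have cf : continuous (fun u : R => expR (- k * `|u|)).
  move=> u; apply: continuous_comp; last exact: continuous_expR.
  by apply: cvgM; [exact: cvg_cst|exact: norm_continuous].
apply: rintegrableP; first exact: continuous_measurable_fun.
have -> : (\int[leb]_u `|(expR (- k * `|u|))%:E| = \int[leb]_u (expR (- k * `|u|))%:E)%E.
  by apply: eq_integral => u _; rewrite /= ger0_norm ?expR_ge0.
rewrite (ge0_symfun_integralT (fun x => expR_ge0 _) cf); last first.
  by move=> x /=; rewrite normrN.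
have -> : [set x : R | 0 <= x] = `[0, +oo[%classic.
  by apply/seteqP; split => x /=; rewrite in_itv/= andbT.
have -> : (\int[leb]_(x in `[0%R, +oo[) (expR (- k * `|x|))%:E =
    \int[leb]_(x in `[0%R, +oo[) (expR (- k * x))%:E)%E.
  by apply: eq_integral => x; rewrite inE/= in_itv/= andbT => x0; rewrite ger0_norm.
pose F (x : R) := - k^-1 * expR (- k * x).
have dF (x : R) : is_derive x 1 F (expR (- k * x)).
  have d : is_derive x 1 (fun u : R => - k * u) (- k).
    by apply: is_derive_eq; rewrite /GRing.scale /= mulr1.
  have d1 : is_derive x 1 (expR \o (fun u => - k * u)) (- k * expR (- k * x)).
    by rewrite mulrC; exact: is_derive1_comp.
  apply: is_derive_eq; rewrite /GRing.scale /= mulrA mulrNN mulVf ?mul1r//.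
  by rewrite gt_eqF.
have cF : continuous F.
  move=> x; apply: differentiable_continuous; apply/derivable1_diffP.
  by have [] := dF x.
rewrite (@ge0_continuous_FTC2y _ _ F 0 0)//.
- by rewrite lte_mul_pinfty// ltry.
- apply: continuous_subspaceT => x; apply: continuous_comp; last exact: continuous_expR.
  by apply: cvgM; [exact: cvg_cst|exact: cvg_id].
- rewrite -(mulr0 (- k^-1)); apply: cvgM; first exact: cvg_cst.
  under eq_fun do rewrite mulNr.
  apply: (@cvg_comp _ _ _ (fun x => k * x) (fun x => expR (- x)) _ +oo%R).
    by apply: gt0_cvgMry => //; exact: cvg_id.
  exact: cvgr_expR.
- by apply: cvg_at_right_filter; exact: cF.
- by move=> x _; rewrite derive1E; apply: derive_val.
Qed.

Lemma rintegrable_expdecay (f : R -> R) (C k : R) : measurable_fun setT f -> 0 < k ->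
  (forall u, `|f u| <= C * expR (- k * `|u|)) -> rintegrable f.
Proof.
move=> mf k0 fC; apply: (rintegrable_le mf fC).
by apply: rintegrableZ; exact: rintegrable_expabs.
Qed.

(** At +oo the term e^u dominates. At -oo it is y e^{-u} when [y] is positive, and otherwise the
    factor e^{su} decays because [s] is positive. *)
Lemma kernel_decay (y s : R) : 0 <= y -> 0 < y \/ 0 < s ->
  exists C k : R, [/\ 0 < C, 0 < k & forall u,
    expR (- expR u - y * expR (- u) + s * u) <= C * expR (- k * `|u|)].
Proof.
move=> y0 ys.
(* A power exceeding |s| + 1 absorbs e^{su} and leaves a spare factor e^{-|u|}. *)
pose m := (Num.truncn (`|s| + 1)).+1.
have mk : `|s| + 1 <= m%:R by apply: ltW; exact: truncnS_gt.
have s1 : s + 1 <= m%:R by apply: le_trans mk; rewrite lerD2r ler_norm.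
have s2 : - s + 1 <= m%:R by apply: le_trans mk; rewrite lerD2r -normrN ler_norm.
have m0 : (0 < m`!%:R :> R) by rewrite ltr0n fact_gt0.
have upos (u : R) : 0 <= u -> expR (- expR u - y * expR (- u) + s * u) <=
    m`!%:R * expR (- `|u|).
  move=> u0; have := @exp_exp_le 1 u m ltr01; rewrite expr1n divr1 mul1r => h.
  rewrite ger0_norm// -ler_pdivrMr ?expR_gt0// -expRN opprK -expRD.
  apply: le_trans h; rewrite -expRD ler_expR.
  have := expR_ge0 (- u) => e0; have := mulr_ge0 y0 e0 => h1.
  have := ler_wpM2r u0 s1 => h3; lra.
have [y1|y1] := ltP 0 y.
  pose C := m`!%:R + m`!%:R / y ^+ m.
  have m1 : 0 < m`!%:R / y ^+ m by rewrite divr_gt0// exprn_gt0.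
  exists C, 1; split => //; first by rewrite addr_gt0.
  move=> u; rewrite mulN1r; have [u0|u0] := leP 0 u.
    by apply: (le_trans (upos u u0)); rewrite ler_pM2r ?expR_gt0// lerDl ltW.
  have := @exp_exp_le y (- u) m y1 => h.
  apply: (@le_trans _ _ (m`!%:R / y ^+ m * expR (- `|u|))); last first.
    by rewrite ler_pM2r ?expR_gt0// lerDr ltW.
  rewrite -ler_pdivrMr ?expR_gt0// -expRN opprK -expRD.
  apply: le_trans h; rewrite -expRD ler_expR ltr0_norm//.
  have := expR_ge0 u => e0.
  have nu0 : 0 <= - u by rewrite oppr_ge0 ltW.
  have := ler_wpM2r nu0 s2 => h3; lra.
have y00 : y = 0 by apply/eqP; rewrite eq_le y0 y1.
have s0 : 0 < s by case: ys => //; rewrite y00 ltxx.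
(* For [y = 0] the rate on the negative side is only [s]. *)
pose k := Num.min 1 s.
have k0 : 0 < k by rewrite lt_min ltr01.
have k1 : k <= 1 by rewrite ge_min lexx.
have ks : k <= s by rewrite ge_min lexx orbT.
exists (m`!%:R), k; split => // u.
have [u0|u0] := leP 0 u.
  apply: (le_trans (upos u u0)); rewrite ler_pM2l// ler_expR ger0_norm// mulNr lerN2.
  by rewrite -[leRHS]mul1r ler_wpM2r.
apply: (@le_trans _ _ (1 * expR (- k * `|u|))); last first.
  by rewrite ler_pM2r ?expR_gt0// ler1n fact_gt0.
rewrite mul1r ler_expR y00 mul0r subr0 ltr0_norm// mulrNN.
have := expR_ge0 u => e0.
have nu0 : 0 <= - u by rewrite oppr_ge0 ltW.
have := ler_wpM2r nu0 ks => h3; lra.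
Qed.

End ExponentialBounds.

Section ElementaryBounds.
Context {R : realType}.

Lemma norm_sin_le (t : R) : `|sin t| <= `|t|.
Proof.
wlog t0 : t / 0 <= t.
  move=> h; have [t0|t0] := leP 0 t; first exact: h.
  by rewrite -normrN -sinN -(normrN t); apply: h; rewrite oppr_ge0 ltW.
have cs : {within `[0, t], continuous (@sin R)}.
  by apply: continuous_subspaceT; exact: continuous_sin.
have [c _] := MVT_segment t0 (fun x _ => is_derive_sin x) cs.
rewrite sin0 !subr0 => ->; rewrite normrM.
by rewrite -[leRHS]mul1r ler_wpM2r// cos_max.
Qed.

Lemma cos_ge (t : R) : 1 - t ^+ 2 / 2 <= cos t.
Proof.
have -> : cos t = 1 - 2 * sin (t / 2) ^+ 2.
  have -> : cos t = cos (t / 2 *+ 2) by congr cos; rewrite -mulr_natr; field.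
  by rewrite cos_mulr2n cos2sin2; ring.
have : sin (t / 2) ^+ 2 <= (t / 2) ^+ 2.
  by rewrite -real_normK ?num_real// -[leRHS]real_normK ?num_real// lerXn2r ?nnegrE// norm_sin_le.
by rewrite expr_div_n => h; lra.
Qed.

(** With a = e^{w/2} the bracket is (a - 1/a)^2. For w >= 0 one has a >= 1 + w/2 and 1/a <= 1, hence
    a - 1/a >= w/2. *)
Lemma sqr_le_cosh (w : R) : w ^+ 2 <= 4 * (expR w + expR (- w) - 2).
Proof.
wlog w0 : w / 0 <= w.
  move=> h; have [w0|w0] := leP 0 w; first exact: h.
  have := h (- w); rewrite oppr_ge0 (ltW w0) sqrrN opprK => /(_ isT) => h1.
  by rewrite (addrC (expR w)).
set a := expR (w / 2).
have a1 : 1 + w / 2 <= a by exact: expR_ge1Dx.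
have a0 : 0 < a by exact: expR_gt0.
have -> : expR w = a ^+ 2 by rewrite /a -expRM_natl; congr expR; field.
have -> : expR (- w) = a^-1 ^+ 2.
  by rewrite /a -expRN -expRM_natl; congr expR; field.
have ia : a^-1 <= 1 by rewrite invf_le1//; lra.
have -> : a ^+ 2 + a^-1 ^+ 2 - 2 = (a - a^-1) ^+ 2.
  by field; rewrite gt_eqF.
have h : w / 2 <= a - a^-1 by lra.
have : (w / 2) ^+ 2 <= (a - a^-1) ^+ 2.
  by rewrite lerXn2r ?nnegrE//; lra.
by rewrite expr_div_n => h1; lra.
Qed.

(** For z = a + ib, split e^z - 1 = e^a (e^{ib} - 1) + (e^a - 1) and bound the two terms by |b| e^a
    and |a| e^{|a|}. *)
Lemma normc_cexp_sub1 (z : R[i]) :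
  normc (cexp z - 1) <= normc z * expR (`|Re z|) *+ 2.
Proof.
pose a := Re z; pose b := Im z.
have e1 : `|expR a - 1| <= `|a| * expR `|a|.
  have [a0|a0] := leP 0 a.
    rewrite ger0_norm ?subr_ge0 ?(le_trans _ (expR_ge1Dx a)) ?lerDl// ger0_norm//.
    have := expR_ge1Dx (- a); rewrite expRN => h.
    have e0 := expR_gt0 a.
    have : (1 - a) * expR a <= 1 by rewrite -ler_pdivlMr// div1r.
    by rewrite mulrBl mul1r => h1; lra.
  rewrite ltr0_norm ?subr_lt0 ?expR_lt1// ltr0_norm//.
  have h := expR_ge1Dx a.
  have : - a <= - a * expR (- a).
    by rewrite ler_peMr ?oppr_ge0 ?(ltW a0)// -[leLHS]expR0 ler_expR oppr_ge0 ltW.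
  by move=> h1; lra.
have -> : cexp z - 1 = (expR a)%:C * ((cos b - 1) +i* sin b) + (expR a - 1)%:C.
  by apply: complex_eqP; rewrite /cexp ?(cReB, cImB, cReD, cImD, cReM, cImM) /=; ring.
apply: (le_trans (le_normcD _ _)); rewrite ComplexField.Normc.normcM !normcR.
rewrite (ger0_norm (expR_ge0 a)).
have e2 : normc ((cos b - 1) +i* sin b) <= `|b|.
  rewrite normcE2 /= -(sqrtr_sqr b).
  rewrite ler_sqrt ?sqr_ge0//.
  have -> : (cos b - 1) ^+ 2 + sin b ^+ 2 = 2 - 2 * cos b.
    by rewrite sin2cos2; ring.
  by have := cos_ge b => h; lra.
have aE : `|a| <= normc z := ler_Re_normc z.
have bE : `|b| <= normc z := ler_Im_normc z.
have ee : expR a <= expR `|a| by rewrite ler_expR ler_norm.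
rewrite mulr2n lerD//.
  rewrite mulrC ler_pM ?normc_ge0 ?expR_ge0//; exact: le_trans e2 bE.
by apply: (le_trans e1); rewrite ler_wpM2r// expR_ge0.
Qed.

End ElementaryBounds.

(** * Macdonald's integral with exponential variable, and the gamma integral as its value at 0 *)

Section Kernel.
Context {R : realType}.
Local Notation cint := (cintegral setT).
Local Notation cintg := (cintegrable setT).
Implicit Types (v z : R[i]) (y u : R).

(** With t = e^u, the integral [kint v y] is int_0^oo t^{v-1} e^{-t-y/t} dt, that is 2 y^{v/2} K_v(2
    sqrt y) for y > 0, and Euler's integral for y = 0. The exponential variable turns scalings of t
    into translations of the line. *)
Definition kker v y u : R[i] :=
  cexp ((- expR u - y * expR (- u))%:C + v * u%:C).

Definition kint v y : R[i] := cint (kker v y).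

Definition egamma z : R[i] := kint z 0.

Definition rgamma (s : R) : R := rint (fun u => expR (- expR u + s * u)).

Lemma normc_kker v y u :
  normc (kker v y u) = expR (- expR u - y * expR (- u) + Re v * u).
Proof. by rewrite /kker normc_cexp cReD cReMr. Qed.

Lemma ccont_id : ccont (fun u : R => u%:C).
Proof. by apply: ccontR => x; exact: cvg_id. Qed.

Lemma ccont_kker v y : ccont (kker v y).
Proof.
apply: ccont_cexp; apply: ccontD.
  apply: ccontR => u; apply: cvgB; first by apply: cvgN; exact: continuous_expR.
  apply: cvgM; first exact: cvg_cst.
  apply: continuous_comp; last exact: continuous_expR.
  by apply: cvgN; exact: cvg_id.
by apply: ccontM; [exact: ccont_cst|exact: ccont_id].
Qed.

Lemma kker_decay v y : 0 <= y -> 0 < y \/ 0 < Re v ->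
  exists C k : R, [/\ 0 < C, 0 < k & forall u, normc (kker v y u) <= C * expR (- k * `|u|)].
Proof.
move=> y0 /(kernel_decay y0) [C [k [C0 k0 h]]]; exists C, k; split => // u.
by rewrite normc_kker.
Qed.

Lemma cintg_kker v y : 0 <= y -> 0 < y \/ 0 < Re v -> cintg (kker v y).
Proof.
move=> y0 /(kker_decay y0) [C [k [C0 k0 h]]].
apply: cintg_le h _; first by apply: ccont_meas; exact: ccont_kker.
by apply: rintegrableZ; exact: rintegrable_expabs.
Qed.

Lemma expabs_cvg (k : R) : 0 < k -> expR (- k * n%:R) @[n --> \oo] --> 0.
Proof.
move=> k0; under eq_fun do rewrite mulNr.
have h : (k * x) @[x --> +oo] --> +oo by apply: (gt0_cvgMry k0); exact: cvg_id.
exact: (cvg_comp _ _ (cvg_comp _ _ cvgr_idn h) (@cvgr_expR R)).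
Qed.

Lemma decay_cvg (F : R -> R[i]) (C k : R) : 0 < k ->
  (forall u, normc (F u) <= C * expR (- k * `|u|)) ->
  ccvg (fun n => F n%:R) 0 /\ ccvg (fun n => F (- n%:R)) 0.
Proof.
move=> k0 h.
have c0 : C * expR (- k * n%:R) @[n --> \oo] --> 0.
  by rewrite -[X in _ --> X](mulr0 C); apply: cvgM; [exact: cvg_cst|exact: expabs_cvg].
split; apply: (ccvg_le (w := fun n => C * expR (- k * n%:R))) => // n;
  by rewrite subr0 (le_trans (h _))// ?normrN ger0_norm.
Qed.

Lemma cint_derive (F f : R -> R[i]) :
  (forall x : R, is_derive x 1 (fun u => Re (F u)) (Re (f x)) /\
    is_derive x 1 (fun u => Im (F u)) (Im (f x))) ->
  ccont f -> cintg f -> ccvg (fun n => F n%:R) 0 -> ccvg (fun n => F (- n%:R)) 0 ->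
  cint f = 0.
Proof.
move=> dF [f1 f2] [fi1 fi2] F1 F2; apply: complex_eqP => /=.
- rewrite -[LHS]/(rint (fun x => Re (f x))) (rint_derive (fun x => (dF x).1) f1 fi1 (ccvg_Re F1) (ccvg_Re F2)).
  by rewrite subrr.
- rewrite -[LHS]/(rint (fun x => Im (f x))) (rint_derive (fun x => (dF x).2) f2 fi2 (ccvg_Im F1) (ccvg_Im F2)).
  by rewrite subrr.
Qed.

Lemma kkerS v y u : kker (v + 1) y u = (expR u)%:C * kker v y u.
Proof. by rewrite /kker -cexpR -cexpD; congr cexp; ring. Qed.

Lemma kkerB v y u : kker (v - 1) y u = (expR (- u))%:C * kker v y u.
Proof.
by rewrite /kker -cexpR -cexpD; congr cexp; rewrite rmorphN /=; ring.
Qed.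

Lemma is_derive_kker v y (x : R) :
  let f := v * kker v y x - kker (v + 1) y x + y%:C * kker (v - 1) y x in
  is_derive x 1 (fun u => Re (kker v y u)) (Re f) /\
  is_derive x 1 (fun u => Im (kker v y u)) (Im f).
Proof.
move=> f.
pose p (u : R) := - expR u - y * expR (- u) + Re v * u.
pose q (u : R) := Im v * u.
pose p' := - expR x + y * expR (- x) + Re v.
have dp : is_derive x 1 p p'.
  have dN : is_derive x 1 (expR \o -%R) (expR (- x) * - 1).
    by apply: is_derive1_comp.
  rewrite /p -[fun _ => _]/((- expR) - (y *: (expR \o -%R)) + (Re v *: id)).
  by apply: is_derive_eq; rewrite /GRing.scale /= /p'; ring.
have dq : is_derive x 1 q (Im v).
  rewrite /q -[fun _ => _]/(Im v *: id).
  by apply: is_derive_eq; rewrite /GRing.scale /=; ring.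
have kE u : kker v y u = (expR (p u) * cos (q u)) +i* (expR (p u) * sin (q u)).
  rewrite /kker /cexp cReD cImD cReMr cImMr /= add0r -/(p u) -/(q u).
  by apply: complex_eqP; rewrite ?(cReM, cImM) /=; ring.
have fE : f = (p' +i* Im v) * kker v y x.
  rewrite /f kkerS kkerB; move: (kker v y x) => K; apply: complex_eqP; rewrite ?(cReD, cImD, cReN, cImN, cReM, cImM) /= /p'; ring.
split.
- under eq_fun do rewrite kE /=.
  have := is_derive_expcos dp dq => h; apply: is_derive_eq; rewrite fE kE cReM /=; ring.
- under eq_fun do rewrite kE /=.
  have := is_derive_expsin dp dq => h; apply: is_derive_eq; rewrite fE kE cImM /=; ring.
Qed.

(** Integration by parts: the derivative of [kker v y] is a combination of kernels with exponents v,
    v + 1 and v - 1, and its integral vanishes because the kernel decays at both ends. *)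
Lemma kint_rec v y : 0 <= y -> 0 < y \/ 0 < Re v ->
  kint (v + 1) y = v * kint v y + y%:C * kint (v - 1) y.
Proof.
move=> y0 yv.
have i0 := cintg_kker y0 yv.
have i1 : cintg (kker (v + 1) y).
  by apply: cintg_kker => //; case: yv => [?|h]; [left|right; rewrite cReD /= addr_gt0].
have i2 : cintg (fun u => y%:C * kker (v - 1) y u).
  (* At [y = 0] the kernel of exponent v - 1 may fail to be integrable; its coefficient is then
     0. *)
  have [y1|y1] := ltP 0 y; first by apply: cintgZ; apply: cintg_kker => //; left.
  have -> : y = 0 by apply/eqP; rewrite eq_le y0 y1.
  by under eq_fun do rewrite mul0r; exact: cintg0.
have e2 : cint (fun u => y%:C * kker (v - 1) y u) = y%:C * kint (v - 1) y.
  have [y1|y1] := ltP 0 y; first by rewrite cintZ//; apply: cintg_kker => //; left.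
  have -> : y = 0 by apply/eqP; rewrite eq_le y0 y1.
  by under eq_fun do rewrite mul0r; rewrite cint0 mul0r.
have i01 : cintg (fun u => v * kker v y u - kker (v + 1) y u).
  by apply: cintgB => //; exact: cintgZ.
have [C [k [C0 k0 hd]]] := kker_decay y0 yv.
have [c1 c2] := decay_cvg k0 hd.
have E : cint (fun u => v * kker v y u - kker (v + 1) y u + y%:C * kker (v - 1) y u) =
    v * kint v y - kint (v + 1) y + y%:C * kint (v - 1) y.
  by rewrite cintD// e2 cintB//; [rewrite cintZ|exact: cintgZ].
suff : v * kint v y - kint (v + 1) y + y%:C * kint (v - 1) y = 0.
  by move/eqP; rewrite addrAC subr_eq0 => /eqP.
rewrite -E; apply: (cint_derive (fun x => is_derive_kker v y x) _ _ c1 c2); last exact: cintgD.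
apply: ccontD; last by apply: ccontM; [exact: ccont_cst|exact: ccont_kker].
apply: ccontD; first by apply: ccontM; [exact: ccont_cst|exact: ccont_kker].
under eq_fun do rewrite -mulN1r.
by apply: ccontM; [exact: ccont_cst|exact: ccont_kker].
Qed.

Lemma egamma_rec z : 0 < Re z -> egamma (z + 1) = z * egamma z.
Proof.
by move=> z0; rewrite /egamma kint_rec ?lexx//; [rewrite mul0r addr0|right].
Qed.

(** The substitution u -> ln y - u exchanges e^u and y e^{-u}. This is the symmetry K_{-v} = K_v. *)
Lemma kint_reflect v y : 0 < y -> kint (- v) y = cpow y (- v) * kint v y.
Proof.
move=> y0; rewrite /kint -(@cint_reflect _ (ln y)); last first.
  by apply: cintg_kker; [exact: ltW|left].
rewrite /cpow -cintZ; last by apply: cintg_kker; [exact: ltW|left].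
congr (cint _); apply/funext => u; rewrite /kker -cexpD; congr cexp.
have ey : expR (ln y) = y by rewrite lnK// posrE.
rewrite opprB expRD (expRB u) ey.
have -> : y * (expR u / y) = expR u by field; rewrite gt_eqF.
by rewrite !rmorphB !rmorphN !rmorphM /=; ring.
Qed.

Lemma egammaR (s : R) : egamma s%:C = (rgamma s)%:C.
Proof.
rewrite /egamma /kint /rgamma -cintR; congr (cint _); apply/funext => u.
by rewrite /kker mul0r subr0 -rmorphM -rmorphD cexpR.
Qed.

Lemma rgamma_integrable (s : R) : 0 < s -> rintegrable (fun u => expR (- expR u + s * u)).
Proof.
move=> s0; have [] := @cintg_kker s%:C 0 (lexx 0) (or_intror s0).
by under eq_fun do rewrite /kker mul0r subr0 -rmorphM -rmorphD cexpR /=.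
Qed.

Lemma rgamma_rec (s : R) : 0 < s -> rgamma (s + 1) = s * rgamma s.
Proof.
move=> s0; apply: complexI; rewrite -egammaR rmorphD /= egamma_rec//.
by rewrite egammaR rmorphM.
Qed.

Lemma rgamma_gt0 (s : R) : 0 < s -> 0 < rgamma s.
Proof.
move=> s0; pose c : R := expR (- expR 1).
have mi : measurable [set` `[0, 1 : R]] by [].
have ii := integrable_indic_itv 0 (1 : R) true false.
pose g (u : R) := c * \1_`[0%R, 1%R]%classic u.
have gi : rintegrable g by apply: rintegrableZ.
apply: (@lt_le_trans _ _ (rint g)).
  rewrite rintZ//; apply: mulr_gt0; first exact: expR_gt0.
  rewrite /rint /Rintegral integral_indic// setIT.
  have h := @lebesgue_measure_itv R `[0%R, 1%R].
  rewrite /= lte_fin ltr01 -EFinB subr0 in h.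
  by apply: (@lt_le_trans _ _ (fine (1%:E : \bar R))); [exact: ltr01|rewrite -h].
apply: le_rint => //; first exact: rgamma_integrable.
move=> u; rewrite /g indicE; case: (boolP (u \in _)) => [|_]; last by rewrite mulr0 expR_ge0.
rewrite inE /= in_itv/= => /andP[u0 u1]; rewrite mulr1 ler_expR.
have h1 := mulr_ge0 (ltW s0) u0.
have h2 : expR u <= expR 1 by rewrite ler_expR.
lra.
Qed.

Lemma normc_kint_le v y : 0 <= y -> 0 < Re v -> normc (kint v y) <= rgamma (Re v).
Proof.
move=> y0 v0; apply: cint_le.
- by apply: ccont_meas; exact: ccont_kker.
- move=> u; rewrite normc_kker ler_expR.
  by have := mulr_ge0 y0 (expR_ge0 (- u)); lra.
- exact: rgamma_integrable.
Qed.

(** Dropping the factor exp(-y e^{-u}) costs at most y e^{-u}, which lowers the exponent by one;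
    this is why the real part must exceed 1. *)
Lemma kint_egamma_le v y : 0 <= y -> 1 < Re v ->
  normc (kint v y - egamma v) <= y * rgamma (Re v - 1).
Proof.
move=> y0 v1; have v0 : 0 < Re v by exact: lt_trans v1.
have i1 : cintg (kker v y) by apply: cintg_kker => //; right.
have i2 : cintg (kker v 0) by apply: cintg_kker => //; right.
rewrite /egamma /kint -cintB// -rintZ; last by apply: rgamma_integrable; rewrite subr_gt0.
apply: cint_le; last by apply: rintegrableZ; apply: rgamma_integrable; rewrite subr_gt0.
  by apply: cintg_meas; exact: cintgB.
move=> u.
have -> : kker v y u - kker v 0 u = kker v 0 u * (expR (- (y * expR (- u))) - 1)%:C.
  rewrite rmorphB /= mulrBr mulr1 -cexpR; congr (_ - _).
  by rewrite /kker -cexpD; congr cexp; rewrite mul0r subr0 rmorphB rmorphN /=; ring.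
rewrite ComplexField.Normc.normcM normc_kker normcR mul0r subr0.
have -> : expR (- expR u + (Re v - 1) * u) = expR (- expR u + Re v * u) * expR (- u).
  by rewrite -expRD; congr expR; ring.
rewrite mulrCA ler_pM2l ?expR_gt0//.
have h0 : 0 <= y * expR (- u) by rewrite mulr_ge0// expR_ge0.
rewrite ler0_norm ?subr_le0 ?expR_le1 ?oppr_le0//.
by have := expR_ge1Dx (- (y * expR (- u))); lra.
Qed.

End Kernel.

Lemma Re_cexp {R : realType} (z : R[i]) : Re (cexp z) = expR (Re z) * cos (Im z).
Proof. by rewrite /cexp cReM /= mul0r subr0. Qed.

Lemma Im_cexp {R : realType} (z : R[i]) : Im (cexp z) = expR (Re z) * sin (Im z).
Proof. by rewrite /cexp cImM /= mul0r addr0. Qed.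

(** * Rising factorials and the gamma recurrence *)

Section Pochhammer.
Context {R : realType}.
Implicit Types (a z : R[i]) (s : R).

Lemma pochhammer0 a : pochhammer a 0 = 1.
Proof. by rewrite /pochhammer big_ord0. Qed.

Lemma pochhammerSr a k : pochhammer a k.+1 = pochhammer a k * (a + k%:R).
Proof. by rewrite /pochhammer big_ord_recr. Qed.

Lemma pochhammerSl a k : pochhammer a k.+1 = a * pochhammer (a + 1) k.
Proof.
rewrite /pochhammer big_ord_recl /= addr0; congr (_ * _).
by apply: eq_bigr => j _; rewrite /bump /= add1n mulrS addrA.
Qed.

Definition rpochhammer s k : R := \prod_(j < k) (s + j%:R).

Lemma rpochhammerSr s k : rpochhammer s k.+1 = rpochhammer s k * (s + k%:R).
Proof. by rewrite /rpochhammer big_ord_recr. Qed.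

Lemma rpochhammer_gt0 s k : 0 < s -> 0 < rpochhammer s k.
Proof. by move=> s0; apply: prodr_gt0 => j _; rewrite ltr_wpDr. Qed.

Lemma Re_nat n : Re (n%:R : R[i]) = n%:R.
Proof. by rewrite -(rmorph_nat (real_complex R)). Qed.

Lemma Im_nat n : Im (n%:R : R[i]) = 0.
Proof. by rewrite -(rmorph_nat (real_complex R)). Qed.

Lemma rpochhammer_le z k : 0 < Re z -> rpochhammer (Re z) k <= normc (pochhammer z k).
Proof.
move=> z0; elim: k => [|k IH].
  by rewrite /rpochhammer /pochhammer !big_ord0 ComplexField.Normc.normc1.
rewrite rpochhammerSr pochhammerSr ComplexField.Normc.normcM ler_pM//.
- by rewrite ltW// rpochhammer_gt0.
- by rewrite addr_ge0// ltW.
- by rewrite (le_trans _ (ler_Re_normc _))// cReD Re_nat ler_norm.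
Qed.

Lemma pochhammer_neq0 z k : 0 < Re z -> pochhammer z k != 0.
Proof.
move=> z0; rewrite -normc_gt0; apply: lt_le_trans (rpochhammer_le k z0).
exact: rpochhammer_gt0.
Qed.

Lemma egamma_pochhammer z n : 0 < Re z -> egamma (z + n%:R) = pochhammer z n * egamma z.
Proof.
move=> z0; elim: n => [|n IH]; first by rewrite pochhammer0 addr0 mul1r.
rewrite -natr1 addrA egamma_rec; last by rewrite cReD Re_nat ltr_wpDr.
rewrite IH pochhammerSr; ring.
Qed.

Lemma rgamma_pochhammer s n : 0 < s -> rgamma (s + n%:R) = rpochhammer s n * rgamma s.
Proof.
move=> s0; elim: n => [|n IH]; first by rewrite /rpochhammer big_ord0 addr0 mul1r.
rewrite -natr1 addrA rgamma_rec; last by rewrite ltr_wpDr.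
rewrite IH rpochhammerSr; ring.
Qed.

End Pochhammer.

(** * The gamma integral has no zeros *)

Section GammaNonvanishing.
Context {R : realType}.

(* After multiplication by a phase, Re Gamma(m + it) is the Gamma(m)-average
   of cos (t ln (X / m)), which is close to 1 because X concentrates near m. *)
Lemma egamma_neq0_large (m t : R) : 1 < m -> 2 * t ^+ 2 < m - 1 ->
  egamma (m +i* t) != 0.
Proof.
move=> m1 tm; have m0 : 0 < m by exact: lt_trans m1.
pose L := ln m.
have eL : expR L = m by rewrite lnK// posrE.
apply/eqP => E0.
have z0 : 0 < 0 :> R \/ 0 < Re (m +i* t) by right.
have ki := cintg_kker (lexx 0) z0.
pose w (u : R) := expR (- expR u + m * u).
have reE : (fun u => Re (cexp ((- (t * L))*i) * kker (m +i* t) 0 u)) =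
    (fun u => w u * cos (t * (u - L))).
  apply/funext => u; rewrite /kker -cexpD Re_cexp !(cReD, cImD, cReM, cImM) /=.
  by rewrite /w; congr (expR _ * cos _); ring.
have i1 : rintegrable w by exact: rgamma_integrable.
have i2 : rintegrable (fun u => w u * cos (t * (u - L))).
  by rewrite -reE; have [] := cintgZ (cexp ((- (t * L))*i)) ki.
have m10 : 0 < m - 1 by rewrite subr_gt0.
have ip : rintegrable (fun u => expR (- expR u + (m + 1) * u)).
  by apply: rgamma_integrable; rewrite addr_gt0.
have im := rgamma_integrable m10.
(* Lower bound of the integrand from [cos_ge] and [sqr_le_cosh]: with s = u - L, cos(ts) >= 1 + 4t^2
   - 2t^2 (e^s + e^{-s}). As e^L = m, the exponentials shift the gamma argument by 1 and -1, so [g]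
   integrates in closed form. *)
pose g (u : R) := (1 + 4 * t ^+ 2) * w u - (2 * t ^+ 2 / m * expR (- expR u + (m + 1) * u)
   + 2 * t ^+ 2 * m * expR (- expR u + (m - 1) * u)).
have gi : rintegrable g.
  by apply: rintegrableB; [|apply: rintegrableD]; exact: rintegrableZ.
have gE : rint g = rgamma m * (1 - 2 * t ^+ 2 / (m - 1)).
  rewrite rintB; [|exact: rintegrableZ|by apply: rintegrableD; exact: rintegrableZ].
  rewrite rintD ?rintZ//; [|exact: rintegrableZ|exact: rintegrableZ].
  rewrite -/(rgamma m) -/(rgamma (m + 1)) -/(rgamma (m - 1)) rgamma_rec//.
  have -> : rgamma m = (m - 1) * rgamma (m - 1) by rewrite -rgamma_rec// subrK.
  by field; rewrite gt_eqF//= gt_eqF.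
suff key : rint g <= Re (cexp ((- (t * L))*i) * egamma (m +i* t)).
  have : 0 < rint g.
    by rewrite gE mulr_gt0 ?rgamma_gt0// subr_gt0 ltr_pdivrMr// mul1r.
  by rewrite E0 mulr0 in key; rewrite ltNge key.
rewrite /egamma /kint -cintZ//=.
rewrite -[leRHS]/(rint (fun u => Re (cexp ((- (t * L))*i) * kker (m +i* t) 0 u))) reE.
apply: le_rint => // u; rewrite /g.
have -> : expR (- expR u + (m + 1) * u) = w u * (m * expR (u - L)).
  rewrite expRB eL /w.
  have -> : expR (- expR u + (m + 1) * u) = expR (- expR u + m * u) * expR u.
    by rewrite -expRD; congr expR; ring.
  by field; rewrite gt_eqF.
have -> : expR (- expR u + (m - 1) * u) = w u * (expR (- (u - L)) / m).
  rewrite opprB expRB eL /w.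
  have -> : expR (- expR u + (m - 1) * u) = expR (- expR u + m * u) / expR u.
    by rewrite -expRN -expRD; congr expR; ring.
  by field; rewrite !gt_eqF// expR_gt0.
have w0 : 0 < w u by exact: expR_gt0.
have -> : (1 + 4 * t ^+ 2) * w u - (2 * t ^+ 2 / m * (w u * (m * expR (u - L))) +
    2 * t ^+ 2 * m * (w u * (expR (- (u - L)) / m))) =
    w u * (1 + 4 * t ^+ 2 - 2 * t ^+ 2 * (expR (u - L) + expR (- (u - L)))).
  by field; rewrite gt_eqF.
rewrite ler_pM2l//; apply: le_trans (cos_ge _).
have := ler_wpM2l (sqr_ge0 t) (sqr_le_cosh (u - L)).
by rewrite exprMn => h; lra.
Qed.

(** The recurrence carries a zero at z to a zero at z + n, and for large n the real part outgrows
    the square of the fixed imaginary part, where [egamma_neq0_large] applies. *)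
Lemma egamma_neq0 (z : R[i]) : 0 < Re z -> egamma z != 0.
Proof.
move=> z0; apply/eqP => E.
pose n := (Num.truncn (1 + 2 * Im z ^+ 2)).+1.
have hn : 1 + 2 * Im z ^+ 2 < n%:R by exact: truncnS_gt.
have := egamma_pochhammer n z0; rewrite E mulr0 => /eqP; apply/negP.
have -> : z + n%:R = (Re z + n%:R) +i* Im z.
  by apply: complex_eqP; rewrite ?(cReD, cImD, Re_nat, Im_nat) ?addr0.
have := sqr_ge0 (Im z) => h.
by apply: egamma_neq0_large; lra.
Qed.

End GammaNonvanishing.

(** * Complex series and the function 0F1 *)

Section ComplexSeries.
Context {R : realType}.
Implicit Types u : nat -> R[i].

Lemma csum_eq (u : nat -> R[i]) l : ccvg (fun n => \sum_(0 <= k < n) u k) l -> csum 0 u = l.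
Proof. by move=> /ccvg_topology h; apply: cvg_lim h; exact: norm_hausdorff. Qed.

Lemma csum_cvg u (a : R ^nat) : (forall k, normc (u k) <= a k) -> cvgn (series a) ->
  ccvg (fun n => \sum_(0 <= k < n) u k) (csum 0 u).
Proof.
move=> ua ca.
have cRe : cvgn (series (fun k => Re (u k))).
  apply: normed_cvg; apply: (@series_le_cvg _ _ a) => [k|k|k|].
  - exact: normr_ge0.
  - exact: le_trans (normc_ge0 _) (ua k).
  - exact: le_trans (ler_Re_normc _) (ua k).
  - exact: ca.
have cIm : cvgn (series (fun k => Im (u k))).
  apply: normed_cvg; apply: (@series_le_cvg _ _ a) => [k|k|k|].
  - exact: normr_ge0.
  - exact: le_trans (normc_ge0 _) (ua k).
  - exact: le_trans (ler_Im_normc _) (ua k).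
  - exact: ca.
have h : ccvg (fun n => \sum_(0 <= k < n) u k)
   (limn (series (fun k => Re (u k))) +i* limn (series (fun k => Im (u k)))).
  apply: ccvg_ReIm => /=.
  - by under eq_fun do rewrite Re_sum.
  - by under eq_fun do rewrite Im_sum.
by rewrite (csum_eq h).
Qed.

End ComplexSeries.

Section ConfluentLimit.
Context {R : realType}.
Implicit Types (c v : R[i]) (y dl : R).

(** A quantitative way to say that c is not a pole 0, -1, -2, ...: the same [dl] bounds all factors
    of every rising factorial of c and survives c -> c + 1, so estimates stay uniform along the
    recurrences. *)
Definition apart dl c : Prop := 0 < dl /\ forall j : nat, dl <= normc (c + j%:R).

Lemma apartS dl c : apart dl c -> apart dl (c + 1).
Proof. by move=> [d0 h]; split => // j; rewrite -addrA nat1r; exact: h. Qed.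

Lemma apart_neq0 dl c j : apart dl c -> c + j%:R != 0.
Proof. by move=> [d0 h]; rewrite -normc_gt0; exact: lt_le_trans (h j). Qed.

Lemma apart_poch dl c k : apart dl c -> dl ^+ k <= normc (pochhammer c k).
Proof.
move=> [d0 h]; elim: k => [|k IH]; first by rewrite expr0 pochhammer0 ComplexField.Normc.normc1.
rewrite pochhammerSr ComplexField.Normc.normcM exprSr ler_pM ?exprn_ge0//; exact: ltW.
Qed.

Lemma apart_poch_neq0 dl c k : apart dl c -> pochhammer c k != 0.
Proof.
move=> h; rewrite -normc_gt0; apply: lt_le_trans (apart_poch k h).
by rewrite exprn_gt0//; case: h.
Qed.

(* 0F1(; c; y) *)
Definition phi_term c y (k : nat) : R[i] := y%:C ^+ k / (k`!%:R * pochhammer c k).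
Definition phi c y : R[i] := csum 0 (phi_term c y).

Lemma phi_term0 c y : phi_term c y 0 = 1.
Proof. by rewrite /phi_term pochhammer0 expr0 fact0 mulr1 divr1. Qed.

Lemma factC_neq0 k : (k`!%:R : R[i]) != 0.
Proof. by rewrite pnatr_eq0 -lt0n fact_gt0. Qed.

Lemma normc_phi_term dl c y k : 0 <= y -> apart dl c ->
  normc (phi_term c y k) <= (y / dl) ^+ k / k`!%:R.
Proof.
move=> y0 h; have d0 : 0 < dl by case: h.
rewrite /phi_term !(ComplexField.Normc.normcM, ComplexField.Normc.normcV) normc_nat normcX normcR.
rewrite (ger0_norm y0) invfM mulrA expr_div_n mulrAC ler_pM2r ?invr_gt0 ?ltr0n ?fact_gt0//.
rewrite ler_wpM2l ?exprn_ge0// lef_pV2 ?posrE ?exprn_gt0//.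
  exact: apart_poch.
by apply: lt_le_trans (apart_poch k h); rewrite exprn_gt0.
Qed.

Lemma phi_cvg dl c y : 0 <= y -> apart dl c ->
  ccvg (fun n => \sum_(0 <= k < n) phi_term c y k) (phi c y).
Proof.
move=> y0 h; apply: csum_cvg (fun k => normc_phi_term k y0 h) _.
exact: (is_cvg_series_exp_coeff (y / dl)).
Qed.

(** Contiguity relation, coefficient by coefficient: 1/(c)_k - 1/(c+1)_k = k/(c (c+1)_k). *)
Lemma phi_rec dl c y : 0 <= y -> apart dl c ->
  phi c y - phi (c + 1) y = y%:C / (c * (c + 1)) * phi (c + 2%:R) y.
Proof.
move=> y0 h; have h1 := apartS h; have h2 := apartS h1.
have c2 : c + 2%:R = c + 1 + 1 by rewrite -addrA.
rewrite c2.
have c0 : c != 0 by have := apart_neq0 0 h; rewrite addr0.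
have c1 : c + 1 != 0 by have := apart_neq0 0 h1; rewrite addr0.
have L : ccvg (fun n => \sum_(0 <= k < n) phi_term c y k -
     \sum_(0 <= k < n) phi_term (c + 1) y k) (phi c y - phi (c + 1) y).
  apply: ccvgD; first exact: phi_cvg h.
  have := ccvgZ (-1) (phi_cvg y0 h1); rewrite mulN1r.
  by under eq_fun do rewrite mulN1r.
(* The constant terms of the two series cancel, so the partial sums match after a shift by one. *)
apply: (ccvg_unique ((ccvg_shiftn 1 _ _).1 L)).
have := ccvgZ (y%:C / (c * (c + 1))) (phi_cvg y0 h2).
congr ccvg; apply/funext => n; rewrite addn1 -sumrB big_nat_recl// big_distrr /=.
rewrite !phi_term0 subrr add0r; apply: eq_bigr => k _.
rewrite /phi_term pochhammerSl (pochhammerSr (c + 1)).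
have e : pochhammer (c + 1) k * (c + 1 + k%:R) = (c + 1) * pochhammer (c + 1 + 1) k.
  by rewrite -pochhammerSr pochhammerSl.
have p1 := apart_poch_neq0 k h1; have p2 := apart_poch_neq0 k h2.
have ck : c + 1 + k%:R != 0 by exact: apart_neq0 h1.
have -> : pochhammer (c + 1 + 1) k = pochhammer (c + 1) k * (c + 1 + k%:R) / (c + 1).
  by rewrite e; field.
rewrite factS natrM exprS -natr1.
have f0 := factC_neq0 k; have f1 : (k%:R + 1 : R[i]) != 0 by rewrite natr1 pnatr_eq0.
by field; rewrite c0 c1 p1 ck f0 f1.
Qed.

(** Every term after the constant 1 contains the factor 1/c; the rest is dominated by the
    exponential series. Hence 0F1 tends to 1 when c goes to infinity away from its poles. *)
Lemma phi_sub1 dl c y : 0 <= y -> apart dl c ->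
  normc (phi c y - 1) <= dl / normc c * expR (y / dl).
Proof.
move=> y0 h; have h1 := apartS h; have d0 : 0 < dl by case: h.
have c0 : c != 0 by have := apart_neq0 0 h; rewrite addr0.
have nc0 : 0 < normc c by rewrite normc_gt0.
have b k : normc (phi_term c y k.+1) <= dl / normc c * exp_coeff (y / dl) k.+1.
  rewrite /phi_term pochhammerSl !(ComplexField.Normc.normcM, ComplexField.Normc.normcV) normc_nat normcX normcR.
  rewrite (ger0_norm y0) /exp_coeff /= /exp_coeff expr_div_n.
  have -> : dl / normc c * (y ^+ k.+1 / dl ^+ k.+1 / k.+1`!%:R) =
     (y ^+ k.+1 / k.+1`!%:R / normc c) * (dl ^+ k)^-1.
    by rewrite (exprS dl); field; rewrite !gt_eqF ?exprn_gt0// ltr0n fact_gt0.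
  have -> : y ^+ k.+1 / (k.+1`!%:R * (normc c * normc (pochhammer (c + 1) k))) =
     (y ^+ k.+1 / k.+1`!%:R / normc c) * (normc (pochhammer (c + 1) k))^-1.
    by field; rewrite !gt_eqF ?normc_gt0 ?(apart_poch_neq0 k h1)// ltr0n fact_gt0.
  rewrite ler_wpM2l ?divr_ge0 ?exprn_ge0 ?normc_ge0//.
  rewrite lef_pV2 ?posrE ?exprn_gt0 ?normc_gt0 ?(apart_poch_neq0 k h1)//.
  exact: apart_poch.
have bn n : normc (\sum_(0 <= k < n.+1) phi_term c y k - 1) <= dl / normc c * expR (y / dl).
  rewrite big_nat_recl// phi_term0.
  rewrite [1 + _]addrC addrK; apply: (le_trans (normc_sum _ _ _)).
  apply: (@le_trans _ _ (\sum_(0 <= k < n) dl / normc c * exp_coeff (y / dl) k.+1)).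
    by apply: ler_sum => k _; exact: b.
  rewrite -big_distrr /= ler_wpM2l ?divr_ge0 ?normc_ge0 ?(ltW d0)//.
  have e0 k : 0 <= exp_coeff (y / dl) k.
    by rewrite /exp_coeff /= divr_ge0// exprn_ge0// divr_ge0// ltW.
  apply: (@le_trans _ _ (series (exp_coeff (y / dl)) n.+1)).
    by rewrite /series /= [leRHS]big_nat_recl//= lerDr.
  rewrite /expR; apply: nondecreasing_cvgn_le.
    by apply: nondecreasing_series => k _ _; exact: e0.
  exact: is_cvg_series_exp_coeff.
have L : ccvg (fun n => \sum_(0 <= k < n.+1) phi_term c y k - 1) (phi c y - 1).
  apply: ccvgD; last exact: ccvg_cst.
  by have := (ccvg_shiftn 1 _ _).1 (phi_cvg y0 h); under eq_fun do rewrite addn1.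
have L' : normc (\sum_(0 <= k < n.+1) phi_term c y k - 1) @[n --> \oo] --> normc (phi c y - 1).
  apply/subr_cvg0; apply/norm_cvg0P; apply: (squeeze_cvgr _ (cvg_cst 0) L).
  near=> n; rewrite normr_ge0/=; set A := _ - 1; set B := phi c y - 1.
  rewrite ler_norml; apply/andP; split.
    rewrite lerNl opprB lerBlDr; have := le_normcD (B - A) A; rewrite subrK.
    by rewrite normcB.
  by rewrite lerBlDr; have := le_normcD (A - B) B; rewrite subrK.
apply: (ler_cvg_to L' (cvg_cst _)); near=> n; exact: bn.
Unshelve. all: by end_near. Qed.

Lemma phi_limit dl (c : nat -> R[i]) y : 0 <= y -> (forall n, apart dl (c n)) ->
  (normc (c n))^-1 @[n --> \oo] --> 0 -> ccvg (fun n => phi (c n) y) 1.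
Proof.
move=> y0 h cn.
apply: (ccvg_le (w := fun n => (dl * expR (y / dl)) * (normc (c n))^-1)).
  by move=> n; rewrite mulrAC; exact: phi_sub1.
by rewrite -[X in _ --> X](mulr0 (dl * expR (y / dl))); apply: cvgM => //; exact: cvg_cst.
Qed.

Lemma invn_cvg (a : R) : (n%:R + a)^-1 @[n --> \oo] --> (0 : R).
Proof.
apply/gtr0_cvgV0; last first.
  apply/cvgryPge => A; near=> n; rewrite -lerBlDr.
  by near: n; exact: nbhs_infty_ger.
near=> n; have : - a < n%:R by near: n; exact: nbhs_infty_gtr.
by rewrite -subr_gt0 opprK.
Unshelve. all: by end_near. Qed.

Lemma normc_inv_cvg (c : nat -> R[i]) (a : R) : (forall n, n%:R - a <= normc (c n)) ->
  (normc (c n))^-1 @[n --> \oo] --> 0.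
Proof.
move=> h; apply: (squeeze_cvgr _ (cvg_cst 0) (invn_cvg (- a))).
near=> n; have n0 : 0 < n%:R - a by rewrite subr_gt0; near: n; exact: nbhs_infty_gtr.
have c0 : 0 < normc (c n) by exact: lt_le_trans (h n).
by rewrite invr_ge0 normc_ge0/= lef_pV2.
Unshelve. all: by end_near. Qed.

End ConfluentLimit.

(** * The connection formula between Macdonald's integral and 0F1 *)

Section Connection.
Context {R : realType}.
Implicit Types (c v : R[i]) (y dl : R).

Definition zapart dl v : Prop := 0 < dl /\ forall m : int, dl <= normc (v + m%:~R).

(** Inside the strip |Re v| < 1 the only integer that v can approach is 0; the others lie at
    distance at least 1 - |Re v|. *)
Lemma zapartP v : v != 0 -> `|Re v| < 1 -> exists dl, zapart dl v.
Proof.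
move=> v0 v1; exists (Num.min (normc v) (1 - `|Re v|)).
split; first by rewrite lt_min normc_gt0 v0 subr_gt0.
move=> m; rewrite ge_min; have [->|m0] := eqVneq m 0; first by rewrite addr0 lexx.
apply/orP; right; apply: le_trans (ler_Re_normc _).
have m1 : 1 <= `|m%:~R : R|.
  by rewrite -intr_norm (_ : 1 = 1%:~R)// ler_int -gtz0_ge1 normr_gt0.
have -> : Re (v + m%:~R) = Re v + m%:~R.
  by rewrite cReD -(rmorph_int (real_complex R)).
have := ler_normB (Re v + m%:~R) (Re v).
by rewrite addrAC subrr add0r; lra.
Qed.

Lemma zapart_apart dl v (m : int) : zapart dl v -> apart dl (v + m%:~R).
Proof.
move=> [d0 h]; split => // j; rewrite -addrA -[j%:R]/(j%:~R) -intrD.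
exact: h.
Qed.

Lemma zapartN dl v : zapart dl v -> zapart dl (- v).
Proof.
by move=> [d0 h]; split => // m; rewrite -normcN opprD opprK -rmorphN; exact: h.
Qed.

Lemma zapartD dl v (m : int) : zapart dl v -> zapart dl (v + m%:~R).
Proof. by move=> [d0 h]; split => // k; rewrite -addrA -intrD; exact: h. Qed.

Lemma zapart_apartD dl v (m : nat) : zapart dl v -> apart dl (m%:R + v).
Proof. by move=> h; rewrite addrC; exact: (zapart_apart m). Qed.

Lemma zapart_apartB dl v (m : nat) : zapart dl v -> apart dl (m%:R - v).
Proof. by move=> h; apply: zapart_apartD; exact: zapartN. Qed.

Let wronsk v y := phi v y * phi (1 - v) y +
  y%:C / (v * (v - 1)) * phi (2%:R - v) y * phi (1 + v) y.

Lemma zapart_neq0 dl v (m : int) : zapart dl v -> v + m%:~R != 0.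
Proof. by move=> [d0 h]; rewrite -normc_gt0; exact: lt_le_trans (h m). Qed.

Let wronsk_rec dl v y : 0 <= y -> zapart dl v -> wronsk (v + 1) y = wronsk v y.
Proof.
move=> y0 h.
have v0 : v != 0 by have := zapart_neq0 0 h; rewrite addr0.
have v1 : v + 1 != 0 := zapart_neq0 1 h.
have v2 : v - 1 != 0 := zapart_neq0 (-1) h.
have := zapart_apartD 0 h; rewrite add0r => a0.
have := zapart_apartB 0 h; rewrite sub0r => a1.
have := phi_rec y0 a0; have := phi_rec y0 a1.
rewrite /wronsk.
have -> : 1 - (v + 1) = - v by ring.
have -> : 2%:R - (v + 1) = - v + 1 by ring.
have -> : v + 1 - 1 = v by ring.
have -> : 1 + (v + 1) = v + 2%:R by ring.
have -> : 1 - v = - v + 1 by ring.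
have -> : 2%:R - v = - v + 2%:R by ring.
have -> : 1 + v = v + 1 by ring.
move=> /eqP; rewrite subr_eq => /eqP ->.
move=> /eqP; rewrite subr_eq => /eqP ->.
have v3 : - v + 1 != 0 by rewrite addrC -oppr_eq0 opprB.
by field; rewrite v0 v1 v2 v3.
Qed.

Lemma norm_natD_ge (c : R[i]) n : n%:R - normc c <= normc (c + n%:R).
Proof.
rewrite lerBlDr; have := le_normcD (c + n%:R) (- c).
by rewrite addrAC subrr add0r normcN normc_nat.
Qed.

(** The left side is the Wronskian relation of the two Bessel functions of orders v and -v. The
    contiguity relations make it invariant under v -> v + 1, and along v + n it tends to 1. *)
Lemma phi_wronskian dl v y : 0 <= y -> zapart dl v ->
  phi v y * phi (1 - v) y + y%:C / (v * (v - 1)) * phi (2%:R - v) y * phi (1 + v) y = 1.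
Proof.
move=> y0 h; rewrite -/(wronsk v y).
have hn n : zapart dl (v + n%:R) := zapartD n h.
have E n : wronsk (v + n%:R) y = wronsk v y.
  elim: n => [|n IH]; first by rewrite addr0.
  by rewrite -natr1 addrA (wronsk_rec y0 (hn n)).
have L : ccvg (fun n => wronsk (v + n%:R) y) (1 * 1 + (y%:C * 0) * 1 * 1).
  apply: ccvgD; first apply: ccvgM.
  - apply: (@phi_limit _ dl) => // [n|].
      by have := zapart_apartD 0 (hn n); rewrite add0r.
    by apply: (normc_inv_cvg (a := normc v)) => n; exact: norm_natD_ge.
  - apply: (@phi_limit _ dl) => // [n|]; first exact: zapart_apartB 1 (hn n).
    apply: (normc_inv_cvg (a := normc (v - 1))) => n.
    have -> : 1 - (v + n%:R) = - (v - 1 + n%:R) by ring.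
    by rewrite normcN; exact: norm_natD_ge.
  apply: ccvgM; first apply: ccvgM; first apply: ccvgM.
  - exact: ccvg_cst.
  - apply: (ccvg_near_le (w := fun n => (n%:R + (- normc v))^-1 * (n%:R + (- normc (v - 1)))^-1)).
      near=> n.
      have n0 : 0 < n%:R - normc v by rewrite subr_gt0; near: n; exact: nbhs_infty_gtr.
      have n1 : 0 < n%:R - normc (v - 1) by rewrite subr_gt0; near: n; exact: nbhs_infty_gtr.
      have h1 := norm_natD_ge v n; have h2 := norm_natD_ge (v - 1) n.
      rewrite subr0 ComplexField.Normc.normcV ComplexField.Normc.normcM invfM.
      have e1 : (normc (v + n%:R))^-1 <= (n%:R - normc v)^-1.
        by rewrite lef_pV2 ?posrE//; exact: lt_le_trans h1.
      have e2 : (normc (v + n%:R - 1))^-1 <= (n%:R - normc (v - 1))^-1.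
        by rewrite addrAC lef_pV2 ?posrE//; exact: lt_le_trans h2.
      by rewrite ler_pM ?invr_ge0 ?normc_ge0.
    by rewrite -[X in _ --> X](mulr0 0); apply: cvgM; exact: invn_cvg.
  - apply: (@phi_limit _ dl) => // [n|]; first exact: zapart_apartB 2 (hn n).
    apply: (normc_inv_cvg (a := normc (v - 2%:R))) => n.
    have -> : 2%:R - (v + n%:R) = - (v - 2%:R + n%:R) by ring.
    by rewrite normcN; exact: norm_natD_ge.
  - apply: (@phi_limit _ dl) => // [n|]; first exact: zapart_apartD 1 (hn n).
    by apply: (normc_inv_cvg (a := normc (1 + v))) => n; rewrite addrA; exact: norm_natD_ge.
apply: (@ccvg_unique _ (fun=> wronsk v y)); first exact: ccvg_cst.
move: L; under eq_fun do rewrite E.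
by rewrite mulr0 !mul0r addr0 mulr1.
Unshelve. all: by end_near. Qed.

Section Casorati.
Variables (v : R[i]) (y : R).
Hypotheses (y0 : 0 < y) (v1 : -1 < Re v).

Let c n := 1 + v + n%:R.
Let cgt n : 0 < Re (c n).
Proof.
rewrite /c !cReD Re_nat /=; have : 0 <= n%:R :> R by []; move: v1; lra.
Qed.

Let dl := Re (1 + v).
Let dl0 : 0 < dl. Proof. by have := cgt 0; rewrite /c addr0. Qed.

Let cap n : apart dl (c n).
Proof.
split => // j; apply: le_trans (ler_Re_normc _).
rewrite /c !cReD !Re_nat /dl cReD; apply: le_trans (ler_norm _).
by rewrite -addrA lerDl addr_ge0.
Qed.

Let F n := kint (v + n%:R) y.
Let P n := pochhammer (1 + v) n.
Let Pn n : P n != 0.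
Proof. by apply: pochhammer_neq0. Qed.
(** Both [F n] and (-y)^n phi(c_n)/P_n solve X_{n+2} = c_n X_{n+1} + y X_n. Their Casoratian is
    multiplied by -y at each step, and [D] is that Casoratian divided by (-y)^n, hence constant. *)
Let D n := F n * (- y%:C) / P n.+1 * phi (c n.+1) y - F n.+1 / P n * phi (c n) y.

Let D_rec n : D n.+1 = D n.
Proof.
rewrite /D.
have cE m : c m + 1 = c m.+1 by rewrite /c -addrA natr1.
have cE2 : c n + 2%:R = c n.+2 by rewrite /c -[n.+2%:R]natr1 -[n.+1%:R]natr1; ring.
have PE m : P m.+1 = P m * c m by rewrite /P pochhammerSr.
have FE : F n.+2 = c n * F n.+1 + y%:C * F n.
  have := @kint_rec R (v + n.+1%:R) y (ltW y0) (or_introl y0).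
  have -> : v + n.+1%:R - 1 = v + n%:R by rewrite -natr1; ring.
  rewrite -addrA natr1 -/(F n.+2) -/(F n.+1) -/(F n) => ->.
  by have -> : v + n.+1%:R = c n by rewrite /c -natr1; ring.
have c0 : c n != 0 by have := apart_neq0 0 (cap n); rewrite addr0.
have c1 : c n.+1 != 0 by have := apart_neq0 0 (cap n.+1); rewrite addr0.
have p0 := Pn n.
have := phi_rec (ltW y0) (cap n); rewrite cE cE2 => /eqP; rewrite subr_eq => /eqP ->.
by rewrite FE !PE; field; rewrite c0 c1 p0.
Qed.

Let rP n := rpochhammer dl n.

Let L1 : ccvg (fun n => F n.+1 / P n) (egamma (1 + v)).
Proof.
(* [kint_egamma_le] asks for real part greater than 1, while only Re (1 + v) > 0 is known; one shift
   of the index repairs this. *)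
apply/(ccvg_shiftn 1).
apply: (ccvg_le (w := fun m => (y * rgamma dl) * (m%:R + dl)^-1)); last first.
  rewrite -[X in _ --> X](mulr0 (y * rgamma dl)); apply: cvgM; first exact: cvg_cst.
  exact: invn_cvg.
move=> m; rewrite addn1.
have -> : F m.+2 / P m.+1 - egamma (1 + v) =
    (kint (1 + v + m.+1%:R) y - egamma (1 + v + m.+1%:R)) / P m.+1.
  rewrite egamma_pochhammer// -/(P m.+1) mulrBl (mulrC (P m.+1)) mulfK ?Pn//.
  have -> : 1 + v + m.+1%:R = v + m.+2%:R by rewrite -[m.+2%:R]natr1; ring.
  by [].
have ReE : Re (1 + v + m.+1%:R) - 1 = dl + m%:R.
  by rewrite cReD Re_nat -/dl -natr1; ring.
have m0 : 0 <= m%:R :> R by [].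
have h : 1 < Re (1 + v + m.+1%:R) by move: ReE dl0; lra.
have := kint_egamma_le (ltW y0) h; rewrite ReE rgamma_pochhammer// => h1.
rewrite ComplexField.Normc.normcM ComplexField.Normc.normcV.
have Pg : 0 < normc (P m.+1) by rewrite normc_gt0.
rewrite ler_pdivrMr//; apply: (le_trans h1).
have h2 : rpochhammer dl m.+1 <= normc (P m.+1) by exact: rpochhammer_le.
have d1 : 0 < m%:R + dl by rewrite ltr_wpDl.
have r0 : 0 < rgamma dl by exact: rgamma_gt0.
apply: (@le_trans _ _ (y * rgamma dl / (m%:R + dl) * rpochhammer dl m.+1)); last first.
  by rewrite ler_wpM2l// divr_ge0 ?mulr_ge0// ltW.
rewrite rpochhammerSr le_eqVlt; apply/orP; left; apply/eqP.
by move: (rpochhammer dl m) (rgamma dl) d1; generalize dl => d A B d1; field; rewrite gt_eqF.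
Qed.

Let L2 : ccvg (fun n => F n * (- y%:C) / P n.+1) 0.
Proof.
(* The same shift here gives v + n + 1 a positive real part, as [normc_kint_le] requires. *)
apply/(ccvg_shiftn 1).
apply: (ccvg_le (w := fun m => (y * rgamma dl) * ((m%:R + dl)^-1 * (m%:R + (dl + 1))^-1))); last first.
  rewrite -[X in _ --> X](mulr0 (y * rgamma dl)); apply: cvgM; first exact: cvg_cst.
  by rewrite -[X in _ --> X](mulr0 0); apply: cvgM; exact: invn_cvg.
move=> m; rewrite addn1 subr0.
have vE : v + m.+1%:R = 1 + v + m%:R by rewrite -natr1; ring.
have ReE : Re (v + m.+1%:R) = dl + m%:R by rewrite vE cReD Re_nat.
have m0 : 0 <= m%:R :> R by [].
have h : 0 < Re (v + m.+1%:R) by rewrite ReE ltr_wpDr.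
have := normc_kint_le (ltW y0) h; rewrite ReE rgamma_pochhammer// -/(F m.+1) => h1.
rewrite !(ComplexField.Normc.normcM, ComplexField.Normc.normcV) normcN normcR (gtr0_norm y0).
have Pg : 0 < normc (P m.+2) by rewrite normc_gt0.
rewrite ler_pdivrMr// mulrC; apply: (@le_trans _ _ (y * (rpochhammer dl m * rgamma dl))).
  by rewrite ler_pM2l.
have h2 : rpochhammer dl m.+2 <= normc (P m.+2) by exact: rpochhammer_le.
have d1 : 0 < m%:R + dl by rewrite ltr_wpDl.
have d2 : 0 < m%:R + (dl + 1) by rewrite addrA ltr_wpDr.
have r0 : 0 < rgamma dl by exact: rgamma_gt0.
apply: (@le_trans _ _ (y * rgamma dl * ((m%:R + dl)^-1 / (m%:R + (dl + 1))) * rpochhammer dl m.+2)); last first.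
  by rewrite ler_wpM2l// !mulr_ge0 ?invr_ge0// ltW.
rewrite !rpochhammerSr -[m.+1%:R]natr1 le_eqVlt; apply/orP; left; apply/eqP.
move: (rpochhammer dl m) (rgamma dl) d1 d2; generalize dl => d A B d1 d2.
by field; rewrite !gt_eqF.
Qed.

(** The constant Casoratian is computed at infinity, where [L1], [L2] and phi -> 1 leave only
    -Gamma(1 + v). *)
Lemma kint_casorati : kint (v + 1) y * phi (1 + v) y +
  kint v y * y%:C / (1 + v) * phi (2%:R + v) y = egamma (1 + v).
Proof.
have DE n : D n = D 0 by elim: n => // n <-; exact: D_rec.
have cinv : (normc (c n))^-1 @[n --> \oo] --> 0.
  by apply: (normc_inv_cvg (a := normc (1 + v))) => n; exact: norm_natD_ge.
have Lc : ccvg (fun n => phi (c n) y) 1 by apply: (phi_limit (ltW y0) cap).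
have LD : ccvg D (0 * 1 + -1 * (egamma (1 + v) * 1)).
  apply: ccvgD.
    apply: ccvgM => //; have := (ccvg_shiftn 1 _ _).1 Lc.
    by under eq_fun do rewrite addn1.
  have := ccvgZ (-1) (ccvgM L1 Lc).
  by under eq_fun do rewrite mulN1r.
have LD0 : ccvg D (D 0).
  have e : D = (fun=> D 0) by apply/funext; exact: DE.
  by rewrite [X in ccvg X]e; exact: ccvg_cst.
have := ccvg_unique LD0 LD.
rewrite /D /F /P /c !addr0 pochhammerSr pochhammer0 addr0 mul1r divr1 mul0r add0r mulr1.
have -> : 1 + v + 1 = 2%:R + v by ring.
rewrite mulN1r => E; apply: oppr_inj; rewrite -E; ring.
Qed.

End Casorati.

Lemma cpowD y (a b : R[i]) : cpow y (a + b) = cpow y a * cpow y b.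
Proof. by rewrite /cpow mulrDl cexpD. Qed.

Lemma cpow0 y : cpow y 0 = 1 :> R[i].
Proof. by rewrite /cpow mul0r cexp0. Qed.

Lemma cpow1 y : 0 < y -> cpow y 1 = y%:C.
Proof. by move=> y0; rewrite /cpow mul1r cexpR lnK// posrE. Qed.

(** Macdonald's function in terms of the two modified Bessel functions of the first kind.
    [kint_casorati] at v and, by reflection, at -v gives two linear equations for the values at v
    and v + 1; [phi_wronskian] is the determinant that solves them. *)
Lemma kint_connection v y : 0 < y -> v != 0 -> `|Re v| < 1 ->
  v * kint v y = egamma (1 + v) * phi (1 - v) y -
    cpow y v * egamma (1 - v) * phi (1 + v) y.
Proof.
move=> y0 v0 v1.
have [dl h] := zapartP v0 v1.
have /andP[v2 v3] : -1 < Re v < 1 by rewrite -ltr_norml.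
have vN : -1 < Re (- v) by rewrite cReN ltrN2.
have E1 := kint_casorati y0 v2.
have E2 := kint_casorati y0 vN.
have r := @kint_rec R v y (ltW y0) (or_introl y0).
have e1 : kint (- v) y = cpow y (- v) * kint v y by exact: kint_reflect.
have e2 : kint (- v + 1) y = cpow y (- v) * (kint (v + 1) y - v * kint v y).
  have -> : - v + 1 = - (v - 1) by ring.
  rewrite kint_reflect// r.
  have -> : - (v - 1) = - v + 1 by ring.
  by rewrite cpowD cpow1//; ring.
have W := phi_wronskian (ltW y0) h.
have pv : cpow y v * cpow y (- v) = 1 by rewrite -cpowD subrr cpow0.
rewrite e1 e2 in E2.
have a1 : 1 + v != 0 by have := zapart_neq0 1 h; rewrite addrC.
have a2 : v - 1 != 0 := zapart_neq0 (-1) h.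
have a3 : 1 - v != 0 by rewrite -oppr_eq0 opprB.
have {}E2 : (kint (v + 1) y - v * kint v y) * phi (1 - v) y +
    kint v y * y%:C / (1 - v) * phi (2%:R - v) y = cpow y v * egamma (1 - v).
  rewrite -E2 -[LHS]mul1r -pv; ring.
have rv := zapart_apartD 0 h; rewrite add0r in rv.
have := phi_rec (ltW y0) rv; rewrite (addrC v 1) (addrC v 2%:R) => rphi.
rewrite -E1 -E2.
(* The factor v is replaced by v times the Wronskian, which is 1; after elimination of phi(2 + v)
   the claim is a rational identity. *)
have W' : v = v * (phi v y * phi (1 - v) y +
   y%:C / (v * (v - 1)) * phi (2%:R - v) y * phi (1 + v) y) by rewrite W mulr1.
have rphi' : phi (2%:R + v) y = (phi v y - phi (1 + v) y) * (v * (1 + v)) / y%:C.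
  rewrite rphi; field.
  by rewrite v0 a1 /= andbT; rewrite (_ : 0 = 0%:C)// (inj_eq (@complexI R)) gt_eqF.
rewrite {1}W' rphi'; field.
by rewrite v0 a1 a2 a3 /= ?andbT; rewrite (_ : 0 = 0%:C)// (inj_eq (@complexI R)) gt_eqF.
Qed.

End Connection.

(** * Termwise integration: from 0F1 to 1F1 *)

Section Termwise.
Context {R : realType}.
Local Notation cint := (cintegral setT).
Local Notation cintg := (cintegrable setT).
Implicit Types (a c v z : R[i]) (x y dl : R).

Lemma cpowX_exp x u (k : nat) : 0 < x -> ((x * expR u)%:C : R[i]) ^+ k = (x ^+ k)%:C * cexp (k%:R * u%:C).
Proof. by move=> x0; rewrite rmorphM /= exprMn rmorphXn /= -cexpR cexpMn. Qed.

Definition ekern (l : R) (s : R[i]) (u : R) : R[i] := cexp ((- (l * expR u))%:C + s * u%:C).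

Lemma ekern_shift l s u : 0 < l -> ekern l s (u - ln l) = cpow l (- s) * kker s 0 u.
Proof.
move=> l0; rewrite /ekern /cpow /kker -cexpD; congr cexp.
rewrite mul0r subr0 expRB lnK ?posrE//.
have -> : l * (expR u / l) = expR u by field; rewrite gt_eqF.
by rewrite !rmorphB /=; ring.
Qed.

Lemma ekernE l s u : 0 < l -> ekern l s u = cpow l (- s) * kker s 0 (u + ln l).
Proof. by move=> l0; rewrite -ekern_shift// addrK. Qed.

Lemma ccont_ekern l s : ccont (ekern l s).
Proof.
apply: ccont_cexp; apply: ccontD.
  apply: ccontR => u; apply: cvgN; apply: cvgM; first exact: cvg_cst.
  exact: continuous_expR.
by apply: ccontM; [exact: ccont_cst|exact: ccont_id].
Qed.

Lemma cintg_ekern l s : 0 < l -> 0 < Re s -> cintg (ekern l s).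
Proof.
move=> l0 s0; have -> : ekern l s = (fun u => cpow l (- s) * kker s 0 (u + ln l)).
  by apply/funext => u; rewrite ekernE.
by apply: cintgZ; apply: cintg_shift; apply: cintg_kker => //; right.
Qed.

Lemma cint_ekern l s : 0 < l -> 0 < Re s -> cint (ekern l s) = cpow l (- s) * egamma s.
Proof.
move=> l0 s0; have -> : ekern l s = (fun u => cpow l (- s) * kker s 0 (u + ln l)).
  by apply/funext => u; rewrite ekernE.
have ki : cintg (kker s 0) by apply: cintg_kker => //; right.
by rewrite cintZ; [rewrite cint_shift|exact: cintg_shift].
Qed.

Lemma normc_ekern l s u : normc (ekern l s u) = expR (- (l * expR u) + Re s * u).
Proof. by rewrite /ekern normc_cexp cReD cReMr. Qed.

Lemma rintegrable_ekern (l s : R) : 0 < l -> 0 < s ->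
  rintegrable (fun u => expR (- (l * expR u) + s * u)).
Proof.
move=> l0 s0; have := cintg_norm (@cintg_ekern l s%:C l0 s0).
by under eq_fun do rewrite normc_ekern.
Qed.

(** Each factor satisfies k + 1 <= |c + k| + |c| + 1 <= (1 + (|c| + 1)/dl) |c + k|. Factorial growth
    of the denominators is what bounds 0F1 by the exponential of a square root. *)
Lemma apart_poch_fact dl c k : apart dl c ->
  (1 + (normc c + 1) / dl)^-1 ^+ k * k`!%:R <= normc (pochhammer c k).
Proof.
set q := _^-1 => h; have d0 : 0 < dl by case: h.
have B0 : 0 < 1 + (normc c + 1) / dl.
  by rewrite ltr_pwDl// divr_ge0 ?addr_ge0 ?normc_ge0// ltW.
have q0 : 0 < q by rewrite invr_gt0.
elim: k => [|k IH]; first by rewrite expr0 pochhammer0 ComplexField.Normc.normc1 mul1r.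
rewrite pochhammerSr ComplexField.Normc.normcM exprSr factS natrM.
have -> : q ^+ k * q * (k.+1%:R * k`!%:R) = (q ^+ k * k`!%:R) * (q * k.+1%:R) by ring.
suff hk : q * k.+1%:R <= normc (c + k%:R).
  by apply: ler_pM => //; rewrite mulr_ge0// ?exprn_ge0// ltW.
rewrite -ler_pdivlMl// /q invrK.
have h1 := norm_natD_ge c k; have h2 := h.2 k.
have : normc c + 1 <= (normc c + 1) / dl * normc (c + k%:R).
  by rewrite -mulrA ler_peMr ?addr_ge0 ?normc_ge0// ler_pdivlMl// mulr1.
by rewrite mulrDl mul1r -natr1; lra.
Qed.

(** By [apart_poch_fact] the sum is at most the sum of (t^k/k!)^2 with t^2 = yB, hence at most the
    square of a partial sum of e^t. *)
Lemma phi_partial_le dl c y n : 0 <= y -> apart dl c ->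
  \sum_(0 <= k < n) normc (phi_term c y k) <=
  expR (2 * Num.sqrt (y * (1 + (normc c + 1) / dl))).
Proof.
set B := 1 + _ => y0 h; have d0 : 0 < dl by case: h.
have B0 : 0 < B by rewrite ltr_pwDl// divr_ge0 ?addr_ge0 ?normc_ge0// ltW.
set t := Num.sqrt (y * B); have t0 : 0 <= t by exact: sqrtr_ge0.
have tE : t ^+ 2 = y * B by rewrite sqr_sqrtr// mulr_ge0// ltW.
pose S := \sum_(0 <= k < n) t ^+ k / k`!%:R.
have e0 k : 0 <= t ^+ k / k`!%:R by rewrite divr_ge0// exprn_ge0.
have S0 : 0 <= S by exact: sumr_ge0.
have SE : S <= expR t.
  rewrite /S /expR.
  have -> : \sum_(0 <= k < n) t ^+ k / k`!%:R = series (exp_coeff t) n by [].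
  apply: nondecreasing_cvgn_le; last exact: is_cvg_series_exp_coeff.
  by apply: nondecreasing_series => k _ _; exact: e0.
apply: (@le_trans _ _ (S ^+ 2)); last first.
  by rewrite expRM_natl lerXn2r ?nnegrE ?expR_ge0.
rewrite expr2 {2}/S mulr_sumr; apply: ler_sum_nat => k /andP[_ kn].
apply: (@le_trans _ _ ((t ^+ k / k`!%:R) * (t ^+ k / k`!%:R))); last first.
  rewrite ler_wpM2r// /S (big_rem k) /=; last by rewrite mem_index_iota.
  by rewrite lerDl sumr_ge0.
rewrite /phi_term !(ComplexField.Normc.normcM, ComplexField.Normc.normcV) normc_nat normcX normcR.
rewrite (ger0_norm y0).
have -> : t ^+ k / k`!%:R * (t ^+ k / k`!%:R) = (y ^+ k / k`!%:R) * (B^-1 ^+ k * k`!%:R)^-1.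
  have -> : t ^+ k / k`!%:R * (t ^+ k / k`!%:R) = (t ^+ 2) ^+ k / k`!%:R / k`!%:R.
    by rewrite -exprM mulnC exprM expr2; field; rewrite gt_eqF// ltr0n fact_gt0.
  rewrite tE exprMn exprVn; field.
  by rewrite !gt_eqF ?exprn_gt0// ltr0n fact_gt0.
rewrite invfM mulrA ler_wpM2l ?divr_ge0 ?exprn_ge0//.
have hh := apart_poch_fact k h.
have pos : 0 < B^-1 ^+ k * k`!%:R by rewrite mulr_gt0 ?exprn_gt0 ?invr_gt0// ltr0n fact_gt0.
by rewrite lef_pV2 ?posrE//; exact: lt_le_trans hh.
Qed.

(** The k-th term of 0F1 at x e^u multiplies the gamma kernel by e^{ku}, so its integral is Gamma(a
    + k) = (a)_k Gamma(a) times the coefficient. Dominated convergence justifies the exchange. *)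
Lemma kker_phi_int dl a c x : 0 < x -> 0 < Re a -> apart dl c ->
  cintg (fun u => kker a 0 u * phi c (x * expR u)) /\
  cint (fun u => kker a 0 u * phi c (x * expR u)) = egamma a * hyp1F1 a c x%:C.
Proof.
move=> x0 a0 h; have d0 : 0 < dl by case: h.
set B := 1 + (normc c + 1) / dl.
have B0 : 0 < B by rewrite ltr_pwDl// divr_ge0 ?addr_ge0 ?normc_ge0// ltW.
pose F (n : nat) (u : R) := \sum_(0 <= k < n) kker a 0 u * phi_term c (x * expR u) k.
(* The partial sums are at most e^{2t} with t^2 = xB e^u, and 2t <= t^2/(2xB) + 2xB = e^u/2 + 2xB:
   half of the decay of e^{-e^u} is enough to absorb them. *)
pose g (u : R) := expR (2 * x * B) * expR (- (2^-1 * expR u) + Re a * u).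
have FE k (u : R) : kker a 0 u * phi_term c (x * expR u) k =
    x%:C ^+ k / (k`!%:R * pochhammer c k) * kker (a + k%:R) 0 u.
  rewrite /phi_term cpowX_exp// rmorphXn /=.
  have -> : kker (a + k%:R) 0 u = kker a 0 u * cexp (k%:R * u%:C).
    by rewrite /kker -cexpD; congr cexp; ring.
  by ring.
have ki k : cintg (kker (a + k%:R) 0).
  by apply: cintg_kker => //; right; rewrite cReD Re_nat ltr_wpDr.
have ti k : cintg (fun u => kker a 0 u * phi_term c (x * expR u) k).
  by under eq_fun do rewrite FE; exact: cintgZ.
have xe u : 0 <= x * expR u by rewrite mulr_ge0 ?expR_ge0// ltW.
have [|||| Hi Hc] := @cint_dominated R F (fun u => kker a 0 u * phi c (x * expR u)) g.
- by move=> n; apply: cintg_meas; apply: cintg_sum.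
- move=> u; rewrite /F; under eq_fun do rewrite -mulr_sumr.
  by apply: ccvgZ; exact: phi_cvg (xe u) h.
- move=> n u; rewrite /F -mulr_sumr ComplexField.Normc.normcM.
  have h1 : normc (\sum_(0 <= k < n) phi_term c (x * expR u) k) <=
      expR (2 * Num.sqrt (x * expR u * B)).
    by apply: le_trans (normc_sum _ _ _) _; exact: phi_partial_le.
  apply: (@le_trans _ _ (normc (kker a 0 u) * expR (2 * Num.sqrt (x * expR u * B)))).
    by rewrite ler_wpM2l ?normc_ge0.
  rewrite normc_kker /g -!expRD ler_expR mul0r subr0.
  set t := Num.sqrt _; have tE : t ^+ 2 = x * expR u * B.
    by rewrite sqr_sqrtr// mulr_ge0// ltW.
  have xB : 0 < x * B by rewrite mulr_gt0.
  have h2 : 2 * t <= t ^+ 2 / (2 * (x * B)) + 2 * (x * B).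
    have : 0 <= (t - 2 * (x * B)) ^+ 2 / (2 * (x * B)).
      by rewrite divr_ge0 ?sqr_ge0// mulr_ge0// ltW.
    have -> : (t - 2 * (x * B)) ^+ 2 / (2 * (x * B)) = t ^+ 2 / (2 * (x * B)) + 2 * (x * B) - 2 * t.
      by field; rewrite !gt_eqF.
    by rewrite subr_ge0.
  have h3 : t ^+ 2 / (2 * (x * B)) = 2^-1 * expR u.
    by rewrite tE; field; rewrite !gt_eqF.
  by rewrite h3 in h2; lra.
- by apply: rintegrableZ; apply: rintegrable_ekern.
split => //.
have e n : cint (F n) = egamma a * \sum_(0 <= k < n) (pochhammer a k / pochhammer c k * (x%:C ^+ k / k`!%:R)).
  rewrite /F cint_sum// mulr_sumr; apply: eq_bigr => k _.
  under eq_fun do rewrite FE.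
  rewrite cintZ// -/(kint _ 0) -/(egamma _) egamma_pochhammer//.
  by field; rewrite factC_neq0 (apart_poch_neq0 k h).
have ga := egamma_neq0 a0.
have : ccvg (fun n => \sum_(0 <= k < n) (pochhammer a k / pochhammer c k * (x%:C ^+ k / k`!%:R)))
    ((egamma a)^-1 * cint (fun u => kker a 0 u * phi c (x * expR u))).
  have := ccvgZ (egamma a)^-1 Hc; under eq_fun do rewrite e mulKf//.
  by [].
by move=> /csum_eq E; rewrite /hyp1F1 E mulVKf.
Qed.

End Termwise.

(** * The Laplace-type integral of Tricomi's function *)

Section TricomiIntegral.
Context {R : realType}.
Local Notation cint := (cintegral setT).
Local Notation cintg := (cintegrable setT).
Local Notation RR := (measurableTypeR R * measurableTypeR R)%type.
Implicit Types (a c v z : R[i]) (x y dl : R).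

(** With t = e^r, the integral [tint a v x] is int_0^oo e^{-xt} t^{a-1} (1+t)^{-a-v} dt, the
    classical value of Gamma(a) Psi(a, 1 - v; x). *)
Definition tker a v x (r : R) : R[i] := ekern x a r * cpow (1 + expR r) (- (a + v)).
Definition tint a v x : R[i] := cint (tker a v x).

Lemma cmeas_kk a v x :
  cmeas (fun p : RR => kker a 0 p.1 * kker v (x * expR p.1) p.2).
Proof.
have m1 : measurable_fun setT (fun p : RR => p.1 : R) by exact: measurable_fst.
have m2 : measurable_fun setT (fun p : RR => p.2 : R) by exact: measurable_snd.
have me (f : RR -> R) : measurable_fun setT f -> measurable_fun setT (fun p => expR (f p)).
  by move=> mf; apply: measurableT_comp.
apply: cmeasM; apply: cmeas_cexp; apply: cmeasD.
- apply: cmeas_real; apply: measurable_funB; first by apply: measurable_funN; exact: me.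
  by apply: measurable_funM => //; apply: me; exact: measurable_funN.
- by apply: cmeasM; [exact: cmeas_cst|exact: cmeas_real].
- apply: cmeas_real; apply: measurable_funB; first by apply: measurable_funN; exact: me.
  apply: measurable_funM; last by apply: me; exact: measurable_funN.
  by apply: measurable_funM => //; exact: me.
- by apply: cmeasM; [exact: cmeas_cst|exact: cmeas_real].
Qed.

Lemma cmeas_hh a s x :
  cmeas (fun p : RR => ekern x a p.2 * ekern (1 + expR p.2) s p.1).
Proof.
have m1 : measurable_fun setT (fun p : RR => p.1 : R) by exact: measurable_fst.
have m2 : measurable_fun setT (fun p : RR => p.2 : R) by exact: measurable_snd.
have me (f : RR -> R) : measurable_fun setT f -> measurable_fun setT (fun p => expR (f p)).
  by move=> mf; apply: measurableT_comp.
apply: cmeasM; apply: cmeas_cexp; apply: cmeasD.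
- apply: cmeas_real; apply: measurable_funN; apply: measurable_funM => //; exact: me.
- by apply: cmeasM; [exact: cmeas_cst|exact: cmeas_real].
- apply: cmeas_real; apply: measurable_funN; apply: measurable_funM; last exact: me.
  by apply: measurable_funD => //; exact: me.
- by apply: cmeasM; [exact: cmeas_cst|exact: cmeas_real].
Qed.

Lemma exp_exp_real (x k : R) : 0 < x -> 0 <= k -> exists2 C : R, 0 < C & forall t : R,
  expR (- (x * expR t)) <= C * expR (- k * t).
Proof.
move=> x0 k0; pose m := (Num.truncn k).+1.
have km : k <= m%:R by apply: ltW; exact: truncnS_gt.
have m0 : 0 < m`!%:R / x ^+ m by rewrite divr_gt0 ?exprn_gt0// ltr0n fact_gt0.
exists (1 + m`!%:R / x ^+ m); first by rewrite addr_gt0.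
move=> t; rewrite -ler_pdivrMr ?expR_gt0// -expRN mulNr opprK.
have [t0|t0] := leP 0 t.
  have := @exp_exp_le R x t m x0 => h.
  apply: (@le_trans _ _ (m`!%:R / x ^+ m)); last by rewrite lerDr.
  apply: le_trans h; rewrite ler_wpM2l ?expR_ge0// ler_expR.
  by rewrite ler_wpM2r.
apply: (@le_trans _ _ 1); last by rewrite lerDl ltW.
rewrite -expRD -[leRHS]expR0 ler_expR.
have h1 : 0 <= x * expR t by rewrite mulr_ge0 ?expR_ge0// ltW.
have h2 : k * t <= 0 by rewrite mulr_ge0_le0// ltW.
lra.
Qed.

(** The coupling factor exp(-x e^{u-w}) is at most C e^{-k(u-w)}, which moves an exponent k from the
    variable u to w and separates the variables. *)
Lemma kk_bound a v x : 0 < x -> 0 < Re a -> 0 < Re (a + v) ->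
  exists f g : R -> R, [/\ rintegrable f, rintegrable g & forall u w,
    normc (kker a 0 u * kker v (x * expR u) w) <= f u * g w].
Proof.
move=> x0 a0 av.
(* Both remaining exponents must be positive, so k is taken between -Re v and Re a; the hypothesis
   on Re (a + v) makes room for it. *)
have [k [k0 ka kv]] : exists k : R, [/\ 0 <= k, 0 < Re a - k & 0 < Re v + k].
  rewrite cReD in av; have [v0|v0] := ltP 0 (Re v).
    by exists 0; rewrite subr0 addr0.
  by exists ((Re a - Re v) / 2); split; lra.
have [C C0 hC] := exp_exp_real x0 k0.
exists (fun u => C * expR (- expR u + (Re a - k) * u)), (fun w => expR (- expR w + (Re v + k) * w)).
split.
- by apply: rintegrableZ; exact: rgamma_integrable.
- exact: rgamma_integrable.
move=> u w; rewrite ComplexField.Normc.normcM !normc_kker mul0r subr0.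
have := hC (u - w) => h.
have -> : expR (- expR w - x * expR u * expR (- w) + Re v * w) =
   expR (- (x * expR (u - w))) * expR (- expR w + Re v * w).
  rewrite -expRD; congr expR; rewrite expRD; ring.
have -> : C * expR (- expR u + (Re a - k) * u) * expR (- expR w + (Re v + k) * w) =
   expR (- expR u + Re a * u) * (C * expR (- k * (u - w)) * expR (- expR w + Re v * w)).
  have e : expR (- expR u + (Re a - k) * u) * expR (- expR w + (Re v + k) * w) =
     expR (- expR u + Re a * u) * expR (- k * (u - w)) * expR (- expR w + Re v * w).
    by rewrite -!expRD; congr expR; ring.
  by rewrite -mulrA e; ring.
by rewrite ler_pM2l ?expR_gt0// ler_pM2r ?expR_gt0.
Qed.

Lemma hh_bound a s x (w r : R) :
  normc (ekern x a r * ekern (1 + expR r) s w) <=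
  expR (- expR w + Re s * w) * expR (- (x * expR r) + Re a * r).
Proof.
rewrite ComplexField.Normc.normcM !normc_ekern mulrC (ler_pM2r (expR_gt0 _)).
by rewrite ler_expR lerD2r lerN2 ler_peMl ?expR_ge0// lerDl expR_ge0.
Qed.

(** In the double integral over u and w, the shift u = r + w collects e^u + e^w into (1 + e^r) e^w.
    The integral over w is then a gamma integral at scale 1 + e^r, and the integral over r is
    [tint]. *)
Lemma kk_integral a v x : 0 < x -> 0 < Re a -> 0 < Re (a + v) ->
  cintg (fun u => kker a 0 u * kint v (x * expR u)) /\ cintg (tker a v x) /\
  cint (fun u => kker a 0 u * kint v (x * expR u)) = egamma (a + v) * tint a v x.
Proof.
move=> x0 a0 av.
have xe u : 0 < x * expR u by rewrite mulr_gt0 ?expR_gt0.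
have [f [g [fi gi fg]]] := kk_bound x0 a0 av.
have mkk := cmeas_kk a v x.
pose F u w := kker a 0 u * kker v (x * expR u) w.
pose G w r := ekern x a r * ekern (1 + expR r) (a + v) w.
have [I1 I2 E1] := @cint_fubini_prod R F f g mkk fi gi fg.
have inner u : cint (F u) = kker a 0 u * kint v (x * expR u).
  exact: (cintZ (kker a 0 u) (@cintg_kker R v (x * expR u) (ltW (xe u)) (or_introl (xe u)))).
have shiftw w : cint (F^~ w) = cint (G w).
  have Fi : cintg (F^~ w).
    apply: (@cintg_le R _ (fun u => g w * f u)).
    - exact: (cmeas_sect1 w mkk).
    - by move=> u; rewrite mulrC; exact: fg.
    - exact: rintegrableZ.
  rewrite -(cint_shift w Fi); congr (cintegral setT _); apply/funext => r.
  rewrite /F /G /kker /ekern -!cexpD; congr cexp.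
  have -> : x * expR (r + w) * expR (- w) = x * expR r.
    by rewrite -mulrA -expRD addrK.
  rewrite mul0r subr0 expRD mulrDl mul1r (rmorphD _ r w) /=.
  by rewrite !(rmorphB, rmorphN, rmorphD) /=; ring.
have hh := cmeas_hh a (a + v) x.
have fi' := rgamma_integrable av.
have gi' := rintegrable_ekern x0 a0.
have Gb := hh_bound a (a + v) x.
have [J1 J2 E2] := @cint_fubini_prod R G _ _ hh fi' gi' Gb.
have inner2 r : cint (G^~ r) = egamma (a + v) * tker a v x r.
  have l0 : 0 < 1 + expR r by rewrite addr_gt0 ?expR_gt0.
  have e : cint (G^~ r) = ekern x a r * cint (ekern (1 + expR r) (a + v)).
    exact: (cintZ _ (cintg_ekern l0 av)).
  rewrite e (cint_ekern l0 av) mulrA mulrC; reflexivity.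
have J2' : cintg (fun r => egamma (a + v) * tker a v x r).
  exact: (eq_ind _ (cintegrable setT) J2 _ (funext inner2)).
have I1' : cintg (fun u => kker a 0 u * kint v (x * expR u)).
  exact: (eq_ind _ (cintegrable setT) I1 _ (funext inner)).
have ga := egamma_neq0 av.
have tI : cintg (tker a v x).
  have e : (fun r => (egamma (a + v))^-1 * (egamma (a + v) * tker a v x r)) = tker a v x.
    apply/funext => r; exact: (mulKf ga).
  exact: (eq_ind _ (cintegrable setT) (cintgZ (egamma (a + v))^-1 J2') _ e).
have E3 : cint (fun u => kker a 0 u * kint v (x * expR u)) = cint (fun u => cint (F u)).
  exact: (esym (f_equal (cintegral setT) (funext inner))).
have E4 : cint (fun w => cint (F^~ w)) = cint (fun w => cint (G w)).
  exact: (f_equal (cintegral setT) (funext shiftw)).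
have E5 : cint (fun r => cint (G^~ r)) = cint (fun r => egamma (a + v) * tker a v x r).
  exact: (f_equal (cintegral setT) (funext inner2)).
have E6 := cintZ (egamma (a + v)) tI.
exact: (conj I1' (conj tI (etrans E3 (etrans E1 (etrans E4 (etrans E2 (etrans E5 E6))))))).
Qed.

End TricomiIntegral.

(** * The continued gamma function in terms of the whole-line integral *)

Section GammaFunction.
Context {R : realType}.
Local Notation cint := (cintegral setT).
Local Notation cintg := (cintegrable setT).
Implicit Types (a c v z : R[i]) (x y : R).

Lemma eq_cintegral (D : set R) (F G : R -> R[i]) : {in D, F =1 G} ->
  cintegral D F = cintegral D G.
Proof.
move=> FG; rewrite /cintegral; congr (_ +i* _);
  by apply: eq_Rintegral => t Dt; rewrite FG.
Qed.

(** The offset 2 in the index keeps the endpoints distinct even for n = 0. *)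
Lemma bigcup_itv_gt (a : R) :
  `]a, +oo[%classic = \bigcup_n `[a + n.+2%:R^-1, a + n.+2%:R]%classic.
Proof.
apply/seteqP; split => t /=; rewrite in_itv/= andbT; last first.
  by move=> [n _] /=; rewrite in_itv/= => /andP[+ _]; apply: lt_le_trans; rewrite ltrDl invr_gt0.
move=> t0; have ta : 0 < t - a by rewrite subr_gt0.
pose n := (Num.truncn (t - a) + Num.truncn (t - a)^-1)%N.
have n1 : t - a <= n.+2%:R.
  apply/ltW; apply: lt_le_trans (truncnS_gt _) _; rewrite ler_nat.
  by rewrite /n ltnS leqW// leq_addr.
have n2 : (t - a)^-1 <= n.+2%:R.
  apply/ltW; apply: lt_le_trans (truncnS_gt _) _; rewrite ler_nat.
  by rewrite /n ltnS leqW// leq_addl.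
exists n => //=; rewrite in_itv/=; apply/andP; split.
  by rewrite -lerBrDl -[leRHS]invrK lef_pV2 ?posrE ?invr_gt0.
by rewrite -lerBlDl.
Qed.

Lemma itv_gt_noninc (a : R) : nonincreasing_seq (fun n : nat => a + n.+2%:R^-1).
Proof. by move=> n m nm; rewrite lerD2l lef_pV2 ?posrE// ler_nat !ltnS. Qed.

Lemma itv_gt_nondec (a : R) : nondecreasing_seq (fun n : nat => a + n.+2%:R).
Proof. by move=> n m nm; rewrite lerD2l ler_nat !ltnS. Qed.

Lemma itv_gt_lt (a : R) (n : nat) : a + n.+2%:R^-1 < a + n.+2%:R.
Proof.
rewrite ltrD2l; apply: (@lt_trans _ _ 1); last by rewrite ltr1n.
by rewrite invf_lt1// ltr1n.
Qed.

Lemma euler_gammaE z : 0 < Re z -> euler_gamma z = egamma z.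
Proof.
move=> z0; rewrite /egamma /kint.
have ki : cintg (kker z 0) by apply: cintg_kker => //; right.
have noninc : nonincreasing_seq (fun n : nat => 0 + n.+2%:R^-1 : R) := itv_gt_noninc 0.
have [||||||_ ->] := @cint_substitution R `]0, +oo[%classic (fun n => 0 + n.+2%:R^-1)
  (fun n => 0 + n.+2%:R) (@ln R) (fun x => x^-1) (itv_gt_lt 0) noninc
  (itv_gt_nondec 0) (bigcup_itv_gt 0) _ _ _ _ _ _ (kker z 0) (ccont_kker z 0) ki.
- exact: interval_open.
- by move=> t /=; rewrite in_itv/= andbT => t0; exact: is_derive1_ln.
- move=> t /=; rewrite in_itv/= andbT => t0; apply: (@cvgV _ _ _ _ id); last exact: cvg_id.
  by rewrite gt_eqF.
- by move=> t /=; rewrite in_itv/= andbT invr_gt0.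
- move=> A; have [n hn] : exists n : nat, expR (- A) <= n.+2%:R.
    exists (Num.truncn (expR (- A))); apply/ltW.
    by apply: lt_le_trans (truncnS_gt _) _; rewrite ler_nat.
  exists n; rewrite add0r lnV ?posrE// lerNl -[leLHS]expRK ler_ln ?posrE ?expR_gt0//.
- move=> A; have [n hn] : exists n : nat, expR A <= n.+2%:R.
    exists (Num.truncn (expR A)); apply/ltW.
    by apply: lt_le_trans (truncnS_gt _) _; rewrite ler_nat.
  by exists n; rewrite add0r -[leLHS]expRK ler_ln ?posrE ?expR_gt0.
apply: eq_cintegral => t; rewrite inE /= in_itv/= andbT => t0.
rewrite /kker /cpow mul0r subr0 lnK ?posrE// -cexpR -cexpD.
have -> : ((t^-1)%:C : R[i]) = cexp (- (ln t)%:C).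
  by rewrite -rmorphN cexpR expRN lnK ?posrE.
by rewrite -cexpD; congr cexp; rewrite rmorphN /=; ring.
Qed.

Lemma cgammaE z : 0 < Re z -> cgamma z = egamma z.
Proof.
move=> z0; rewrite /cgamma.
have -> : Num.truncn (1 - Re z) = 0%N.
  by apply/eqP; rewrite -leqn0 truncn_le_nat; lra.
by rewrite addr0 pochhammer0 divr1 euler_gammaE.
Qed.

(** The form needed for Gamma(v) and Gamma(-v) with |Re v| < 1: at most one step of the continuation
    is used, and v = 0 is excluded. *)
Lemma cgamma_shiftE z : -1 < Re z -> z != 0 -> cgamma z = egamma (1 + z) / z.
Proof.
move=> z1 zn0; have [z0|z0] := ltP 0 (Re z).
  by rewrite cgammaE// addrC egamma_rec// mulrAC divff// mul1r.
rewrite /cgamma; have -> : Num.truncn (1 - Re z) = 1%N.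
  by apply: truncn_def; apply/andP; split; lra.
rewrite pochhammerSr pochhammer0 mul1r addr0 euler_gammaE 1?addrC//.
by rewrite cReD /=; lra.
Qed.

End GammaFunction.

(** * Tricomi's and Whittaker's functions as integrals *)

Lemma half_C {R : realType} : (((1 / 2 : R)%:C) : R[i]) = 1 / 2.
Proof. by rewrite fmorph_div rmorph1 rmorph_nat. Qed.

Section TricomiValue.
Context {R : realType}.
Local Notation cint := (cintegral setT).
Local Notation cintg := (cintegrable setT).
Implicit Types (a c v z : R[i]) (x y : R).

(** The connection formula at y = x e^u is integrated against the gamma kernel of exponent a: its
    left side is given by [kk_integral], its two 0F1 terms by [kker_phi_int], where the factor (x
    e^u)^v raises the second exponent to a + v. *)
Lemma tricomi_nonint_tint a v x : 0 < x -> 0 < Re a -> 0 < Re (a + v) ->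
  v != 0 -> `|Re v| < 1 ->
  tricomi_nonint a (1 - v) x = tint a v x / egamma a.
Proof.
move=> x0 a0 av v0 v1.
have [I1 [_ E]] := kk_integral x0 a0 av.
have [dl h] := zapartP v0 v1.
have ap1 : apart dl (1 - v) := zapart_apartB 1 h.
have ap2 : apart dl (1 + v) := zapart_apartD 1 h.
have [p1 q1] := kker_phi_int x0 a0 ap1.
have [p2 q2] := kker_phi_int x0 av ap2.
have xe u : 0 < x * expR u by rewrite mulr_gt0 ?expR_gt0.
have K u : v * (kker a 0 u * kint v (x * expR u)) =
   egamma (1 + v) * (kker a 0 u * phi (1 - v) (x * expR u)) -
   (cpow x v * egamma (1 - v)) * (kker (a + v) 0 u * phi (1 + v) (x * expR u)).
  rewrite mulrCA kint_connection//.
  have -> : kker (a + v) 0 u = kker a 0 u * cexp (v * u%:C).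
    by rewrite /kker -cexpD; congr cexp; ring.
  have -> : cpow (x * expR u) v = cpow x v * cexp (v * u%:C).
    by rewrite /cpow lnM ?posrE ?expR_gt0// expRK rmorphD /= mulrDr cexpD.
  ring.
have : v * (egamma (a + v) * tint a v x) = egamma (1 + v) * (egamma a * hyp1F1 a (1 - v) x%:C) -
   (cpow x v * egamma (1 - v)) * (egamma (a + v) * hyp1F1 (a + v) (1 + v) x%:C).
  rewrite -E -q1 -q2.
  have e0 := cintZ v I1; have e1 := cintZ (egamma (1 + v)) p1.
  have e2 := cintZ (cpow x v * egamma (1 - v)) p2.
  have eB := cintB (cintgZ (egamma (1 + v)) p1) (cintgZ (cpow x v * egamma (1 - v)) p2).
  exact: (etrans (esym e0) (etrans (f_equal (cintegral setT) (funext K))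
    (etrans eB (f_equal2 (fun p q => p - q) e1 e2)))).
move=> {}E; have ga := egamma_neq0 a0; have gv := egamma_neq0 av.
have /andP[v2 v3] : -1 < Re v < 1 by rewrite -ltr_norml.
rewrite /tricomi_nonint.
have -> : 1 - (1 - v) = v by ring.
have -> : a - (1 - v) + 1 = a + v by ring.
have -> : 1 - v - 1 = - v by ring.
have -> : 2 - (1 - v) = 1 + v by ring.
rewrite (cgamma_shiftE v2 v0) (cgammaE a0) (cgammaE av).
rewrite cgamma_shiftE ?oppr_eq0//; last by rewrite cReN ltrN2.
have -> : tint a v x = (v * (egamma (a + v) * tint a v x)) / (v * egamma (a + v)).
  by field; rewrite v0 gv.
rewrite E; field; by rewrite v0 ga gv.
Qed.

(** Lipschitz continuity at v = 0, which will identify the limit that defines Psi at c = 1. *)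
Lemma tint_continuous a x : 0 < x -> 0 < Re a -> exists K : R, 0 < K /\
  forall v, normc v <= 1 -> 0 < Re (a + v) ->
  normc (tint a v x - tint a 0 x) <= K * normc v.
Proof.
move=> x0 a0.
have a1 : 0 < Re a + 1 by rewrite addr_gt0.
have a2 : 0 < Re a + 2 by rewrite addr_gt0.
have i1 := rintegrable_ekern x0 a1; have i2 := rintegrable_ekern x0 a2.
(* With L = ln(1 + e^r), [normc_cexp_sub1] bounds (1+e^r)^{-v} - 1 by 2|v| L e^L for |v| <= 1, and L
   <= e^r, e^L = 1 + e^r. The product e^r + e^{2r} shifts the exponent by 1 and 2. *)
pose g r := 2 * (expR (- (x * expR r) + (Re a + 1) * r) + expR (- (x * expR r) + (Re a + 2) * r)).
have gi : rintegrable g by apply: rintegrableZ; exact: rintegrableD.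
have g0 r : 0 <= g r by rewrite mulr_ge0// addr_ge0// expR_ge0.
exists (1 + rint g); split; first by rewrite ltr_pwDl// rint_ge0.
move=> v v1 av.
have [_ [T1 _]] := kk_integral x0 a0 av.
have a00 : 0 < Re (a + 0) by rewrite addr0.
have [_ [T0 _]] := kk_integral x0 a0 a00.
rewrite /tint -cintB//.
apply: (@le_trans _ _ (rint (fun r => normc v * g r))); last first.
  by rewrite rintZ// mulrC ler_wpM2r ?normc_ge0// lerDr.
apply: cint_le; [by apply: cintg_meas; exact: cintgB| |exact: rintegrableZ].
move=> r; rewrite /tker addr0.
have e0 := expR_gt0 r.
have l1 : 0 < 1 + expR r by rewrite addr_gt0.
set L := ln (1 + expR r).
have L0 : 0 <= L by rewrite ln_ge0// lerDl ltW.
have Le : L <= expR r by apply: le_ln1Dx; apply: lt_trans e0; rewrite oppr_lt0.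
have -> : ekern x a r * cpow (1 + expR r) (- (a + v)) - ekern x a r * cpow (1 + expR r) (- a) =
    ekern x a r * cpow (1 + expR r) (- a) * (cexp (- v * L%:C) - 1).
  by rewrite opprD cpowD {2}/cpow -/L; ring.
rewrite ComplexField.Normc.normcM (ComplexField.Normc.normcM (ekern x a r)) normc_ekern.
have c1 : normc (cpow (1 + expR r) (- a)) <= 1.
  rewrite /cpow normc_cexp -[leRHS]expR0 ler_expR cReMr cReN mulNr oppr_le0.
  by rewrite mulr_ge0// ltW.
have c2 : normc (cexp (- v * L%:C) - 1) <= normc v * (2 * (expR r * (1 + expR r))).
  apply: (le_trans (normc_cexp_sub1 _)).
  rewrite ComplexField.Normc.normcM normcN normcR (ger0_norm L0) cReMr cReN mulNr normrN normrM (ger0_norm L0).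
  have h1 : `|Re v| * L <= L.
    by rewrite -[leRHS]mul1r ler_wpM2r// (le_trans (ler_Re_normc _)).
  have h2 : expR (`|Re v| * L) <= 1 + expR r.
    by apply: (@le_trans _ _ (expR L)); [rewrite ler_expR|rewrite lnK// posrE].
  rewrite -mulr_natl; apply: (@le_trans _ _ (2 * (normc v * expR r * (1 + expR r)))).
    rewrite ler_pM2l// ler_pM ?mulr_ge0 ?normc_ge0 ?expR_ge0//.
    by rewrite ler_wpM2l ?normc_ge0.
  by rewrite le_eqVlt; apply/orP; left; apply/eqP; ring.
set A := expR (- (x * expR r) + Re a * r).
have A0 : 0 < A by exact: expR_gt0.
have gE : g r = 2 * (A * (expR r * (1 + expR r))).
  have f1 : expR (- (x * expR r) + (Re a + 1) * r) = A * expR r.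
    by rewrite -expRD; congr expR; ring.
  have f2 : expR (- (x * expR r) + (Re a + 2) * r) = A * expR r * expR r.
    by rewrite -!expRD; congr expR; ring.
  by rewrite /g f1 f2; ring.
apply: (@le_trans _ _ (A * 1 * (normc v * (2 * (expR r * (1 + expR r)))))).
  rewrite ler_pM ?mulr_ge0 ?normc_ge0 ?(ltW A0)//.
  by rewrite ler_pM2l.
by rewrite gE le_eqVlt; apply/orP; left; apply/eqP; ring.
Qed.

(** Here c = 1 is an integer, so the value is the limit over c' = 1 - v with v -> 0, v nonzero,
    where the non-integer formula holds. *)
Lemma tricomi_one a x : 0 < x -> 0 < Re a -> tricomi a 1 x = tint a 0 x / egamma a.
Proof.
move=> x0 a0; rewrite /tricomi.
case: asboolP => [_|[]]; last by exists 1.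
have [K [K0 hK]] := tint_continuous x0 a0.
have ga := egamma_neq0 a0; have nga : 0 < normc (egamma a) by rewrite normc_gt0.
apply: (@cvg_lim (R[i])^o _ _ (((1 : R[i]) : (R[i])^o)^') _
  ((fun c' => tricomi_nonint a c' x) : _ -> (R[i])^o) (tint a 0 x / egamma a)).
  exact: norm_hausdorff.
apply/cvgrPdist_lt => e e0.
have [r r0 ->] : exists2 r : R, 0 < r & e = r%:C.
  by case: e e0 => [p q]; rewrite ltcE/= => /andP[/eqP -> p0]; exists p.
(* The three bounds secure |Re v| < 1, Re (a + v) > 0, and an error K |v| / |Gamma(a)| below r. *)
pose d := Num.min (Num.min (1 / 2) (Re a)) (r * normc (egamma a) / K).
have d0 : 0 < d by rewrite !lt_min a0 !divr_gt0 ?mulr_gt0.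
have near1 : \forall c' \near (1 : (R[i])^o)^', `|1 - c'| < d%:C.
  by apply: nbhs_dnbhs; apply/nbhs_ballP; exists d%:C => //=; rewrite ltcR.
have near2 : \forall c' \near (1 : (R[i])^o)^', c' != 1 by exact: nbhs_dnbhs_neq.
near=> c'.
have c1 : c' != 1 by near: c'.
have c2 : `|1 - c'| < d%:C by near: c'.
pose v := 1 - c'.
have {}c2 : normc v < d by move: c2; rewrite normc_def -normcE2 ltcR.
have v0 : v != 0 by rewrite subr_eq0 eq_sym.
have [d1 d2 d3] : [/\ d <= 1 / 2, d <= Re a & d <= r * normc (egamma a) / K].
  by rewrite /d !ge_min !lexx ?orbT.
have rv := ler_Re_normc v.
have v1 : `|Re v| < 1 by lra.
have av : 0 < Re (a + v).
  by rewrite cReD; move: rv; rewrite ler_norml => /andP[]; lra.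
have -> : c' = 1 - v by rewrite /v; ring.
rewrite (tricomi_nonint_tint x0 a0 av v0 v1) normc_def -normcE2 ltcR normcB.
rewrite -mulrBl ComplexField.Normc.normcM ComplexField.Normc.normcV ltr_pdivrMr//.
have vl1 : normc v <= 1 by lra.
apply: (le_lt_trans (hK v vl1 av)).
by rewrite -ltr_pdivlMl// mulrC; apply: lt_le_trans c2 _.
Unshelve. all: by end_near. Qed.

(** Here c = 1 - v with v = -2it. The condition mu < 1/2 makes both Re a and Re (a + v) positive. *)
Lemma whittaker_tint (mu t x : R) : 0 < x -> mu < 1 / 2 ->
  let a := (1 / 2 - mu)%:C + t *i in
  whittakerW mu%:C (t *i) x =
  (expR (- x / 2))%:C * cpow x (t *i + 1 / 2) * (tint a (- (2 * t) *i) x / egamma a).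
Proof.
move=> x0 m a; rewrite /whittakerW; congr (_ * _).
have -> : 1 / 2 + t *i - mu%:C = a.
  by rewrite -half_C /a rmorphB /= addrAC.
have a0 : 0 < Re a by rewrite /a cReD /= addr0 subr_gt0.
have cE : 2 * t *i + 1 = 1 - (- (2 * t) *i).
  apply: complex_eqP; rewrite ?(cReD, cImD, cReN, cImN, cReM, cImM, Re_nat, Im_nat) /=; ring.
have [t0|t0] := eqVneq t 0.
  have -> : 2 * t *i + 1 = 1.
    by apply: complex_eqP; rewrite t0 ?(cReD, cImD, cReM, cImM) /=; ring.
  have -> : - (2 * t) *i = 0 by apply: complex_eqP => /=; rewrite ?t0 ?mulr0 oppr0.
  exact: tricomi_one.
(* For nonzero t the imaginary part 2t of c shows that c is not an integer. *)
rewrite /tricomi; case: asboolP => [[m' E]|_].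
  move: E; rewrite cE => /(congr1 (@complex.Im R)) /eqP.
  rewrite -(rmorph_int (real_complex R)) cImB /= sub0r opprK.
  by rewrite mulf_eq0 pnatr_eq0/= (negbTE t0).
rewrite cE tricomi_nonint_tint//.
- by rewrite cReD /= ?oppr0 addr0.
- apply/eqP => /(congr1 (@complex.Im R)) /= /eqP.
  by rewrite oppr_eq0 mulf_eq0 pnatr_eq0/= (negbTE t0).
- by rewrite /= ?oppr0 normr0 ltr01.
Qed.

End TricomiValue.

(** * Products of integrals, the elementary case of order 1/2, and duplication *)

Section Convolution.
Context {R : realType}.
Local Notation cint := (cintegral setT).
Local Notation cintg := (cintegrable setT).
Local Notation RR := (measurableTypeR R * measurableTypeR R)%type.
Implicit Types F G : R -> R[i].

Lemma cint_convolution F G : cintg F -> cintg G ->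
  cintg (fun y => cint (fun x => F x * G (y - x))) /\
  cint F * cint G = cint (fun y => cint (fun x => F x * G (y - x))).
Proof.
move=> Fi Gi.
pose H (x y : R) := F x * G (y - x).
pose h (x y : R) := normc (F x) * normc (G (y - x)).
have mF := cintg_meas Fi; have mG := cintg_meas Gi.
have mH : cmeas (fun p : RR => H p.1 p.2).
  have m1 : measurable_fun setT (fun p : RR => p.1) by exact: measurable_fst.
  have m2 : measurable_fun setT (fun p : RR => (p.2 : R) - p.1).
    by apply: measurable_funB; [exact: measurable_snd|exact: measurable_fst].
  apply: cmeasM; first exact: (cmeas_comp mF m1).
  exact: (cmeas_comp mG m2).
have Gs x : cintg (fun y => G (y - x)) by exact: cintg_shift.
have hi x : rintegrable (h x) by apply: rintegrableZ; exact: (cintg_norm (Gs x)).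
have hE x : rint (h x) = rint (fun y => normc (G y)) * normc (F x).
  rewrite rintZ; last exact: (cintg_norm (Gs x)).
  rewrite mulrC; congr (_ * _).
  rewrite [RHS](@rint_affine _ 1 (- x))//; last exact: (cintg_norm Gi).
  by rewrite normr1 mul1r; congr (rint _); apply/funext => y; rewrite mul1r.
have hI : rintegrable (fun x => rint (h x)).
  rewrite (_ : (fun x => rint (h x)) = fun x => rint (fun y => normc (G y)) * normc (F x)).
    by apply: rintegrableZ; exact: cintg_norm.
  by apply/funext => x; exact: hE.
have hb x y : normc (H x y) <= h x y by rewrite /H /h ComplexField.Normc.normcM.
have [I1 I2 E] := @cint_fubini R H h mH hi hI hb.
split; first exact: I2.
have inner x : cint (H x) = cint G * F x.
  have e := cintZ (F x) (Gs x).
  have e2 := cint_shift (- x) Gi.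
  by rewrite [LHS]e e2 mulrC.
have e3 : cint (fun x => cint (H x)) = cint G * cint F.
  exact: (etrans (f_equal (cintegral setT) (funext inner)) (cintZ (cint G) Fi)).
by rewrite mulrC -e3; exact: E.
Qed.

End Convolution.

Section ClosedForms.
Context {R : realType}.
Local Notation cint := (cintegral setT).
Local Notation cintg := (cintegrable setT).

Definition rkint (s y : R) : R := rint (fun u => expR (- expR u - y * expR (- u) + s * u)).

Lemma kkerR (s y u : R) : kker s%:C y u = (expR (- expR u - y * expR (- u) + s * u))%:C.
Proof. by rewrite /kker -rmorphM -rmorphD cexpR. Qed.

Lemma kintR (s y : R) : kint s%:C y = (rkint s y)%:C.
Proof. by rewrite /kint /rkint -cintR; congr (cint _); apply/funext => u; rewrite kkerR. Qed.

Lemma rkint_integrable (s y : R) : 0 < y ->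
  rintegrable (fun u => expR (- expR u - y * expR (- u) + s * u)).
Proof.
move=> y0; have [] := @cintg_kker R s%:C y (ltW y0) (or_introl y0).
by under eq_fun do rewrite kkerR /=.
Qed.

Lemma cpowR (x s : R) : cpow x s%:C = (expR (s * ln x))%:C.
Proof. by rewrite /cpow -rmorphM cexpR. Qed.

Lemma rkint_reflect (s y : R) : 0 < y -> rkint (- s) y = expR (- s * ln y) * rkint s y.
Proof.
move=> y0; apply: complexI; rewrite -kintR rmorphN /= kint_reflect// kintR.
by rewrite -rmorphN cpowR -rmorphM.
Qed.

(* Cauchy-Schloemilch substitution t = e^(u/2) - sqrt(y) e^(-u/2) in the
   Gaussian integral. *)
Lemma rkint_half (y : R) : 0 < y ->
  rkint (1 / 2) y = Num.sqrt pi * expR (- (2 * Num.sqrt y)).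
Proof.
move=> y0; set s := Num.sqrt y; have s0 : 0 < s by rewrite sqrtr_gt0.
have sE : s ^+ 2 = y by rewrite sqr_sqrtr// ltW.
pose phi (u : R) := expR (u / 2) - s * expR (- (u / 2)).
pose dphi (u : R) := (expR (u / 2) + s * expR (- (u / 2))) / 2.
have dphiE (u : R) : setT u -> is_derive u 1 phi (dphi u).
  move=> _.
  have d1 : is_derive u 1 (fun t : R => t / 2) (2^-1).
    rewrite -[fun _ => _]/((id : R -> R) * cst 2^-1); apply: is_derive_eq.
    by rewrite /GRing.scale /= mulr0 add0r mulr1.
  have d2 : is_derive u 1 (fun t : R => - (t / 2)) (- 2^-1) by exact: is_deriveN.
  have d3 : is_derive u 1 (expR \o (fun t : R => t / 2)) (expR (u / 2) * 2^-1) by exact: is_derive1_comp.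
  have d4 : is_derive u 1 (expR \o (fun t : R => - (t / 2))) (expR (- (u / 2)) * - 2^-1) by exact: is_derive1_comp.
  rewrite /phi -[fun _ => _]/((expR \o (fun t : R => t / 2)) - s *: (expR \o (fun t : R => - (t / 2)))).
  by apply: is_derive_eq; rewrite /GRing.scale /= /dphi; field.
have ch (u : R) : {for u, continuous (fun t : R => t / 2)} by exact: mulrr_continuous.
have cdphi (u : R) : setT u -> {for u, continuous dphi}.
  move=> _; apply: cvgM; last exact: cvg_cst.
  apply: cvgD.
    by apply: continuous_comp; [exact: ch|exact: continuous_expR].
  apply: cvgM; first exact: cvg_cst.
  apply: continuous_comp; last exact: continuous_expR.
  by apply: cvgN; exact: ch.
have dphi0 (u : R) : setT u -> 0 < dphi u.
  by move=> _; rewrite /dphi divr_gt0// addr_gt0 ?mulr_gt0 ?expR_gt0.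
have DE : [set: R] = \bigcup_n `[- n.+1%:R, n.+1%:R]%classic.
  apply/seteqP; split => // u _; exists (Num.truncn `|u|) => //=.
  by rewrite in_itv/= -ler_norml ltW// truncnS_gt.
have noninc : nonincreasing_seq (fun n : nat => - n.+1%:R : R).
  by move=> n m nm; rewrite lerN2 ler_nat ltnS.
have nondec : nondecreasing_seq (fun n : nat => n.+1%:R : R).
  by move=> n m nm; rewrite ler_nat ltnS.
have lt n : - n.+1%:R < n.+1%:R :> R by rewrite gtrN.
have ex1 (t : R) : 1 + t / 2 <= expR (t / 2) := expR_ge1Dx _.
have phial (A : R) : exists n : nat, phi (- n.+1%:R) <= A.
  pose n := Num.truncn (2 * (`|A| + 1) / s); exists n.
  have hn : 2 * (`|A| + 1) / s < n.+1%:R by exact: truncnS_gt.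
  rewrite /phi mulNr opprK.
  have h1 : expR (- (n.+1%:R / 2)) <= 1 :> R by rewrite expR_le1 oppr_le0.
  have h2 := ex1 n.+1%:R.
  have h3 : s * (1 + n.+1%:R / 2) <= s * expR (n.+1%:R / 2) by rewrite ler_pM2l.
  have h4 : 2 * (`|A| + 1) < n.+1%:R * s by rewrite -ltr_pdivrMr.
  by have := ler_norm (- A); rewrite normrN; nra.
have phibe (A : R) : exists n : nat, A <= phi n.+1%:R.
  pose n := Num.truncn (2 * (`|A| + s)); exists n.
  have hn : 2 * (`|A| + s) < n.+1%:R by exact: truncnS_gt.
  rewrite /phi.
  have h1 : expR (- (n.+1%:R / 2)) <= 1 :> R by rewrite expR_le1 oppr_le0.
  have h2 := ex1 n.+1%:R.
  have h3 : s * expR (- (n.+1%:R / 2)) <= s by rewrite -[leRHS]mulr1 ler_pM2l.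
  by have := ler_norm A; lra.
have gi : rintegrable (@gauss_fun R) by exact: integrableT_gauss.
have := @substitution R setT _ _ phi dphi lt noninc nondec DE openT dphiE cdphi
  dphi0 phial phibe _ (@continuous_gauss_fun R) gi.
have -> : rint (@gauss_fun R) = Num.sqrt pi by rewrite /rint /Rintegral integralT_gauss.
move=> ->.
have gE (u : R) : gauss_fun (phi u) * dphi u =
   (expR (2 * s) / 2) * (expR (- expR u - y * expR (- u) + 1 / 2 * u) +
     s * expR (- expR u - y * expR (- u) + (- (1 / 2)) * u)).
  have e1 : expR u = expR (u / 2) ^+ 2 by rewrite -expRM_natl; congr expR; field.
  have e2 : expR (- u) = expR (- (u / 2)) ^+ 2 by rewrite -expRM_natl; congr expR; field.
  have e3 : expR (u / 2) * expR (- (u / 2)) = 1 by rewrite -expRD subrr expR0.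
  have e4 : - phi u ^+ 2 = 2 * s + (- expR u - y * expR (- u)).
    have -> : phi u ^+ 2 = expR (u / 2) ^+ 2 + s ^+ 2 * expR (- (u / 2)) ^+ 2 -
        2 * s * (expR (u / 2) * expR (- (u / 2))) by rewrite /phi; ring.
    by rewrite e3 -e1 -e2 sE; ring.
  rewrite /gauss_fun /dphi e4; set E := - expR u - y * expR (- u).
  rewrite (expRD (2 * s) E) (expRD E) (expRD E).
  have -> : 1 / 2 * u = u / 2 by ring.
  have -> : - (1 / 2) * u = - (u / 2) by ring.
  by field.
have -> : (\int[lebesgue_measure]_(x in setT) (gauss_fun (phi x) * dphi x)) =
   expR (2 * s) / 2 * (rkint (1 / 2) y + s * rkint (- (1 / 2)) y).
  have i1 := rkint_integrable (1 / 2) y0; have i2 := rkint_integrable (- (1 / 2)) y0.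
  have e := rintD i1 (rintegrableZ s i2); rewrite rintZ// in e.
  rewrite -[X in _ * X]e -rintZ; last by apply: rintegrableD => //; exact: rintegrableZ.
  by congr (rint _); apply/funext => u; exact: gE.
(* By reflection, sqrt(y) times the integral of exponent -1/2 equals the one of exponent 1/2, so the
   two summands produced by the derivative of the substitution coincide. *)
rewrite rkint_reflect//.
have -> : s * (expR (- (1 / 2) * ln y) * rkint (1 / 2) y) = rkint (1 / 2) y.
  have -> : expR (- (1 / 2) * ln y) = s^-1.
    have -> : ln y = 2 * ln s by rewrite -sE lnXn// mulr_natl.
    have -> : - (1 / 2) * (2 * ln s) = - ln s by field.
    by rewrite expRN lnK// posrE.
  by rewrite mulVKf// gt_eqF.
rewrite expRN; field.
by rewrite gt_eqF ?expR_gt0.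
Qed.

Lemma kint_Nhalf (y : R) : 0 < y ->
  kint (- (1 / 2))%:C y = (Num.sqrt pi / Num.sqrt y * expR (- (2 * Num.sqrt y)))%:C.
Proof.
move=> y0; rewrite kintR rkint_reflect// rkint_half//; congr (_%:C).
have s0 : 0 < Num.sqrt y by rewrite sqrtr_gt0.
have -> : expR (- (1 / 2) * ln y) = (Num.sqrt y)^-1.
  have -> : ln y = 2 * ln (Num.sqrt y) by rewrite -{1}(sqr_sqrtr (ltW y0)) lnXn// mulr_natl.
  have -> : - (1 / 2) * (2 * ln (Num.sqrt y)) = - ln (Num.sqrt y) by field.
  by rewrite expRN lnK// posrE.
by ring.
Qed.

Lemma sqrt_expR (t : R) : Num.sqrt (expR t) = expR (t / 2).
Proof.
have -> : expR t = expR (t / 2) ^+ 2 by rewrite -expRM_natl; congr expR; field.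
by rewrite sqrtr_sqr ger0_norm// expR_ge0.
Qed.

(** The product of the two gamma integrals is a convolution whose inner integral is [kint] of order
    -1/2 at e^g, known in closed form. What remains is a gamma integral in g/2 at scale 2 and
    exponent 2w. *)
Lemma egamma_duplication (w : R[i]) : 0 < Re w ->
  egamma w * egamma (w + (1 / 2)%:C) = 2 * (Num.sqrt pi)%:C * cpow 2 (- (2 * w)) * egamma (2 * w).
Proof.
move=> w0; have w1 : 0 < Re (w + (1 / 2)%:C) by rewrite cReD /=; lra.
have i1 := cintg_kker (lexx (0 : R)) (or_intror w0).
have i2 := cintg_kker (lexx (0 : R)) (or_intror w1).
have [ci cE] := cint_convolution i1 i2.
rewrite /egamma {1}/kint {1}/kint cE.
have w2 : 0 < Re (2 * w) by rewrite cReM Re_nat Im_nat mul0r subr0 mulr_gt0.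
have inner (g : R) : cint (fun a => kker w 0 a * kker (w + (1 / 2)%:C) 0 (g - a)) =
    (Num.sqrt pi)%:C * ekern 2 (2 * w) (g / 2).
  have -> : (fun a => kker w 0 a * kker (w + (1 / 2)%:C) 0 (g - a)) =
    (fun a => cexp ((w + (1 / 2)%:C) * g%:C) * kker (- (1 / 2))%:C (expR g) a).
    apply/funext => a; rewrite /kker -!cexpD; congr cexp.
    by rewrite !mul0r !subr0 (expRB g) expRN !(rmorphB, rmorphD, rmorphN) /=; ring.
  have eg := expR_gt0 g.
  rewrite cintZ; last by apply: cintg_kker; [exact: ltW|left].
  rewrite -/(kint _ _) kint_Nhalf// sqrt_expR.
  have -> : Num.sqrt pi / expR (g / 2) * expR (- (2 * expR (g / 2))) =
      Num.sqrt pi * expR (- (g / 2) - 2 * expR (g / 2)).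
    by rewrite expRB !expRN; field; rewrite !gt_eqF ?expR_gt0.
  have -> : ((Num.sqrt pi * expR (- (g / 2) - 2 * expR (g / 2)))%:C : R[i]) =
      (Num.sqrt pi)%:C * cexp (- (g / 2) - 2 * expR (g / 2))%:C.
    by rewrite cexpR rmorphM.
  rewrite mulrCA -cexpD /ekern.
  congr (_ * cexp _).
  by apply: complex_eqP; rewrite !(cReD, cImD, cReMr, cImMr, cReM, cImM, Re_nat, Im_nat) /=; field.
rewrite (_ : (fun g => cint _) = (fun g => (Num.sqrt pi)%:C * ekern 2 (2 * w) (g / 2))); last first.
  by apply/funext => g; exact: inner.
have ei : cintg (fun g => ekern 2 (2 * w) (g / 2)).
  have h2 : (2^-1 : R) != 0 by rewrite invr_eq0 pnatr_eq0.
  have := cintg_affine 0 h2 (cintg_ekern (ltr0n R 2) w2).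
  rewrite (_ : (fun x => ekern 2 (2 * w) (2^-1 * x + 0)) = (fun g => ekern 2 (2 * w) (g / 2)))//.
  by apply/funext => g; have -> : 2^-1 * g + 0 = g / 2 by field.
rewrite cintZ// (@cint_affine R 2 0)//.
have -> : (fun g => ekern 2 (2 * w) ((2 * g + 0) / 2)) = ekern 2 (2 * w).
  by apply/funext => g; congr ekern; field.
rewrite cint_ekern//.
have -> : (`|2 : R|%:C : R[i]) = 2 by rewrite normr_nat rmorph_nat.
by rewrite /egamma; ring.
Qed.

End ClosedForms.

(** * Hyperbolic functions *)

Section Hyperbolic.
Context {R : realType}.
Implicit Types x y p : R.

Definition sinh x : R := (expR x - expR (- x)) / 2.

Lemma cosh_gt0 x : 0 < cosh x.
Proof. by rewrite /cosh divr_gt0// addr_gt0 ?expR_gt0. Qed.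

Lemma coshN x : cosh (- x) = cosh x.
Proof. by rewrite /cosh opprK addrC. Qed.

Lemma sinhN x : sinh (- x) = - sinh x.
Proof. by rewrite /sinh opprK; ring. Qed.

Lemma cosh_norm x : cosh `|x| = cosh x.
Proof. by case: (ger0P x) => // _; rewrite coshN. Qed.

Lemma sinh_gt0 x : 0 < x -> 0 < sinh x.
Proof. by move=> x0; rewrite /sinh divr_gt0// subr_gt0 ltr_expR; lra. Qed.

Lemma coshD x y : cosh (x + y) = cosh x * cosh y + sinh x * sinh y.
Proof. by rewrite /cosh /sinh opprD !expRD; field. Qed.

Lemma sinhD x y : sinh (x + y) = sinh x * cosh y + cosh x * sinh y.
Proof. by rewrite /cosh /sinh opprD !expRD; field. Qed.

Lemma cosh2B x : cosh x ^+ 2 - sinh x ^+ 2 = 1.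
Proof.
have e : expR x * expR (- x) = 1 by rewrite -expRD subrr expR0.
have -> : cosh x ^+ 2 - sinh x ^+ 2 = expR x * expR (- x) by rewrite /cosh /sinh; field.
exact: e.
Qed.

Lemma cosh_ge1 x : 1 <= cosh x.
Proof.
rewrite -[leLHS](expr1n _ 2) -(@ler_pXn2r _ 2)// ?nnegrE ?(ltW (cosh_gt0 x))// expr1n.
have := cosh2B x; have := sqr_ge0 (sinh x); rewrite expr1n; lra.
Qed.

Lemma cosh_double x : cosh x = 1 + 2 * sinh (x / 2) ^+ 2.
Proof.
have -> : cosh x = cosh (x / 2 + x / 2) by congr cosh; field.
by rewrite coshD; have := cosh2B (x / 2); lra.
Qed.

Lemma sinh_double x : sinh x = 2 * (sinh (x / 2) * cosh (x / 2)).
Proof.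
have -> : sinh x = sinh (x / 2 + x / 2) by congr sinh; field.
by rewrite sinhD; ring.
Qed.

Lemma cosh_le_exp x : expR `|x| <= 2 * cosh x.
Proof.
rewrite -(cosh_norm x) /cosh mulrC divfK ?pnatr_eq0//.
by rewrite lerDl expR_ge0.
Qed.

Lemma is_derive_cosh x : is_derive x 1 cosh (sinh x).
Proof.
have d : is_derive x 1 (expR \o -%R) (expR (- x) * - 1) by apply: is_derive1_comp.
rewrite /cosh -[fun _ => _]/((expR + (expR \o -%R)) * cst 2^-1).
by apply: is_derive_eq; rewrite /GRing.scale /= /sinh; ring.
Qed.

Lemma is_derive_sinh x : is_derive x 1 sinh (cosh x).
Proof.
have d : is_derive x 1 (expR \o -%R) (expR (- x) * - 1) by apply: is_derive1_comp.
rewrite /sinh -[fun _ => _]/((expR - (expR \o -%R)) * cst 2^-1).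
by apply: is_derive_eq; rewrite /GRing.scale /= /cosh; ring.
Qed.

Lemma continuous_cosh : continuous (@cosh R).
Proof.
move=> x; apply: differentiable_continuous; apply/derivable1_diffP.
by have [] := is_derive_cosh x.
Qed.

Lemma continuous_sinh : continuous sinh.
Proof.
move=> x; apply: differentiable_continuous; apply/derivable1_diffP.
by have [] := is_derive_sinh x.
Qed.

Lemma ltr_cosh x y : `|x| < y -> cosh x < cosh y.
Proof.
move=> xy; rewrite -(cosh_norm x).
have y0 : 0 < y by exact: le_lt_trans xy.
have -> : y = `|x| + (y - `|x|) by ring.
set h := y - `|x|; have h0 : 0 < h by rewrite subr_gt0.
rewrite coshD; have c1 : 1 < cosh h.
  rewrite cosh_double ltrDl mulr_gt0// exprn_gt0// sinh_gt0// divr_gt0//.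
have s0 : 0 <= sinh `|x|.
  have := normr_ge0 x; rewrite le_eqVlt => /predU1P[<-|/sinh_gt0/ltW//].
  by rewrite /sinh oppr0 subrr mul0r.
have := cosh_gt0 `|x| => cx.
have : cosh `|x| < cosh `|x| * cosh h by rewrite ltr_pMr.
have : 0 <= sinh `|x| * sinh h by rewrite mulr_ge0// ltW// sinh_gt0.
lra.
Qed.

End Hyperbolic.

(** * Macdonald's function K_v and its integral over a ray *)

Section MacdonaldRepresentation.
Context {R : realType}.
Local Notation cint := (cintegral setT).
Local Notation cintg := (cintegrable setT).
Implicit Types (v : R[i]) (x z s y : R).
Local Notation h := ((1 / 2 : R)%:C : R[i]).

Definition kmac v z y : R[i] := cexp ((- (z * cosh y))%:C + v * y%:C).
(** This is 2 K_v(z), as an integral over the whole line; a shift by ln(z/2) makes it a multiple of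
    [kint] at z^2/4 ([kmacE]). *)
Definition knu v z : R[i] := cint (kmac v z).

Lemma kmacE v z y : 0 < z ->
  kmac v z y = cpow (z / 2) (- v) * kker v (z ^+ 2 / 4) (y + ln (z / 2)).
Proof.
move=> z0; have z2 : 0 < z / 2 by rewrite divr_gt0.
have e : - expR (y + ln (z / 2)) - z ^+ 2 / 4 * expR (- (y + ln (z / 2))) = - (z * cosh y).
  rewrite opprD (expRD y) (expRD (- y)) [expR (- ln _)]expRN lnK ?posrE// /cosh.
  by field; rewrite gt_eqF.
rewrite /kmac /cpow /kker -cexpD e; congr cexp.
by rewrite (rmorphD _ y) /=; ring.
Qed.

Lemma cintg_kmac v z : 0 < z -> cintg (kmac v z).
Proof.
move=> z0; rewrite (_ : kmac v z =
  (fun y => cpow (z / 2) (- v) * kker v (z ^+ 2 / 4) (y + ln (z / 2)))); last first.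
  by apply/funext => y; exact: kmacE.
have z4 : 0 < z ^+ 2 / 4 by rewrite divr_gt0// exprn_gt0.
by apply: cintgZ; apply: cintg_shift; apply: cintg_kker; [exact: ltW|left].
Qed.

(** With T = sqrt(1 + e^s), the integral of [sker v z] is 2 int_1^oo (T^2-1)^{v-1/2} e^{-zT} dT. *)
Definition sker v z s : R[i] := cexp ((v + h) * s%:C) *
  ((Num.sqrt (1 + expR s))^-1 * expR (- (z * Num.sqrt (1 + expR s))))%:C.

Lemma ccont_sker v z : ccont (sker v z).
Proof.
have cs : continuous (fun s : R => Num.sqrt (1 + expR s)).
  move=> s; apply: (@continuous_comp _ _ _ (fun s : R => 1 + expR s) Num.sqrt).
    by apply: cvgD; [exact: cvg_cst|exact: continuous_expR].
  exact: sqrt_continuous.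
apply: ccontM.
  by apply: ccont_cexp; apply: ccontM; [exact: ccont_cst|exact: ccont_id].
apply: ccontR => s; apply: cvgM.
  apply: cvgV; last exact: cs.
  by rewrite gt_eqF// sqrtr_gt0 addr_gt0// expR_gt0.
apply: continuous_comp; last exact: continuous_expR.
by apply: cvgN; apply: cvgM; [exact: cvg_cst|exact: cs].
Qed.

(** Gamma(v + 1/2) times 2 K_v(z) is written as a convolution. For fixed s the inner integral is a
    [kint] of order -1/2 at (z/2)^2 (1 + e^s), which is elementary and produces [sker]. *)
Lemma knu_rep v z : 0 < z -> 0 < Re (v + h) ->
  cintg (sker v z) /\
  egamma (v + h) * knu v z = cpow (z / 2) v * (Num.sqrt pi)%:C * cint (sker v z).
Proof.
move=> z0 vh; have z2 : 0 < z / 2 by rewrite divr_gt0.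
set L := ln (z / 2).
have eL : expR L = z / 2 by rewrite lnK// posrE.
have i1 := cintg_kmac v z0.
have i0 := cintg_kker (lexx (0 : R)) (or_intror vh).
have i2 := cintg_shift L i0.
have [ci cE] := cint_convolution i1 i2.
have inner s : cint (fun y => kmac v z y * kker (v + h) 0 (s - y + L)) =
    cpow (z / 2) v * (Num.sqrt pi)%:C * sker v z s.
  pose Y := (z / 2) ^+ 2 * (1 + expR s).
  have l1 : 0 < 1 + expR s by rewrite addr_gt0 ?expR_gt0.
  have Y0 : 0 < Y by rewrite mulr_gt0// exprn_gt0.
  have sY : Num.sqrt Y = z / 2 * Num.sqrt (1 + expR s).
    by rewrite sqrtrM ?sqr_ge0// sqrtr_sqr gtr0_norm.
  have ik : cintg (kker (- h) Y) by apply: cintg_kker; [exact: ltW|left].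
  have e y : kmac v z y * kker (v + h) 0 (s - y + L) =
      cexp ((v + h) * s%:C + (v + 1) * L%:C) * kker (- h) Y (y + L).
    rewrite /kmac /kker -!cexpD; congr cexp.
    have -> : - expR (s - y + L) - 0 * expR (- (s - y + L)) = - (z / 2 * expR s * expR (- y)).
      by rewrite mul0r subr0 !expRD eL; ring.
    have -> : - expR (y + L) - Y * expR (- (y + L)) = - (z * cosh y) - z / 2 * expR s * expR (- y).
      rewrite opprD !expRD [expR (- L)]expRN eL /Y /cosh; field.
      by rewrite gt_eqF.
    apply: complex_eqP; rewrite !(cReD, cImD, cReN, cImN, cReM, cImM) /=; field => //.
  refine (etrans (f_equal (cintegral setT) (funext e)) _).
  rewrite (cintZ _ (cintg_shift L ik)) (cint_shift L ik) -/(kint (- h) Y).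
  have -> : - h = (- (1 / 2))%:C by rewrite rmorphN.
  rewrite kint_Nhalf// sY /sker.
  have -> : cexp ((v + h) * s%:C + (v + 1) * L%:C) =
      cexp ((v + h) * s%:C) * cpow (z / 2) v * (z / 2)%:C.
    by rewrite -{2}eL -cexpR /cpow -!cexpD; congr cexp; rewrite -/L; ring.
  have -> : 2 * (z / 2 * Num.sqrt (1 + expR s)) = z * Num.sqrt (1 + expR s) by field.
  set q := Num.sqrt (1 + expR s).
  have q0 : 0 < q by rewrite sqrtr_gt0.
  have -> : Num.sqrt pi / (z / 2 * q) * expR (- (z * q)) =
     (z / 2)^-1 * (Num.sqrt pi * (q^-1 * expR (- (z * q)))).
    by field; rewrite !gt_eqF.
  have zC : ((z / 2)%:C : R[i]) * ((z / 2)^-1)%:C = 1.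
    by rewrite -rmorphM divff ?rmorph1// gt_eqF.
  rewrite (rmorphM _ (z / 2)^-1) (rmorphM _ (Num.sqrt pi)) /=.
  transitivity (((z / 2)%:C * ((z / 2)^-1)%:C) * (cpow (z / 2) v * (Num.sqrt pi)%:C *
    (cexp ((v + h) * s%:C) * (q^-1 * expR (- (z * q)))%:C))); last by rewrite zC mul1r.
  by ring.
have c0 : cpow (z / 2) v * (Num.sqrt pi)%:C != 0.
  rewrite mulf_neq0 ?cexp_neq0// -normc_gt0 normcR normr_gt0 gt_eqF// sqrtr_gt0.
  exact: pi_gt0.
have ci' : cintg (fun s => cpow (z / 2) v * (Num.sqrt pi)%:C * sker v z s).
  exact: (eq_ind _ (cintegrable setT) ci _ (funext inner)).
have si : cintg (sker v z).
  have e : (fun s => (cpow (z / 2) v * (Num.sqrt pi)%:C)^-1 *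
      (cpow (z / 2) v * (Num.sqrt pi)%:C * sker v z s)) = sker v z.
    apply/funext => s; exact: (mulKf c0).
  exact: (eq_ind _ (cintegrable setT) (cintgZ _ ci') _ e).
split; first exact: si.
have e1 : cint (fun u => kker (v + h) 0 (u + L)) = egamma (v + h) by exact: (cint_shift L i0).
have e2 := f_equal (cintegral setT) (funext inner).
have e3 := cintZ (cpow (z / 2) v * (Num.sqrt pi)%:C) si.
rewrite -e1 mulrC; exact: (etrans cE (etrans e2 e3)).
Qed.

End MacdonaldRepresentation.

(** * Substitution from a half-line *)

Section RaySubstitution.
Context {R : realType}.
Local Notation cint := (cintegral setT).
Local Notation cintg := (cintegrable setT).

Lemma cintegral_mkcond (a : R) (F : R -> R[i]) : cintegrable `]a, +oo[ F ->
  cintg (fun x => if a < x then F x else 0) /\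
  cintegral `]a, +oo[ F = cint (fun x => if a < x then F x else 0).
Proof.
have mD : measurable (`]a, +oo[%classic : set (measurableTypeR R)) by exact: measurable_itv.
have inD (x : R) : (x \in `]a, +oo[%classic) = (a < x).
  by rewrite mem_setE in_itv/= andbT.
move=> [F1 F2]; split.
  have G1 := iffLR (@integrable_mkcond _ (measurableTypeR R) R lebesgue_measure _ _ mD) F1; have G2 := iffLR (@integrable_mkcond _ (measurableTypeR R) R lebesgue_measure _ _ mD) F2.
  split; [move: G1|move: G2]; congr (_.-integrable _ _); apply/funext => x;
    by rewrite patchE inD; case: ifP.
rewrite /cintegral; congr (_ +i* _); rewrite Rintegral_mkcond;
  by apply: eq_Rintegral => x _; rewrite patchE inD; case: ifP.
Qed.

(** The new integrand is extended by 0 to the left of [a], so that the result is again an integral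
    over the line, as convolution and Fubini expect. *)
Lemma cint_substitution_ray (a : R) (phi dphi : R -> R) (F : R -> R[i]) :
  (forall x, a < x -> is_derive x 1 phi (dphi x)) ->
  (forall x, a < x -> {for x, continuous dphi}) ->
  (forall x, a < x -> 0 < dphi x) ->
  (forall A, exists2 b, a < b & forall x, a < x <= b -> phi x <= A) ->
  (forall A, exists b, forall x, b <= x -> A <= phi x) ->
  ccont F -> cintg F ->
  cintg (fun x => if a < x then F (phi x) * (dphi x)%:C else 0) /\
  cint F = cint (fun x => if a < x then F (phi x) * (dphi x)%:C else 0).
Proof.
move=> dE dc d0 lo hi cF Fi.
have [||||||I ->] := @cint_substitution R `]a, +oo[%classic (fun n => a + n.+2%:R^-1)
  (fun n => a + n.+2%:R) phi dphi (itv_gt_lt a) (@itv_gt_noninc R a)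
  (@itv_gt_nondec R a) (bigcup_itv_gt a) _ _ _ _ _ _ F cF Fi.
- exact: interval_open.
- by move=> t /=; rewrite in_itv/= andbT; exact: dE.
- by move=> t /=; rewrite in_itv/= andbT; exact: dc.
- by move=> t /=; rewrite in_itv/= andbT; exact: d0.
- move=> A; have [b ab hb] := lo A.
  exists (Num.truncn (b - a)^-1); apply: hb; rewrite ltrDl invr_gt0 ltr0Sn/=.
  rewrite -lerBrDl -[leRHS]invrK lef_pV2 ?posrE ?invr_gt0 ?subr_gt0//.
  by apply/ltW; apply: lt_le_trans (truncnS_gt _) _; rewrite ler_nat.
- move=> A; have [b hb] := hi A.
  exists (Num.truncn (b - a)); apply: hb; rewrite -lerBlDl.
  by apply/ltW; apply: lt_le_trans (truncnS_gt _) _; rewrite ler_nat.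
by have [] := cintegral_mkcond I.
Qed.

End RaySubstitution.

(** * Whittaker's function in the hyperbolic variable *)

Section WhittakerKernel.
Context {R : realType}.
Local Notation cint := (cintegral setT).
Local Notation cintg := (cintegrable setT).
Implicit Types (x s t p : R) (v : R[i]).
Local Notation lsh p := (ln (sinh (p / 2))).
Local Notation lch p := (ln (cosh (p / 2))).

(** For p > 0 this is e^{-(x/2) cosh p} tanh(p/2)^s (sinh(p/2) cosh(p/2))^v, written through
    logarithms so that complex powers are exponentials. *)
Definition wker x v s p : R[i] :=
  if 0 < p then
    cexp ((- (x / 2 * cosh p) + s * (lsh p - lch p))%:C + v * (lsh p + lch p)%:C)
  else 0.

(** Substitution e^r = sinh^2(p/2) in [tint], with 1 + e^r = cosh^2(p/2). The factor e^{-x/2}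
    completes e^{-x sinh^2(p/2)} to e^{-(x/2) cosh p}. *)
Lemma wker_int x t mu : 0 < x -> mu < 1 / 2 ->
  cintg (wker x ((2 * t)*i) (- (2 * mu))) /\
  (expR (- x / 2))%:C * tint ((1 / 2 - mu)%:C + t*i) (- (2 * t) *i) x =
    cint (wker x ((2 * t)*i) (- (2 * mu))).
Proof.
move=> x0 m.
have ra : 0 < Re ((1 / 2 - mu)%:C + t*i : R[i]) by rewrite /=; lra.
have rav : 0 < Re ((1 / 2 - mu)%:C + t*i + - (2 * t) *i : R[i]) by rewrite /=; lra.
have [_ [ti _]] := kk_integral x0 ra rav.
set a := (1 / 2 - mu)%:C + t*i in ra rav ti *.
set w := (- (2 * t)*i : R[i]) in rav ti *.
have sp p : 0 < p -> 0 < sinh (p / 2) by move=> p0; apply: sinh_gt0; rewrite divr_gt0.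
have dsh p : is_derive p 1 (fun p : R => sinh (p / 2)) (cosh (p / 2) * (1 / 2)).
  apply: (@is_derive1_comp _ sinh (fun p : R => p / 2)); first exact: is_derive_sinh.
  have -> : (fun p : R => p / 2) = id * cst 2^-1 by [].
  by apply: is_derive_eq; rewrite /GRing.scale /=; lra.
have ctk : ccont (tker a w x).
  apply: ccontM; first exact: ccont_ekern.
  apply: ccont_cexp; apply: ccontM; first exact: ccont_cst.
  apply: ccontR => r; have r1 : 0 < 1 + expR r by rewrite addr_gt0 ?expR_gt0.
  apply: (@continuous_comp _ _ _ (fun s : R => 1 + expR s) (@ln R)); last exact: continuous_ln.
  by apply: cvgD; [exact: cvg_cst|exact: continuous_expR].
have [|||||I E] := @cint_substitution_ray R 0 (fun p => 2 * lsh p)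
   (fun p => cosh (p / 2) / sinh (p / 2)) (tker a w x) _ _ _ _ _ ctk ti.
- move=> p p0; have s0 := sp p p0.
  have dl : is_derive p 1 (@ln R \o (fun p : R => sinh (p / 2))) ((sinh (p / 2))^-1 * (cosh (p / 2) * (1 / 2))).
    by apply: is_derive1_comp; exact: is_derive1_ln.
  have -> : (fun p => 2 * lsh p) = cst 2 * (@ln R \o (fun p : R => sinh (p / 2))) by [].
  apply: is_derive_eq; rewrite /GRing.scale /=; field; rewrite gt_eqF//.
- move=> p p0; have hc : continuous (fun p : R => p / 2).
    by move=> q; apply: cvgM; [exact: cvg_id|exact: cvg_cst].
  apply: cvgM; first by apply: (@continuous_comp _ _ _ (fun p : R => p / 2) cosh); [exact: hc|exact: continuous_cosh].
  apply: cvgV; first by rewrite gt_eqF// sp.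
  by apply: (@continuous_comp _ _ _ (fun p : R => p / 2) sinh); [exact: hc|exact: continuous_sinh].
- by move=> p p0; rewrite divr_gt0 ?cosh_gt0 ?sp.
- move=> A; have e1 : 1 < 1 + expR (A / 2) by rewrite ltrDl expR_gt0.
  exists (2 * ln (1 + expR (A / 2))); first by rewrite mulr_gt0// ln_gt0.
  move=> p /andP[p0 pb]; rewrite mulrC -ler_pdivlMr// -ler_expR lnK ?posrE ?sp//.
  have : expR (p / 2) <= 1 + expR (A / 2).
    by rewrite -[leRHS]lnK ?posrE ?addr_gt0 ?expR_gt0// ler_expR ler_pdivrMr// mulrC.
  by have := cosh_ge1 (p / 2); rewrite /sinh /cosh; lra.
- move=> A; have e1 : 1 < 1 + 2 * expR (A / 2) by rewrite ltrDl mulr_gt0// expR_gt0.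
  exists (2 * ln (1 + 2 * expR (A / 2))) => p pb.
  have p0 : 0 < p by apply: lt_le_trans pb; rewrite mulr_gt0// ln_gt0.
  rewrite mulrC -ler_pdivrMr// -ler_expR lnK ?posrE ?sp//.
  have : 1 + 2 * expR (A / 2) <= expR (p / 2).
    by rewrite -[leLHS]lnK ?posrE ?(lt_trans _ e1)// ler_expR ler_pdivlMr// mulrC.
  have : expR (- (p / 2)) <= 1 :> R by rewrite -[leRHS]expR0 ler_expR; lra.
  by rewrite /sinh; lra.
have key p : (expR (- x / 2))%:C * (if 0 < p then tker a w x (2 * lsh p) * (cosh (p / 2) / sinh (p / 2))%:C else 0) =
    wker x ((2 * t)*i) (- (2 * mu)) p.
  rewrite /wker; case: ifPn => [p0|_]; last by rewrite mulr0.
  have s0 := sp p p0; have c0 := cosh_gt0 (p / 2).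
  have es : expR (2 * lsh p) = sinh (p / 2) ^+ 2.
    by rewrite mulrC expRM_natr lnK.
  have ec : 1 + expR (2 * lsh p) = cosh (p / 2) ^+ 2.
    by rewrite es; have := cosh2B (p / 2); lra.
  have lc2 : ln (cosh (p / 2) ^+ 2) = 2 * lch p by rewrite lnXn// mulr_natl.
  have -> : (cosh (p / 2) / sinh (p / 2))%:C = cexp (lch p - lsh p)%:C :> R[i].
    by rewrite cexpR expRB !lnK.
  rewrite /tker ec /ekern es /cpow lc2 -cexpR -!cexpD; congr cexp.
  have e : - x / 2 - x * sinh (p / 2) ^+ 2 = - (x / 2 * cosh p).
    by rewrite (cosh_double p); field.
  have -> : - (x / 2 * cosh p) + - (2 * mu) * (lsh p - lch p) =
     - x / 2 - x * sinh (p / 2) ^+ 2 + - (2 * mu) * (lsh p - lch p) by rewrite e.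
  move: (lsh p) (lch p) (sinh _) => l1 l2 sh; rewrite /a /w.
  by apply: complex_eqP; rewrite !(cReD, cImD, cReN, cImN, cReM, cImM) /=; field.
split.
  exact: (eq_ind _ (cintegrable setT) (cintgZ (expR (- x / 2))%:C I) _ (funext key)).
rewrite /tint; apply: (etrans (f_equal (fun z => _ * z) E)).
exact: (etrans (esym (cintZ _ I)) (f_equal (cintegral setT) (funext key))).
Qed.

End WhittakerKernel.

(** * The product of two Whittaker kernels *)

Section SymmetricConvolution.
Context {R : realType}.
Local Notation cint := (cintegral setT).
Local Notation cintg := (cintegrable setT).

Lemma cintg_bounded (F G : R -> R[i]) : cmeas F -> (forall x, normc (F x) <= 1) ->
  cintg G -> cintg (fun x => F x * G x).
Proof.
move=> mF F1 Gi; apply: (cintg_le _ _ (cintg_norm Gi)).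
  by apply: cmeasM => //; exact: cintg_meas.
move=> x; rewrite ComplexField.Normc.normcM ler_piMl ?normc_ge0//; exact: F1.
Qed.

(** In the double integral of F(p) G(q), put p = P + d and q = P - d. The Jacobian 2 is spent on
    adding the values at d and -d. *)
Lemma cint_convolution_sym (F G : R -> R[i]) : cintg F -> cintg G ->
  (forall x, normc (F x) <= 1) ->
  cintg (fun d => cint (fun P => F (P + d) * G (P - d) + F (P - d) * G (P + d))) /\
  cint F * cint G =
    cint (fun d => cint (fun P => F (P + d) * G (P - d) + F (P - d) * G (P + d))).
Proof.
move=> Fi Gi F1; have rG := cint_reflect 0 Gi; have rGi := cintg_reflect 0 Gi.
have [Ki] := cint_convolution Fi rGi; rewrite rG => ->.
set K := (fun y => cint (fun x => _ * _)) in Ki *.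
have n2 : (2 : R) != 0 by [].
(* Boundedness of F gives integrability in P for every d, and not only for almost every d, so the
   two inner integrals can be added pointwise. *)
have FGi a b : cintg (fun P => F (P + a) * G (P + b)).
  apply: cintg_bounded => //; last exact: cintg_shift.
  exact: cintg_meas (cintg_shift a Fi).
have KE d : K (2 * d) = cint (fun P => F (P + d) * G (P - d)).
  rewrite -(cint_shift (- d) (FGi d (- d))) /K; congr (cint _); apply/funext => P.
  by rewrite subrK; congr (_ * G _); ring.
have Ki2 := cintg_affine 0 n2 Ki.
have E1 := cint_affine 0 n2 Ki.
have Ki2' := cintg_reflect 0 Ki2; have E2 := cint_reflect 0 Ki2.
have key d : K (2 * d + 0) + K (2 * (0 - d) + 0) =
    cint (fun P => F (P + d) * G (P - d) + F (P - d) * G (P + d)).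
  rewrite !addr0 !KE sub0r opprK -(cintD (FGi d (- d)) (FGi (- d) d)).
  by [].
have E3 := cintD Ki2 Ki2'.
split.
  exact: (eq_ind _ (cintegrable setT) (cintgD Ki2 Ki2') _ (funext key)).
rewrite E1 -(f_equal (cintegral setT) (funext key)) E3 E2 normr_nat.
by rewrite rmorph_nat mulr_natl mulr2n.
Qed.

End SymmetricConvolution.

Section ProductFormula.
Context {R : realType}.
Local Notation cint := (cintegral setT).
Local Notation cintg := (cintegrable setT).
Implicit Types (x s t p d P : R) (v : R[i]).
Local Notation h := ((1 / 2 : R)%:C : R[i]).
Local Notation lsh p := (ln (sinh (p / 2))).
Local Notation lch p := (ln (cosh (p / 2))).

Lemma sinh_lt_cosh p : sinh p < cosh p.
Proof. by have := expR_gt0 (- p); rewrite /sinh /cosh; lra. Qed.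

(** For exponent 1/2 the factor tanh(p/2)^{1/2} is at most 1. This kernel plays the bounded factor
    in the symmetric convolution. *)
Lemma normc_wker_le1 x v p : 0 < x -> Re v = 0 -> normc (wker x v (1 / 2) p) <= 1.
Proof.
move=> x0 v0; rewrite /wker; case: ifPn => [p0|_]; last by rewrite ComplexField.Normc.normc0.
have s0 : 0 < sinh (p / 2) by apply: sinh_gt0; rewrite divr_gt0.
rewrite normc_cexp cReD cReMr v0 mul0r addr0 -[leRHS]expR0 ler_expR /=.
have : lsh p <= lch p by rewrite ler_ln ?posrE ?cosh_gt0// ltW// sinh_lt_cosh.
have : 0 < x / 2 * cosh p by rewrite mulr_gt0 ?cosh_gt0// divr_gt0.
lra.
Qed.

Lemma cosh2_sinhM P d : cosh P ^+ 2 - cosh d ^+ 2 = sinh (P + d) * sinh (P - d).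
Proof.
rewrite !sinhD coshN sinhN; have := cosh2B P; have := cosh2B d; move: (cosh d) (cosh P) (sinh d) (sinh P) => D C s S e1 e2.
transitivity (S ^+ 2 * D ^+ 2 - C ^+ 2 * s ^+ 2); last by ring.
have -> : S ^+ 2 = C ^+ 2 - 1 by lra.
have -> : s ^+ 2 = D ^+ 2 - 1 by lra.
ring.
Qed.

(** Let A = (P+d)/2 and B = (P-d)/2. The square root of tanh A / tanh B is sinh A cosh B divided by
    the square root of S = sinh A cosh A sinh B cosh B. Here sinh A cosh B = (sinh P + sinh d)/2 and
    S = (cosh^2 P - cosh^2 d)/4, which shifts the exponent of S from v to v - 1/2. *)
Lemma wkerM x v P d : `|d| < P ->
  wker x v (1 / 2) (P + d) * wker x v (- (1 / 2)) (P - d) =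
  (expR (- (x * cosh P * cosh d)) * ((sinh P + sinh d) / 2))%:C *
    cexp ((v - h) * (ln ((cosh P ^+ 2 - cosh d ^+ 2) / 4))%:C).
Proof.
move=> dP; have [dP1 dP2] : - P < d /\ d < P by apply/andP; rewrite -ltr_norml.
have p0 : 0 < P + d by lra.
have q0 : 0 < P - d by lra.
rewrite /wker p0 q0.
have sp : 0 < sinh ((P + d) / 2) by apply: sinh_gt0; rewrite divr_gt0.
have sq : 0 < sinh ((P - d) / 2) by apply: sinh_gt0; rewrite divr_gt0.
have cp := cosh_gt0 ((P + d) / 2); have cq := cosh_gt0 ((P - d) / 2).
have -> : (cosh P ^+ 2 - cosh d ^+ 2) / 4 =
    sinh ((P + d) / 2) * cosh ((P + d) / 2) * (sinh ((P - d) / 2) * cosh ((P - d) / 2)).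
  by rewrite cosh2_sinhM !(sinh_double (_ + _)); field.
have lnM2 (a b : R) : 0 < a -> 0 < b -> ln (a * b) = ln a + ln b by move=> a0 b0; rewrite lnM.
rewrite (lnM2 _ _ (mulr_gt0 sp cp) (mulr_gt0 sq cq)) (lnM2 _ _ sp cp) (lnM2 _ _ sq cq).
have -> : (sinh P + sinh d) / 2 = expR (lsh (P + d) + lch (P - d)).
  rewrite expRD !lnK//.
  have -> : sinh P = sinh ((P + d) / 2 + (P - d) / 2) by congr sinh; field.
  have -> : sinh d = sinh ((P + d) / 2 - (P - d) / 2) by congr sinh; field.
  by rewrite !sinhD coshN sinhN; field.
have cc : cosh (P + d) + cosh (P - d) = 2 * (cosh P * cosh d).
  by rewrite !coshD coshN sinhN; ring.
rewrite -expRD -cexpR -!cexpD; congr cexp.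
have -> : - (x * cosh P * cosh d) = - (x / 2 * cosh (P + d)) - (x / 2 * cosh (P - d)).
  by rewrite -opprD -mulrDr cc; field.
move: (cosh (P + d)) (cosh (P - d)) (lsh (P + d)) (lch (P + d)) (lsh (P - d)) (lch (P - d)) => C1 C2 l1 l2 l3 l4.
apply: complex_eqP; rewrite !(cReD, cImD, cReN, cImN, cReM, cImM) /=; field => //.
Qed.

(** The odd term sinh d cancels, leaving sinh P, the derivative of cosh P; everything else depends
    on P through cosh P only. This is what makes the indices -1/4 and 1/4 work. *)
Lemma wkerM_sym x v P d :
  wker x v (1 / 2) (P + d) * wker x v (- (1 / 2)) (P - d) +
  wker x v (1 / 2) (P - d) * wker x v (- (1 / 2)) (P + d) =
  if `|d| < P then (expR (- (x * cosh P * cosh d)) * sinh P)%:C *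
    cexp ((v - h) * (ln ((cosh P ^+ 2 - cosh d ^+ 2) / 4))%:C) else 0.
Proof.
case: ifPn => dP.
  have e := @wkerM x v P (- d); rewrite opprK coshN sinhN normrN in e.
  rewrite (wkerM _ _ dP) (e dP) -mulrDl -rmorphD; congr (_%:C * _); field => //.
move: dP; rewrite -leNgt /wker; have [d0|d0] := ger0P d => dP.
  have -> : (0 < P - d) = false by apply/negbTE; rewrite -leNgt; lra.
  by rewrite mulr0 mul0r addr0.
have -> : (0 < P + d) = false by apply/negbTE; rewrite -leNgt; lra.
by rewrite mulr0 mul0r addr0.
Qed.


(** The substitution is e^s = cosh^2 P / cosh^2 d - 1, that is sqrt(1 + e^s) = cosh P / cosh d in
    [sker]. *)
Lemma sker_substitution x v d : 0 < x -> 0 < Re (v + h) ->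
  cint (fun P => if `|d| < P then (expR (- (x * cosh P * cosh d)) * sinh P)%:C *
      cexp ((v - h) * (ln ((cosh P ^+ 2 - cosh d ^+ 2) / 4))%:C) else 0) =
  cpow 2 (- (2 * v)) * cpow (cosh d) (2 * v) * cint (sker v (x * cosh d ^+ 2)).
Proof.
move=> x0 vh; set D := cosh d; have D0 : 0 < D by exact: cosh_gt0.
have DE : D = cosh d by []; clearbody D.
have z0 : 0 < x * D ^+ 2 by rewrite mulr_gt0// exprn_gt0.
have [si _] := knu_rep z0 vh; set z := x * D ^+ 2 in z0 si *; have zE : z = x * D ^+ 2 by []; clearbody z.
have CD P : `|d| < P -> 0 < cosh P ^+ 2 - D ^+ 2.
  move=> dP; rewrite subr_gt0 ltr_pXn2r// ?nnegrE ?(ltW D0) ?(ltW (cosh_gt0 P))//.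
  by rewrite DE; exact: ltr_cosh.
have sq (a b : R) : 0 < a -> a <= b -> a ^+ 2 <= b ^+ 2.
  by move=> a0 ab; rewrite ler_pXn2r// nnegrE ?(le_trans _ ab)// ltW.
have D2 : 0 < D ^+ 2 by rewrite exprn_gt0.
have S0 P : `|d| < P -> 0 < sinh P by move=> dP; apply: sinh_gt0; exact: le_lt_trans dP.
have gE P : cosh P ^+ 2 / D ^+ 2 - 1 = (cosh P ^+ 2 - D ^+ 2) / D ^+ 2.
  by rewrite mulrBl divff ?gt_eqF.
have g0 P : `|d| < P -> 0 < cosh P ^+ 2 / D ^+ 2 - 1.
  by move=> dP; rewrite gE divr_gt0 ?CD.
have [|||||I E] := @cint_substitution_ray R `|d| (fun P => ln (cosh P ^+ 2 / D ^+ 2 - 1))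
   (fun P => 2 * cosh P * sinh P / (cosh P ^+ 2 - D ^+ 2)) (sker v z) _ _ _ _ _ (ccont_sker v z) si.
- move=> P dP.
  have dl : is_derive P 1 (@ln R \o (fun P => cosh P ^+ 2 / D ^+ 2 - 1))
     ((cosh P ^+ 2 / D ^+ 2 - 1)^-1 * (2 * cosh P * sinh P / D ^+ 2)).
    apply: is_derive1_comp; first by apply: is_derive1_ln; exact: g0.
    have -> : (fun P => cosh P ^+ 2 / D ^+ 2 - 1) = (@cosh R) ^+ 2 * cst (D ^+ 2)^-1 - cst 1 by [].
    have dc := is_derive_cosh P.
    by apply: is_derive_eq; rewrite /GRing.scale /=; ring.
  have -> : 2 * cosh P * sinh P / (cosh P ^+ 2 - D ^+ 2) =
     (cosh P ^+ 2 / D ^+ 2 - 1)^-1 * (2 * cosh P * sinh P / D ^+ 2).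
    rewrite gE; have := CD P dP => c0; have D1 : D != 0 by rewrite gt_eqF.
    have c1 : cosh P ^+ 2 - D ^+ 2 != 0 by rewrite gt_eqF.
    by field; rewrite c1 D1.
  exact: dl.
- move=> P dP; apply: cvgM.
    apply: cvgM; last exact: continuous_sinh.
    by apply: cvgM; [exact: cvg_cst|exact: continuous_cosh].
  apply: cvgV; first by rewrite gt_eqF ?CD.
  by apply: cvgB; [apply: cvgM; exact: continuous_cosh|exact: cvg_cst].
- move=> P dP; apply: divr_gt0; last exact: CD.
  apply: mulr_gt0; last exact: S0.
  by apply: mulr_gt0 => //; exact: cosh_gt0.
- move=> A; have e1 : 1 < 1 + expR A by rewrite ltrDl expR_gt0.
  (* With q = P - |d| one has cosh P <= e^q cosh d, and e^{2q} <= 1 + e^A for these P. *)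
  exists (`|d| + ln (1 + expR A) / 2); first by rewrite ltrDl divr_gt0// ln_gt0.
  move=> P /andP[dP Pb]; rewrite -ler_expR lnK ?posrE ?g0// lerBlDl.
  rewrite ler_pdivrMr//.
  set q := P - `|d|.
  have c1 : cosh P <= expR q * D.
    have -> : P = `|d| + q by rewrite /q addrC subrK.
    have -> : expR q = cosh q + sinh q by rewrite /cosh /sinh; field.
    rewrite coshD DE -(cosh_norm d) mulrDl mulrC lerD2l mulrC ler_wpM2l ?ltW ?sinh_lt_cosh//.
    by apply: sinh_gt0; rewrite /q; lra.
  apply: (@le_trans _ _ ((expR q * D) ^+ 2)).
    exact: sq (cosh_gt0 P) c1.
  rewrite exprMn ler_pM2r// -expRM_natr -[leRHS]lnK ?posrE ?addr_gt0 ?expR_gt0//.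
  by rewrite ler_expR /q; lra.
- move=> A; have e1 : 1 < 1 + expR A by rewrite ltrDl expR_gt0.
  have e0 : 0 < 1 + expR A by rewrite addr_gt0 ?expR_gt0.
  (* Here cosh P >= e^P / 2 >= D (1 + e^A), and squaring only increases 1 + e^A. *)
  exists (ln (2 * D * (1 + expR A))) => P Pb.
  have c1 : D * (1 + expR A) <= cosh P.
    have : 2 * D * (1 + expR A) <= expR P.
      have q0 : 0 < 2 * D * (1 + expR A) by apply: mulr_gt0 => //; exact: mulr_gt0.
      by rewrite -[leLHS]lnK ?posrE// ler_expR.
    by have := expR_gt0 (- P); move: (D) => D'; rewrite /cosh; lra.
  have c2 : 1 + expR A <= cosh P ^+ 2 / D ^+ 2.
    rewrite ler_pdivlMr//; apply: (@le_trans _ _ ((D * (1 + expR A)) ^+ 2)).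
      by rewrite exprMn [leLHS]mulrC ler_pM2l// expr2 ler_pMl// ltW.
    by apply: sq c1; exact: mulr_gt0.
  by rewrite -[leLHS]expRK ler_ln ?posrE ?expR_gt0// ?lerBrDl// -subr_gt0; have := expR_gt0 A; lra.
have key P : cpow 2 (- (2 * v)) * cpow D (2 * v) *
    (if `|d| < P then sker v z (ln (cosh P ^+ 2 / D ^+ 2 - 1)) *
       (2 * cosh P * sinh P / (cosh P ^+ 2 - D ^+ 2))%:C else 0) =
   (if `|d| < P then (expR (- (x * cosh P * D)) * sinh P)%:C *
      cexp ((v - h) * (ln ((cosh P ^+ 2 - D ^+ 2) / 4))%:C) else 0).
  case: ifPn => [dP|_]; last by rewrite mulr0.
  have c0 := CD P dP; have C0 := cosh_gt0 P.
  have sC : Num.sqrt (1 + (cosh P ^+ 2 / D ^+ 2 - 1)) = cosh P / D.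
    rewrite addrC subrK -expr_div_n sqrtr_sqr gtr0_norm; [by []|exact: divr_gt0].
  rewrite /sker lnK ?posrE ?g0// sC.
  have -> : z * (cosh P / D) = x * cosh P * D by rewrite zE; field; rewrite gt_eqF.
  set W := expR (- (x * cosh P * D)).
  rewrite gE; set N := cosh P ^+ 2 - D ^+ 2 in c0 *.
  have lnM2 (a b : R) : 0 < a -> 0 < b -> ln (a * b) = ln a + ln b by move=> a0 b0; rewrite lnM.
  have l4 : ln (4 : R) = 2 * ln 2.
    by rewrite (_ : 4 = 2 * 2)//; [rewrite lnM2//; ring|ring].
  rewrite lnM2 ?invr_gt0// lnV ?posrE// lnM2 ?invr_gt0// lnV ?posrE// l4.
  have -> : ln (D ^+ 2) = 2 * ln D by rewrite lnXn// mulr_natl.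
  have e : (cosh P / D)^-1 * W * (2 * cosh P * sinh P / N) =
      W * sinh P * expR (ln D + ln 2 - ln N).
    rewrite expRB expRD !lnK ?posrE//; field.
    by rewrite !gt_eqF.
  have eC : ((cosh P / D)^-1 * W)%:C * (2 * cosh P * sinh P / N)%:C =
     (W * sinh P)%:C * cexp (ln D + ln 2 - ln N)%:C :> R[i].
    by rewrite -rmorphM e cexpR (rmorphM _ (W * sinh P)).
  have re (a b c r e' : R[i]) : a * b * (c * (r * e')) = r * (a * b * c * e') by ring.
  rewrite -(mulrA (cexp _)) eC re; congr (_ * _).
  rewrite /cpow -!cexpD; congr cexp.
  move: (ln N) (ln D) (ln 2) => l1 l2 l3.
  apply: complex_eqP; rewrite !(cReD, cImD, cReN, cImN, cReM, cImM) /=; field => //.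
rewrite E; exact: (etrans (esym (f_equal (cintegral setT) (funext key))) (cintZ _ I)).
Qed.

End ProductFormula.

(** * The product as an integral of Macdonald functions *)

Section WhittakerProduct.
Context {R : realType}.
Local Notation cint := (cintegral setT).
Local Notation cintg := (cintegrable setT).
Implicit Types (x s t p d P : R) (v : R[i]).
Local Notation h := ((1 / 2 : R)%:C : R[i]).

Lemma cpowNr x v : cpow x (- v) = (cpow x v)^-1.
Proof. by rewrite /cpow mulNr cexpN. Qed.

Lemma cpow_neq0 x v : cpow x v != 0.
Proof. exact: cexp_neq0. Qed.

Lemma cpowM x p v : 0 < x -> 0 < p -> cpow (x * p) v = cpow x v * cpow p v.
Proof. by move=> x0 p0; rewrite /cpow -cexpD lnM ?posrE// rmorphD mulrDr. Qed.

Lemma cpow_double x v : 0 < x -> cpow x (2 * v) = cpow (x ^+ 2) v.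
Proof. by move=> x0; rewrite /cpow lnXn// rmorphMn /= mulr2n; congr cexp; ring. Qed.

Lemma sqrtpi_neq0 : (Num.sqrt pi)%:C != 0 :> R[i].
Proof. by rewrite -normc_gt0 normcR normr_gt0 gt_eqF// sqrtr_gt0 pi_gt0. Qed.

(** For fixed d the integral over P is a multiple of 2 K_v(x cosh^2 d). The factor cosh(d)^{2v} is
    absorbed by the power (z/2)^v in [knu_rep], so the constant does not depend on d. *)
Lemma wker_product x v : 0 < x -> Re v = 0 ->
  cintg (wker x v (1 / 2)) -> cintg (wker x v (- (1 / 2))) ->
  cintg (fun d => knu v (x * cosh d ^+ 2)) /\
  cint (wker x v (1 / 2)) * cint (wker x v (- (1 / 2))) =
    cpow (2 * x) (- v) * egamma (v + h) / (Num.sqrt pi)%:C *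
      cint (fun d => knu v (x * cosh d ^+ 2)).
Proof.
move=> x0 v0 Fi Gi.
have vh : 0 < Re (v + h) by rewrite cReD v0 /=; lra.
set c := cpow (2 * x) (- v) * egamma (v + h) / (Num.sqrt pi)%:C.
have ge : egamma (v + h) != 0 by exact: egamma_neq0.
have c0 : c != 0.
  apply: mulf_neq0; last by rewrite invr_eq0 sqrtpi_neq0.
  by apply: mulf_neq0 => //; exact: cpow_neq0.
have F1 p : normc (wker x v (1 / 2) p) <= 1 by exact: normc_wker_le1.
have [Ki E] := cint_convolution_sym Fi Gi F1.
have key d : cint (fun P => wker x v (1 / 2) (P + d) * wker x v (- (1 / 2)) (P - d) +
    wker x v (1 / 2) (P - d) * wker x v (- (1 / 2)) (P + d)) = c * knu v (x * cosh d ^+ 2).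
  apply: (etrans (f_equal (cintegral setT) (funext (fun P => wkerM_sym x v P d)))).
  apply: (etrans (sker_substitution d x0 vh)).
  have z0 : 0 < x * cosh d ^+ 2 by rewrite mulr_gt0// exprn_gt0// cosh_gt0.
  have [_] := knu_rep z0 vh.
  set I := cint _; set k := knu _ _ => e.
  have -> : c * k = cpow (2 * x) (- v) / (Num.sqrt pi)%:C * (egamma (v + h) * k).
    rewrite /c; ring.
  rewrite e cpow_double ?cosh_gt0//.
  have -> : x * cosh d ^+ 2 / 2 = 2^-1 * (x * cosh d ^+ 2) by rewrite mulrC.
  have Q0 : 0 < cosh d ^+ 2 by rewrite exprn_gt0// cosh_gt0.
  have h0 : 0 < 2^-1 :> R by rewrite invr_gt0.
  have t0 : 0 < 2 :> R by [].
  have q0 : 0 < x * cosh d ^+ 2 by exact: mulr_gt0.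
  rewrite (cpowM _ h0 q0) (cpowM _ x0 Q0) (cpowM _ t0 x0).
  have -> : cpow (2^-1) v = cpow 2 (- v) by rewrite /cpow lnV ?posrE// rmorphN /= mulrN mulNr.
  have -> : - (2 * v) = - v + - v by ring.
  have -> : cpow 2 (- v + - v) = cpow 2 (- v) * cpow 2 (- v).
    by rewrite -cexpD -mulrDl.
  rewrite (cpowNr x).
  have re (a X r Q J : R[i]) : X != 0 -> r != 0 -> a * a * Q * J = a / X / r * (a * (X * Q) * r * J).
    by move=> X0 r0; field; rewrite ?X0 ?r0.
  exact: re (cpow_neq0 x v) sqrtpi_neq0.
have ci : cintg (fun d => c * knu v (x * cosh d ^+ 2)).
  exact: (eq_ind _ (cintegrable setT) Ki _ (funext key)).
have ki : cintg (fun d => knu v (x * cosh d ^+ 2)).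
  have e : (fun d => c^-1 * (c * knu v (x * cosh d ^+ 2))) = (fun d => knu v (x * cosh d ^+ 2)).
    by apply/funext => d; exact: (mulKf c0).
  exact: (eq_ind _ (cintegrable setT) (cintgZ _ ci) _ e).
split; first exact: ki.
exact: (etrans E (etrans (f_equal (cintegral setT) (funext key)) (cintZ c ki))).
Qed.

End WhittakerProduct.

(** * The product of Whittaker functions as a Fourier integral *)

Section WhittakerFourier.
Context {R : realType}.
Local Notation cint := (cintegral setT).
Local Notation cintg := (cintegrable setT).
Local Notation RR := (measurableTypeR R * measurableTypeR R)%type.
Implicit Types (x s t p d P : R) (v : R[i]).
Local Notation h := ((1 / 2 : R)%:C : R[i]).

Lemma quarter_C : 1 / 4 = (1 / 4 : R)%:C :> R[i].
Proof. by rewrite rmorphM rmorphV ?unitfE// rmorph1 rmorph_nat. Qed.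

(** Assembles [whittaker_tint], [wker_int] and [wker_product] at v = 2it, with kernel exponents -2
    mu = 1/2 and -1/2. *)
Lemma whittaker_product_knu x t : 0 < x ->
  cintg (fun d => knu ((2 * t)*i) (x * cosh d ^+ 2)) /\
  whittakerW (- (1 / 4)) (t*i) x * whittakerW (1 / 4) (t*i) x =
  (x / (Num.sqrt 2 * pi))%:C * cint (fun d => knu ((2 * t)*i) (x * cosh d ^+ 2)).
Proof.
move=> x0.
have m1 : - (1 / 4) < 1 / 2 :> R by lra.
have m2 : 1 / 4 < 1 / 2 :> R by lra.
have [] := wker_int t x0 m1; have [] := wker_int t x0 m2.
have -> : - (2 * (1 / 4)) = - (1 / 2) :> R by field.
have -> : - (2 * - (1 / 4)) = 1 / 2 :> R by field.
move=> Gi GE Fi FE.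
have v0 : Re ((2 * t)*i) = 0 :> R by [].
have [ki E] := wker_product x0 v0 Fi Gi.
split; first exact: ki.
have W1 := whittaker_tint t x0 m1; have W2 := whittaker_tint t x0 m2.
rewrite quarter_C -rmorphN.
set a1 := (1 / 2 - - (1 / 4))%:C + t*i in FE W1.
set a2 := (1 / 2 - 1 / 4)%:C + t*i in GE W2.
have a2p : 0 < Re a2 by rewrite /a2 cReD /=; lra.
have ea : a1 = a2 + (1 / 2)%:C.
  by rewrite /a1 /a2; apply: complex_eqP; rewrite !(cReD, cImD) /=; field => //.
have a1p : 0 < Re a1 by rewrite ea cReD /=; lra.
have e2a : 2 * a2 = (2 * t)*i + h.
  by rewrite /a2; apply: complex_eqP; rewrite !(cReD, cImD, cReM, cImM) /=; field => //.
(* The denominators are Gamma(1/4 + it) Gamma(3/4 + it); duplication reduces them to Gamma(1/2 +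
   2it), which cancels against the factor of [wker_product]. *)
have D := egamma_duplication a2p.
rewrite e2a -ea in D.
have g1 := egamma_neq0 a1p; have g2 := egamma_neq0 a2p.
have vh : 0 < Re ((2 * t)*i + h) by rewrite cReD /=; lra.
have g3 := egamma_neq0 vh.
apply: (etrans (f_equal2 (fun z w => z * w) W1 W2)).
set J := cint (fun d => knu _ _) in E *.
set A := cint _ in E FE; set B := cint (wker _ _ (- _)) in E GE.
set T1 := tint a1 _ _ in FE *; set T2 := tint a2 _ _ in GE *.
set q := (expR (- x / 2))%:C in FE GE *.
have re (r T g T' g' : R[i]) : q * r * (T / g) * (q * r * (T' / g')) = r * r * ((q * T) * (q * T')) / (g' * g).
  by rewrite invfM; ring.
rewrite re FE GE E D.
set v := (2 * t)*i in E D vh g3 *.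
have -> : t*i + 1 / 2 = t*i + h by rewrite half_C.
have er : cpow x (t*i + h) * cpow x (t*i + h) = cpow x v * x%:C.
  rewrite -cpowD -(cpow1 x0) -cpowD; congr cpow.
  by apply: complex_eqP; rewrite !(cReD, cImD) /=; field => //.
have e2 : cpow 2 h = (Num.sqrt 2)%:C :> R[i].
  by rewrite cpowR -[in RHS](@lnK _ 2) ?posrE// sqrt_expR; congr (expR _)%:C; field => //.
rewrite er (cpowNr (2 * x)) (cpowM _ _ x0)// (cpowNr 2) cpowD e2.
have s2 : (Num.sqrt 2)%:C * (Num.sqrt 2)%:C = 2 :> R[i].
  by rewrite -rmorphM -expr2 sqr_sqrtr// rmorph_nat.
have sp : (Num.sqrt pi)%:C * (Num.sqrt pi)%:C = pi%:C :> R[i].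
  by rewrite -rmorphM -expr2 sqr_sqrtr// pi_ge0.
have q20 : (Num.sqrt 2)%:C != 0 :> R[i].
  by rewrite -normc_gt0 normcR normr_gt0 gt_eqF// sqrtr_gt0.
have -> : (x / (Num.sqrt 2 * pi))%:C = x%:C / ((Num.sqrt 2)%:C * pi%:C) :> R[i].
  by rewrite fmorph_div (rmorphM _ (Num.sqrt 2)).
rewrite -sp -s2.
have := @sqrtpi_neq0 R; move: q20 (cpow_neq0 x v) (cpow_neq0 2 v) g3.
move: (Num.sqrt 2)%:C (cpow x v) (cpow 2 v) (egamma (v + h)) (Num.sqrt pi)%:C x%:C (J) => c1 c2 c3 c4 c5 c6 c7 n1 n2 n3 n4 n5.
by field; rewrite ?n1 ?n2 ?n3 ?n4 ?n5.
Qed.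

(** This is e^{-X} K_0(X) at X = (x/2) cosh y, see [besselK_gbessel]. The present form is the one
    that Fubini yields, and it makes the dependence on y transparent. *)
Definition gbessel x y : R := rint (fun d => expR (- (x * cosh y * cosh d ^+ 2))).

Lemma rintegrable_expcosh k : 0 < k -> rintegrable (fun d => expR (- (k * cosh d))).
Proof.
move=> k0; apply: (@rintegrable_expdecay _ _ 1 (k / 2)).
- apply: measurableT_comp => //; apply: continuous_measurable_fun => d.
  by apply: cvgN; apply: cvgM; [exact: cvg_cst|exact: continuous_cosh].
- by rewrite divr_gt0.
move=> u; rewrite ger0_norm ?expR_ge0// mul1r ler_expR.
have : `|u| <= 2 * cosh u.
  by apply: le_trans (cosh_le_exp u); have := expR_ge1Dx `|u|; lra.
move=> hu; have := ler_wpM2l (ltW k0) hu; lra.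
Qed.

(** Since cosh >= 1, the product cosh y cosh^2 d dominates both cosh y and cosh d, hence their mean;
    the bound separates the variables. *)
Lemma expcosh_le x y d : 0 < x ->
  expR (- (x * cosh y * cosh d ^+ 2)) <= expR (- (x / 2 * cosh d)) * expR (- (x / 2 * cosh y)).
Proof.
move=> x0; rewrite -expRD ler_expR.
have := cosh_ge1 y; have := cosh_ge1 d; move: (cosh y) (cosh d) => C D D1 C1.
have h1 : C <= C * D ^+ 2 by rewrite ler_peMr ?expr_ge1//; lra.
have h2 : D <= C * D ^+ 2.
  apply: (@le_trans _ _ (D ^+ 2)); first by rewrite expr2 ler_peMr//; lra.
  by rewrite ler_peMl// exprn_ge0//; lra.
have := ler_wpM2l (ltW x0) h1; have := ler_wpM2l (ltW x0) h2; rewrite !mulrA; lra.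
Qed.

Lemma rintegrable_gbessel x y : 0 < x ->
  rintegrable (fun d => expR (- (x * cosh y * cosh d ^+ 2))).
Proof.
move=> x0; have i0 := @rintegrable_expcosh (x / 2) (divr_gt0 x0 (ltr0Sn _ _)).
apply: (rintegrable_le _ _ (rintegrableZ (expR (- (x / 2 * cosh y))) i0)).
  apply: measurableT_comp => //; apply: continuous_measurable_fun => d.
  apply: cvgN; apply: cvgM; first exact: cvg_cst.
  by apply: cvgM; exact: continuous_cosh.
move=> d; rewrite ger0_norm; last exact: expR_ge0.
by rewrite [leRHS]mulrC; exact: expcosh_le.
Qed.

Lemma knu_fubini x v : 0 < x -> Re v = 0 ->
  cintg (fun y => (gbessel x y)%:C * cexp (v * y%:C)) /\
  cint (fun d => knu v (x * cosh d ^+ 2)) = cint (fun y => (gbessel x y)%:C * cexp (v * y%:C)).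
Proof.
move=> x0 v0; have x2 : 0 < x / 2 by rewrite divr_gt0.
have mc (f : RR -> R) : measurable_fun setT f -> measurable_fun setT (fun p : RR => cosh (f p)).
  by move=> mf; apply: measurableT_comp mf; apply: continuous_measurable_fun; exact: continuous_cosh.
have [||| d y|_ I E] := @cint_fubini_prod R (fun d y => kmac v (x * cosh d ^+ 2) y)
  (fun d => expR (- (x / 2 * cosh d))) (fun y => expR (- (x / 2 * cosh y))).
- have m1 : measurable_fun setT (fun p : RR => p.1 : R) by exact: measurable_fst.
  have m2 : measurable_fun setT (fun p : RR => p.2 : R) by exact: measurable_snd.
  apply: cmeas_cexp; apply: cmeasD.
    apply: cmeas_real; apply: measurable_funN; apply: measurable_funM; last exact: mc.
    by apply: measurable_funM => //; apply: measurable_funX; exact: mc.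
  by apply: cmeasM; [exact: cmeas_cst|exact: cmeas_real].
- exact: rintegrable_expcosh.
- exact: rintegrable_expcosh.
- rewrite normc_cexp cReD cReMr v0 mul0r addr0 /=; apply: le_trans (expcosh_le y d x0).
  by rewrite ler_expR lerN2 mulrAC.
have key y : cint (fun d => kmac v (x * cosh d ^+ 2) y) = (gbessel x y)%:C * cexp (v * y%:C).
  have e d : kmac v (x * cosh d ^+ 2) y = (expR (- (x * cosh y * cosh d ^+ 2)))%:C * cexp (v * y%:C).
    by rewrite -cexpR -cexpD /kmac mulrAC.
  apply: (etrans (f_equal (cintegral setT) (funext e))).
  apply: (etrans (cintZr (cexp (v * y%:C)) (cintgR (rintegrable_gbessel y x0)))).
  by rewrite cintR.
split; last exact: (etrans E (f_equal (cintegral setT) (funext key))).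
exact: (eq_ind _ (cintegrable setT) I _ (funext key)).
Qed.

End WhittakerFourier.

(** * The real form of the product formula *)

Section RealForm.
Context {R : realType}.
Local Notation leb := (@lebesgue_measure R).
Local Notation cint := (cintegral setT).
Local Notation cintg := (cintegrable setT).
Implicit Types (x s t p d P y : R).

Lemma rint_even_ray (f : R -> R) : (forall y, 0 <= f y) -> continuous f ->
  (forall y, f (- y) = f y) -> rintegrable f ->
  \int[leb]_(y in `[0, +oo[%classic) f y = rint f / 2.
Proof.
move=> f0 cf ef fi.
have := ge0_symfun_integralT f0 cf (fun y => esym (ef y)).
have -> : [set y | 0 <= y] = `[0, +oo[%classic :> set R.
  by apply/seteqP; split => y /=; rewrite in_itv/= andbT.
rewrite EFin_rint// /Rintegral.
have : (0 <= \int[leb]_(y in `[0%R, +oo[%classic) (f y)%:E)%E.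
  by apply: integral_ge0 => y _; rewrite lee_fin.
case: (integral _ _ _) => [r _ [->]|_|//] /=; first by rewrite mulrC mulKf.
by rewrite gt0_muley ?lte_fin.
Qed.

Lemma rint_odd (f : R -> R) : rintegrable f -> (forall y, f (- y) = - f y) -> rint f = 0.
Proof.
move=> fi of_; have m1 : (-1 : R) != 0 by rewrite oppr_eq0 oner_eq0.
have := rint_affine 0 m1 fi; rewrite normrN normr1 mul1r.
have -> : (fun y => f (-1 * y + 0)) = (fun y => -1 * f y).
  by apply/funext => y; rewrite addr0 !mulN1r of_.
rewrite rintZ//; lra.
Qed.

Lemma gbesselN x y : gbessel x (- y) = gbessel x y.
Proof. by rewrite /gbessel coshN. Qed.

(** From cosh^2 d = (1 + cosh 2d)/2: the constant gives e^{-X}, and the scaling d -> 2d together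
    with evenness gives K_0(X). *)
Lemma besselK_gbessel x y : 0 < x ->
  (expR (- (x / 2) * cosh y))%:C * besselK 0 (x / 2 * cosh y) = (gbessel x y)%:C.
Proof.
move=> x0; set X := x / 2 * cosh y.
have X0 : 0 < X by rewrite mulr_gt0 ?cosh_gt0// divr_gt0.
have i1 := rintegrable_expcosh X0.
have ce : continuous (fun u : R => expR (- (X * cosh u))).
  move=> u; apply: continuous_comp; last exact: continuous_expR.
  by apply: cvgN; apply: cvgM; [exact: cvg_cst|exact: continuous_cosh].
have -> : besselK 0 X = (rint (fun u => expR (- (X * cosh u))) / 2)%:C :> R[i].
  have e u : (expR (- X * cosh u))%:C * ccosh (0 * u%:C) = (expR (- (X * cosh u)))%:C :> R[i].
    rewrite mul0r /ccosh oppr0 cexp0 -[1 + 1]/(2 : R[i]) divff ?pnatr_eq0// mulr1.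
    by rewrite mulNr.
  have ee u : expR (- (X * cosh (- u))) = expR (- (X * cosh u)) by rewrite coshN.
  rewrite /besselK (eq_cintegral (fun u _ => e u)) -(rint_even_ray (fun u => expR_ge0 _) ce ee i1).
  apply: complex_eqP => //=; by rewrite /Rintegral integral0.
rewrite -rmorphM /gbessel; congr (_%:C).
have n2 : (2 : R) != 0 by [].
rewrite (rint_affine 0 n2 i1) normr_nat.
have i2 := rintegrable_affine 0 n2 i1.
have -> : (fun d => expR (- (x * cosh y * cosh d ^+ 2))) =
    (fun d => expR (- X) * expR (- (X * cosh (2 * d + 0)))).
  apply/funext => d; rewrite -expRD; congr expR; rewrite addr0 (cosh_double (2 * d)).
  have -> : 2 * d / 2 = d by field.
  have -> : sinh d ^+ 2 = cosh d ^+ 2 - 1 by have := cosh2B d; lra.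
  by rewrite /X; field.
rewrite rintZ//.
have -> : - (x / 2) * cosh y = - X by rewrite mulNr.
by field.
Qed.

Definition hbessel x s := rint (fun y => gbessel x y * cos (s * y)).

(** [gbessel] is even in y, so the sine part of the Fourier integral vanishes and the product is
    real. *)
Lemma whittaker_product x t : 0 < x ->
  whittakerW (- (1 / 4)) (t*i) x * whittakerW (1 / 4) (t*i) x =
  (x / (Num.sqrt 2 * pi) * hbessel x (2 * t))%:C.
Proof.
move=> x0; have [ki ->] := whittaker_product_knu t x0.
have v0 : Re ((2 * t)*i) = 0 :> R by [].
have [I ->] := knu_fubini x0 v0.
have e y : (gbessel x y)%:C * cexp ((2 * t)*i * y%:C) =
    (gbessel x y * cos (2 * t * y)) +i* (gbessel x y * sin (2 * t * y)) :> R[i].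
  move: (gbessel x y) => g; apply: complex_eqP; rewrite ?(cReM, cImM) ?Re_cexp ?Im_cexp ?cReM ?cImM /=;
  by rewrite !(mul0r, mulr0, subr0, sub0r, oppr0, addr0, add0r, expR0, mul1r).
have [_ Ii] := eq_ind _ (cintegrable setT) I _ (funext e).
have -> : (x / (Num.sqrt 2 * pi) * hbessel x (2 * t))%:C =
    (x / (Num.sqrt 2 * pi))%:C * (hbessel x (2 * t))%:C :> R[i] by rewrite rmorphM.
congr (_ * _); rewrite (f_equal (cintegral setT) (funext e)).
apply: complex_eqP => //=; apply: rint_odd; first exact: Ii.
by move=> y; rewrite gbesselN mulrN sinN mulrN.
Qed.

End RealForm.

(** * First and second differences of exp(-l cosh y) *)

Section ExpCoshBounds.
Context {R : realType}.
Implicit Types (x y h l z a b : R).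

Lemma expRN_diff_le a b m : m <= a -> m <= b ->
  `|expR (- a) - expR (- b)| <= `|a - b| * expR (- m) :> R.
Proof.
wlog ab : a b / a <= b.
  by move=> W ma mb; have [ab|/ltW ba] := leP a b; [exact: W|rewrite distrC (distrC a); exact: W].
move=> ma _; rewrite (distrC a) !ger0_norm ?subr_ge0// ?ler_expR ?lerN2//.
have -> : expR (- b) = expR (- a) * expR (a - b) by rewrite -expRD; congr expR; ring.
have : expR (- a) <= expR (- m) by rewrite ler_expR lerN2.
have h1 := expR_ge1Dx (a - b); have h2 := expR_gt0 (- a) => h3.
have : expR (- a) * (1 + (a - b)) <= expR (- a) * expR (a - b) by rewrite ler_pM2l.
have : (b - a) * expR (- a) <= (b - a) * expR (- m) by rewrite ler_wpM2l// subr_ge0.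
lra.
Qed.

Lemma exp_cosh_decay l y : 0 < l -> expR (- (l * cosh y)) <= 2 / l * expR (- `|y|).
Proof.
move=> l0; have c0 := cosh_gt0 y; have lc : 0 < l * cosh y by rewrite mulr_gt0.
rewrite !expRN -[2 / l]invf_div -invfM lef_pV2 ?posrE ?expR_gt0 ?mulr_gt0 ?divr_gt0 ?expR_gt0//.
have := expR_ge1Dx (l * cosh y); have := ler_wpM2l (ltW l0) (cosh_le_exp y); lra.
Qed.

Lemma coshD_ge y h : expR (- `|h|) * cosh y <= cosh (y + h).
Proof.
have h1 : expR (- `|h|) * expR y <= expR (y + h).
  by rewrite -expRD ler_expR; have := ler_norm (- h); rewrite normrN; lra.
have h2 : expR (- `|h|) * expR (- y) <= expR (- (y + h)).
  by rewrite -expRD ler_expR; have := ler_norm h; lra.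
rewrite /cosh; lra.
Qed.

Lemma norm_sinh_le h : `|sinh h| <= `|h| * expR `|h|.
Proof.
have -> : `|sinh h| = sinh `|h|.
  have [h0|h0] := ger0P h; last rewrite -normrN -sinhN.
    by rewrite ger0_norm//; move: h0; rewrite le_eqVlt => /predU1P[<-|/sinh_gt0/ltW//]; rewrite /sinh oppr0 subrr mul0r.
  by rewrite gtr0_norm// sinh_gt0// oppr_gt0.
have h0 := normr_ge0 h; move: `|h| h0 => t t0.
have h1 := expR_ge1Dx (- t); have h2 := expR_gt0 t.
have e : expR t * expR (- t) = 1 by rewrite -expRD subrr expR0.
have h3 : expR t * (1 + - t) <= expR t * expR (- t) by rewrite ler_pM2l.
have h4 : expR t + expR (- t) >= 2 by have := cosh_ge1 t; rewrite /cosh; lra.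
rewrite /sinh; lra.
Qed.

Lemma coshD_dist y h : `|cosh (y + h) - cosh y| <= `|h| * expR `|h| * cosh y.
Proof.
have c0 := cosh_gt0 y; have h0 := normr_ge0 h.
have g1 := coshD_ge y h; have := coshD_ge (y + h) (- h); rewrite normrN addrK => g2.
move: (cosh (y + h)) (cosh y) g1 g2 c0 => C D; move: `|h| h0 => t t0 g1 g2 D0.
have e : expR t * expR (- t) = 1 by rewrite -expRD subrr expR0.
have e1 := expR_ge1Dx t; have e2 := expR_ge1Dx (- t).
have f1 : C <= expR t * D.
  have : expR t * (expR (- t) * C) <= expR t * D by rewrite ler_pM2l ?expR_gt0.
  by rewrite mulrA e mul1r.
have f2 : (1 - t) * D <= C by apply: le_trans g1; rewrite ler_pM2r//; lra.
have f3 : expR t * (1 - t) <= 1 by rewrite -e ler_pM2l ?expR_gt0//; lra.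
have f4 : (expR t - t * expR t) * D <= 1 * D by rewrite ler_pM2r//; lra.
have f5 : 0 <= t * D * (expR t - 1) by rewrite !mulr_ge0//; [exact: ltW|lra].
rewrite ler_norml; apply/andP; split; lra.
Qed.

(** [gbessel x] is a superposition of these functions with l = x cosh^2 d; bounds uniform in l
    therefore pass to it. *)
Definition ecosh l y : R := expR (- (l * cosh y)).

(** A power of z is paid for by halving the decay rate. *)
Lemma zexp_le k z : 0 < k -> z * expR (- (k * z)) <= 2 / k * expR (- (k / 2 * z)).
Proof.
move=> k0; have -> : - (k * z) = - (k / 2 * z) + - (k / 2 * z) by field.
rewrite expRD mulrA ler_wpM2r ?expR_ge0// expRN -[2 / k]invf_div ler_pdivrMr ?expR_gt0// mulrC ler_pdivlMr ?divr_gt0//.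
by have := expR_ge1Dx (k / 2 * z); lra.
Qed.

Lemma zzexp_le k z : 0 < k -> 0 <= z -> z ^+ 2 * expR (- (k * z)) <= 2 * (2 / k) ^+ 2 * expR (- (k / 2 * z)).
Proof.
move=> k0 z0; have -> : - (k * z) = - (k / 2 * z) + - (k / 2 * z) by field.
rewrite expRD mulrA ler_wpM2r ?expR_ge0// expRN ler_pdivrMr ?expR_gt0//.
have kz : 0 <= k / 2 * z by rewrite mulr_ge0// divr_ge0// ltW.
have := expX_le 2 kz; have k2 : 0 < (2 / k) ^+ 2 by rewrite exprn_gt0// divr_gt0.
rewrite -(ler_pM2l k2) -exprMn.
have -> : 2 / k * (k / 2 * z) = z by field; rewrite gt_eqF.
by move=> /le_trans; apply; rewrite mulrA [X in _ <= X * _]mulrC.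
Qed.

(** Put z = l cosh y. Moving y by h with |h| <= B changes the exponent by at most |h| e^B z and
    keeps it above e^{-B} z; [zexp_le] absorbs the factor z. *)
Lemma ecosh_lipschitz B l y h : 0 < l -> `|h| <= B ->
  `|ecosh l (y + h) - ecosh l y| <=
    2 * expR (B + B) * `|h| * ecosh (expR (- B) / 2 * l) y.
Proof.
move=> l0 hB; have c0 := cosh_gt0 y.
set k := expR (- B); have k0 : 0 < k by exact: expR_gt0.
set z := l * cosh y; have z0 : 0 < z by exact: mulr_gt0.
have kh : k <= expR (- `|h|) by rewrite ler_expR lerN2.
have k1 : expR (- `|h|) <= 1 by rewrite -[leRHS]expR0 ler_expR oppr_le0.
have zz : k * z <= z by rewrite ler_piMl ?(ltW z0)//; exact: le_trans kh k1.
have z1 : k * z <= l * cosh (y + h).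
  rewrite /z mulrCA ler_pM2l//; apply: le_trans (coshD_ge y h).
  by rewrite ler_pM2r.
apply: le_trans (expRN_diff_le z1 zz) _.
have -> : `|l * cosh (y + h) - z| = l * `|cosh (y + h) - cosh y|.
  by rewrite /z -mulrBr normrM gtr0_norm.
have hE : expR `|h| <= expR B by rewrite ler_expR.
have d1 : l * `|cosh (y + h) - cosh y| <= `|h| * expR B * z.
  rewrite /z mulrCA ler_pM2l//; apply: le_trans (coshD_dist y h) _.
  by rewrite ler_pM2r// ler_wpM2l.
apply: (@le_trans _ _ (`|h| * expR B * (z * expR (- (k * z))))).
  by rewrite [leRHS]mulrA ler_wpM2r// expR_ge0.
have -> : 2 * expR (B + B) * `|h| * ecosh (k / 2 * l) y = `|h| * expR B * (2 / k * expR (- (k / 2 * z))).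
  have -> : k / 2 * z = k / 2 * l * cosh y by rewrite /z mulrA.
  have -> : 2 / k = 2 * expR B by rewrite /k expRN invrK.
  by rewrite expRD /ecosh; ring.
by rewrite ler_wpM2l ?zexp_le// mulr_ge0// expR_ge0.
Qed.

(** With z = l cosh y and u = l sinh y sinh h, the two shifted values are e^{-z cosh h} times e^{-u}
    and e^u. The second difference is 2 e^{-z cosh h} (cosh u - 1) + 2 (e^{-z cosh h} - e^{-z}), and
    both terms are of order h^2. *)
Lemma ecosh_second_difference l y h : 0 < l -> `|h| <= 1 ->
  `|ecosh l (y + h) + ecosh l (y - h) - 2 * ecosh l y| <=
    2 * expR 2 * (2 * (2 * expR 1) ^+ 2 + 2 * expR 1) * h ^+ 2 *
      ecosh (expR (- 1) / 2 * l) y.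
Proof.
move=> l0 hB; have c0 := cosh_gt0 y; have ch := cosh_ge1 h.
set k := expR (- 1); have k0 : 0 < k by exact: expR_gt0.
set z := l * cosh y; have z0 : 0 < z by exact: mulr_gt0.
set u := l * (sinh y * sinh h); set A : R := expR 2.
have A0 : 0 < A by exact: expR_gt0.
have E1 : ecosh l (y + h) = expR (- (z * cosh h)) * expR (- u).
  by rewrite /ecosh coshD -expRD /z /u; congr expR; ring.
have E2 : ecosh l (y - h) = expR (- (z * cosh h)) * expR u.
  by rewrite /ecosh coshD coshN sinhN -expRD /z /u; congr expR; ring.
have kle g : `|g| <= 1 -> ecosh l (y + g) <= expR (- (k * z)).
  move=> g1; rewrite /ecosh ler_expR lerN2 /z mulrCA ler_pM2l//.
  by apply: le_trans (coshD_ge y g); rewrite ler_pM2r// ler_expR lerN2.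
have sh t : `|t| <= 1 -> sinh t ^+ 2 <= t ^+ 2 * A.
  move=> t1; rewrite -(real_normK (num_real (sinh t))) -(real_normK (num_real t)).
  have -> : A = expR 1 ^+ 2 by rewrite -expRM_natr mul1r.
  rewrite -exprMn ler_pXn2r ?nnegrE ?mulr_ge0 ?expR_ge0//.
  by apply: le_trans (norm_sinh_le t) _; rewrite ler_wpM2l// ler_expR.
have u2 : u ^+ 2 <= z ^+ 2 * (h ^+ 2 * A).
  have -> : u ^+ 2 = l ^+ 2 * (sinh y ^+ 2 * sinh h ^+ 2) by rewrite /u; ring.
  have -> : z ^+ 2 * (h ^+ 2 * A) = l ^+ 2 * (cosh y ^+ 2 * (h ^+ 2 * A)) by rewrite /z; ring.
  rewrite ler_pM2l ?exprn_gt0//; apply: ler_pM; rewrite ?sqr_ge0//.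
  - by have := cosh2B y; lra.
  - exact: sh.
(* From cosh u - 1 = 2 sinh^2(u/2) <= (u^2/2) e^{|u|} and e^{|u|} <= 2 cosh u. *)
have cu : cosh u - 1 <= u ^+ 2 * cosh u.
  rewrite (cosh_double u) addrC addKr -(cosh_double u).
  have hu := norm_sinh_le (u / 2).
  have : sinh (u / 2) ^+ 2 <= (`|u / 2| * expR `|u / 2|) ^+ 2.
    have q0 := mulr_ge0 (normr_ge0 (u / 2)) (expR_ge0 `|u / 2|).
    by rewrite -(real_normK (num_real (sinh (u / 2)))) ler_pXn2r ?nnegrE.
  rewrite (exprMn 2 `|u / 2|) real_normK ?num_real// -expRM_natr.
  have -> : `|u / 2| * 2 = `|u|.
    by rewrite normrM (gtr0_norm (_ : 0 < 2^-1))// divfK.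
  have := ler_wpM2l (sqr_ge0 u) (cosh_le_exp u).
  rewrite expr_div_n; lra.
have ch1 : cosh h - 1 <= h ^+ 2 * A.
  have h2 : `|h / 2| <= 1 by rewrite normrM (gtr0_norm (_ : 0 < 2^-1))//; lra.
  have hA : 0 <= h ^+ 2 * A by rewrite mulr_ge0 ?sqr_ge0// ltW.
  have e4 : (h / 2) ^+ 2 * A = h ^+ 2 * A / 4 by field.
  have := sh _ h2; rewrite e4 (cosh_double h); lra.
have F1 : expR (- (z * cosh h)) * cosh u <= expR (- (k * z)).
  have := kle _ hB; have := kle (- h); rewrite normrN => /(_ hB).
  by rewrite E1 E2 /cosh; lra.
have F2 : expR (- z) <= expR (- (k * z)).
  by have := kle 0; rewrite normr0 ler01 addr0 => /(_ isT).
have F3 : `|expR (- (z * cosh h)) - expR (- z)| <= z * (h ^+ 2 * A) * expR (- (k * z)).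
  have m1 : k * z <= z by rewrite -[k * z]opprK -[z in leRHS]opprK lerN2 -ler_expR.
  have m2 : k * z <= z * cosh h by apply: le_trans m1 _; rewrite ler_peMr// ltW.
  apply: le_trans (expRN_diff_le m2 m1) _; rewrite ler_wpM2r ?expR_ge0//.
  have -> : z * cosh h - z = z * (cosh h - 1) by ring.
  have n0 : 0 <= z * (cosh h - 1) by apply: mulr_ge0; [exact: ltW|rewrite subr_ge0].
  by rewrite (ger0_norm n0); apply: ler_wpM2l => //; exact: ltW.
have Z1 := @zexp_le k z k0; have Z2 := @zzexp_le k z k0 (ltW z0).
have ek : expR (- (k / 2 * z)) = ecosh (k / 2 * l) y by rewrite /ecosh /z mulrA.
have k2 : 2 / k = 2 * expR 1 by rewrite /k expRN invrK.
rewrite ek k2 in Z1 Z2.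
have G1 : expR (- (z * cosh h)) * (cosh u - 1) <= z ^+ 2 * (h ^+ 2 * A) * expR (- (k * z)).
  apply: (@le_trans _ _ (u ^+ 2 * (expR (- (z * cosh h)) * cosh u))).
    by rewrite [leRHS]mulrCA ler_pM2l ?expR_gt0.
  by apply: ler_pM; rewrite ?sqr_ge0// mulr_ge0 ?expR_ge0// ltW// cosh_gt0.
have G0 : 0 <= expR (- (z * cosh h)) * (cosh u - 1) by rewrite mulr_ge0 ?expR_ge0// subr_ge0 cosh_ge1.
have -> : ecosh l (y + h) + ecosh l (y - h) - 2 * ecosh l y =
    2 * (expR (- (z * cosh h)) * (cosh u - 1)) + 2 * (expR (- (z * cosh h)) - expR (- z)).
  have eu : expR (- u) = 2 * cosh u - expR u by rewrite /cosh; field.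
  by rewrite E1 E2 eu /ecosh -/z; ring.
move: (expR (- (z * cosh h)) * (cosh u - 1)) (expR (- (z * cosh h)) - expR (- z)) F3 G0 G1 => M1 M2 F3 G0 G1.
apply: le_trans (ler_normD _ _) _; rewrite !normrM (ger0_norm G0) normr_nat.
have hA : 0 <= h ^+ 2 * A by rewrite mulr_ge0 ?sqr_ge0// ltW.
have H1 := ler_wpM2l hA Z1; have H2 := ler_wpM2l hA Z2.
lra.
Qed.

End ExpCoshBounds.

(** * Decay and smoothness of the function [gbessel] *)

Section GbesselBounds.
Context {R : realType}.
Implicit Types (x y h l z a b d : R).

Lemma gbesselE x y : gbessel x y = rint (fun d => ecosh (x * cosh d ^+ 2) y).
Proof. by congr rint; apply/funext => d; rewrite /ecosh mulrAC. Qed.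

Lemma rintegrable_ecosh x y : 0 < x -> rintegrable (fun d => ecosh (x * cosh d ^+ 2) y).
Proof.
move=> x0; rewrite (_ : (fun d => _) = (fun d => expR (- (x * cosh y * cosh d ^+ 2)))).
  exact: rintegrable_gbessel.
by apply/funext => d; rewrite /ecosh mulrAC.
Qed.

Lemma gbessel_ge0 x y : 0 <= gbessel x y.
Proof. by apply: rint_ge0 => d; exact: expR_ge0. Qed.

Lemma gbessel_decay x : 0 < x -> exists2 C, 0 <= C & forall y, gbessel x y <= C * expR (- `|y|).
Proof.
move=> x0; have x2 : 0 < x / 2 by rewrite divr_gt0.
have i1 := rintegrable_expcosh x2.
have I0 : 0 <= rint (fun d => expR (- (x / 2 * cosh d))) by apply: rint_ge0 => d; exact: expR_ge0.
exists (rint (fun d => expR (- (x / 2 * cosh d))) * (2 / (x / 2))).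
  by apply: mulr_ge0 => //; rewrite divr_ge0// ltW.
move=> y; rewrite -mulrA; apply: (@le_trans _ _ (rint (fun d => expR (- (x / 2 * cosh d))) * expR (- (x / 2 * cosh y)))); last first.
  by rewrite ler_wpM2l ?exp_cosh_decay.
rewrite mulrC -rintZ//; apply: le_rint.
- exact: rintegrable_gbessel.
- exact: rintegrableZ.
- by move=> d; rewrite [leRHS]mulrC; exact: expcosh_le.
Qed.

(** For a difference operator [D] that commutes with the integral over d, a bound on each [ecosh l]
    by the same shape at rate c l integrates to a bound by [gbessel] at c x. *)
Lemma gbessel_difference (D : (R -> R) -> R) (K c : R) x y : 0 < x -> 0 <= K -> 0 < c ->
  (forall l, 0 < l -> `|D (ecosh l)| <= K * ecosh (c * l) y) ->
  D (gbessel x) = rint (fun d => D (ecosh (x * cosh d ^+ 2))) ->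
  rintegrable (fun d => D (ecosh (x * cosh d ^+ 2))) ->
  `|D (gbessel x)| <= K * gbessel (c * x) y.
Proof.
move=> x0 K0 c0 DK DE Di; rewrite DE; apply: le_trans (le_norm_rint Di) _.
have cx : 0 < c * x by rewrite mulr_gt0.
have ie := @rintegrable_ecosh (c * x) y cx.
rewrite gbesselE -rintZ//; apply: le_rint.
- exact: rintegrable_norm.
- exact: rintegrableZ.
move=> d; rewrite -mulrA; apply: DK; rewrite mulr_gt0// exprn_gt0// cosh_gt0//.
Qed.

Lemma gbessel_lipschitz x B : 0 < x -> exists2 M, 0 <= M &
  forall y h, `|h| <= B -> `|gbessel x (y + h) - gbessel x y| <= M * `|h| * expR (- `|y|).
Proof.
move=> x0; set c := expR (- B) / 2; have c0 : 0 < c by rewrite divr_gt0 ?expR_gt0.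
have [C C0 hC] := gbessel_decay (mulr_gt0 c0 x0).
exists (2 * expR (B + B) * C); first by rewrite !mulr_ge0 ?expR_ge0.
move=> y h hB.
have K0 : 0 <= 2 * expR (B + B) * `|h| by rewrite !mulr_ge0 ?expR_ge0.
apply: le_trans (@gbessel_difference (fun f => f (y + h) - f y) _ c x y x0 K0 c0 _ _ _) _.
- by move=> l l0; exact: ecosh_lipschitz.
- by rewrite !gbesselE rintB//; exact: rintegrable_ecosh.
- by apply: rintegrableB; exact: rintegrable_ecosh.
have -> : 2 * expR (B + B) * C * `|h| * expR (- `|y|) = 2 * expR (B + B) * `|h| * (C * expR (- `|y|)) by ring.
by rewrite ler_wpM2l.
Qed.

Lemma gbessel_second_difference x : 0 < x -> exists2 M, 0 <= M &
  forall y h, `|h| <= 1 ->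
  `|gbessel x (y + h) + gbessel x (y - h) - 2 * gbessel x y| <= M * h ^+ 2 * expR (- `|y|).
Proof.
move=> x0; set c : R := expR (- 1) / 2; have c0 : 0 < c by rewrite divr_gt0 ?expR_gt0.
have [C C0 hC] := gbessel_decay (mulr_gt0 c0 x0).
pose A : R := 2 * expR 2 * (2 * (2 * expR 1) ^+ 2 + 2 * expR 1).
have A0 : 0 <= A by rewrite /A !(mulr_ge0, addr_ge0, exprn_ge0) ?expR_ge0.
exists (A * C); first by rewrite mulr_ge0.
move=> y h hB.
have K0 : 0 <= A * h ^+ 2 by rewrite mulr_ge0// sqr_ge0.
have ie z := @rintegrable_ecosh x z x0.
apply: le_trans (@gbessel_difference (fun f => f (y + h) + f (y - h) - 2 * f y) _ c x y x0 K0 c0 _ _ _) _.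
- by move=> l l0; exact: ecosh_second_difference.
- by rewrite !gbesselE -rintZ// -rintD// -rintB//; [exact: rintegrableD|exact: rintegrableZ].
- by apply: rintegrableB; [exact: rintegrableD|exact: rintegrableZ].
have -> : A * C * h ^+ 2 * expR (- `|y|) = A * h ^+ 2 * (C * expR (- `|y|)) by ring.
by rewrite ler_wpM2l.
Qed.

End GbesselBounds.

(** * The Cauchy density and the Abel kernel *)

Section LineKernels.
Context {R : realType}.
Local Notation leb := (@lebesgue_measure R).
Implicit Types (x y h s t u w e : R).

Lemma rint_even (f : R -> R) (r : R) : (forall y, 0 <= f y) -> continuous f ->
  (forall y, f (- y) = f y) ->
  (\int[leb]_(y in `[0%R, +oo[) (f y)%:E = r%:E)%E ->
  rintegrable f /\ rint f = 2 * r.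
Proof.
move=> f0 cf ef fr.
have := ge0_symfun_integralT f0 cf (fun y => esym (ef y)).
have -> : [set y | 0 <= y] = `[0, +oo[%classic :> set R.
  by apply/seteqP; split => y /=; rewrite in_itv/= andbT.
rewrite fr => E; split; last by rewrite /rint /Rintegral E.
apply: rintegrableP; first exact: continuous_measurable_fun.
have -> : (\int[leb]_u `|(f u)%:E| = \int[leb]_u (f u)%:E)%E.
  by apply: eq_integral => u _; rewrite /= ger0_norm.
by rewrite E ltry.
Qed.

Lemma rint_cauchy : rintegrable (fun w : R => (1 + w ^+ 2)^-1) /\
  rint (fun w : R => (1 + w ^+ 2)^-1) = pi.
Proof.
have -> : pi = 2 * (pi / 2) :> R by rewrite mulrC divfK.
apply: rint_even.
- by move=> y; rewrite invr_ge0 addr_ge0// sqr_ge0.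
- exact: continuous_oneDsqrV.
- by move=> y; rewrite sqrrN.
- exact: integral0y_oneDsqr.
Qed.

(** The transform of e^{-e|s|} is a multiple of the Poisson kernel, computed from an explicit
    antiderivative on the half-line. *)
Lemma abel_kernel e w : 0 < e ->
  rint (fun s => expR (- e * `|s|) * cos (w * s)) = 2 * (e / (e ^+ 2 + w ^+ 2)).
Proof.
move=> e0; have ew : 0 < e ^+ 2 + w ^+ 2 by rewrite ltr_wpDr ?sqr_ge0// exprn_gt0.
have ce : continuous (fun s : R => expR (- e * `|s|)).
  move=> s; apply: continuous_comp; last exact: continuous_expR.
  by apply: cvgM; [exact: cvg_cst|exact: norm_continuous].
have cw v : continuous (fun s : R => cos (v * s)).
  move=> s; apply: continuous_comp; last exact: continuous_cos.
  by apply: cvgM; [exact: cvg_cst|exact: cvg_id].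
(* Adding 1 to the cosine makes the integrand nonnegative, so the half-line fundamental theorem for
   nonnegative functions applies; the cosine alone is recovered by subtracting half of the case v =
   0. *)
pose f v s := expR (- e * `|s|) * (1 + cos (v * s)).
have main v : rintegrable (f v) /\ rint (f v) = 2 * (e^-1 + e / (e ^+ 2 + v ^+ 2)).
  have ev : 0 < e ^+ 2 + v ^+ 2 by rewrite ltr_wpDr ?sqr_ge0// exprn_gt0.
  apply: rint_even.
  - by move=> s; rewrite mulr_ge0 ?expR_ge0//; have := cos_geN1 (v * s); lra.
  - by move=> s; apply: cvgM; [exact: ce|apply: cvgD; [exact: cvg_cst|exact: cw]].
  - by move=> s; rewrite /f normrN mulrN cosN.
  pose f1 (s : R) := expR (- e * s) * (1 + cos (v * s)).
  pose F (s : R) := - (e^-1 * (expR (- e * s) * cos (0 * s))) +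
    (v / (e ^+ 2 + v ^+ 2) * (expR (- e * s) * sin (v * s)) -
      e / (e ^+ 2 + v ^+ 2) * (expR (- e * s) * cos (v * s))).
  have dF (s : R) : is_derive s 1 F (f1 s).
    have d1 : is_derive s 1 (fun u : R => - e * u) (- e).
      by apply: is_derive_eq; rewrite /GRing.scale /= mulr1.
    have d2 : is_derive s 1 (fun u : R => v * u) v.
      by apply: is_derive_eq; rewrite /GRing.scale /= mulr1.
    have d3 : is_derive s 1 (fun u : R => 0 * u) 0.
      by apply: is_derive_eq; rewrite /GRing.scale /= mulr1.
    have a1 := is_derive_expcos d1 d3; have a2 := is_derive_expcos d1 d2.
    have a3 := is_derive_expsin d1 d2.
    apply: is_derive_eq; rewrite /GRing.scale /= mul0r cos0 /f1; field.
    by rewrite !gt_eqF.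
  have cF : continuous F.
    move=> s; apply: differentiable_continuous; apply/derivable1_diffP.
    by have [] := dF s.
  have xe : expR (- e * s) @[s --> +oo%R] --> 0.
    under eq_fun do rewrite mulNr.
    apply: (@cvg_comp _ _ _ (fun x => e * x) (fun x => expR (- x)) _ +oo%R).
      by apply: gt0_cvgMry => //; exact: cvg_id.
    exact: cvgr_expR.
  have bd (g : R -> R) : (forall s, `|g s| <= 1) -> expR (- e * s) * g s @[s --> +oo%R] --> 0.
    move=> g1; have xe' : - expR (- e * s) @[s --> +oo%R] --> 0 by rewrite -oppr0; exact: cvgN.
    apply: (squeeze_cvgr _ xe' xe); apply: nearW => s.
    by rewrite -ler_norml normrM ger0_norm ?expR_ge0// ler_piMr ?expR_ge0.
  have cos1 c t : `|cos (c * t)| <= 1 by rewrite ler_norml cos_geN1 cos_le1.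
  have sin1 c t : `|sin (c * t)| <= 1 by rewrite ler_norml sin_geN1 sin_le1.
  have -> : (\int[leb]_(y in `[0%R, +oo[) (f v y)%:E = \int[leb]_(y in `[0%R, +oo[) (f1 y)%:E)%E.
    by apply: eq_integral => x; rewrite inE/= in_itv/= andbT => x0; rewrite /f ger0_norm.
  rewrite (@ge0_continuous_FTC2y _ _ F 0 0)//.
  - rewrite sub0e -EFinN /F !mulr0 expR0 sin0 cos0; congr (_%:E); ring.
  - by move=> x _; rewrite /f1 mulr_ge0 ?expR_ge0//; have := cos_geN1 (v * x); lra.
  - apply: continuous_subspaceT => x; apply: cvgM; last by apply: cvgD; [exact: cvg_cst|exact: cw].
    apply: continuous_comp; last exact: continuous_expR.
    by apply: cvgM; [exact: cvg_cst|exact: cvg_id].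
  - rewrite (_ : 0 = - (e^-1 * 0) + (v / (e ^+ 2 + v ^+ 2) * 0 - e / (e ^+ 2 + v ^+ 2) * 0)); last by ring.
    apply: cvgD; first by apply: cvgN; apply: cvgM; [exact: cvg_cst|exact: bd].
    by apply: cvgB; apply: cvgM; [exact: cvg_cst|exact: bd|exact: cvg_cst|exact: bd].
  - by apply: cvg_at_right_filter; exact: cF.
  - by move=> x _; rewrite derive1E; apply: derive_val.
have [i1 r1] := main w; have [i0 r0] := main 0.
have e2 : (fun s => expR (- e * `|s|)) = (fun s => 2^-1 * f 0 s).
  by apply/funext => s; rewrite /f mul0r cos0; field.
have -> : (fun s => expR (- e * `|s|) * cos (w * s)) = (fun s => f w s - 2^-1 * f 0 s).
  by apply/funext => s; rewrite /f mul0r cos0; field.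
rewrite rintB//; last exact: rintegrableZ.
rewrite rintZ// r1 r0 expr0n addr0; field.
by rewrite !gt_eqF.
Qed.

End LineKernels.

(** * Cosine transforms of even, decaying, smooth functions; inversion *)

Section CosineTransform.
Context {R : realType}.
Local Notation RR := (measurableTypeR R * measurableTypeR R)%type.
Implicit Types (x y h s t u w e : R).

Definition cosine_transform (G : R -> R) s : R := rint (fun y => G y * cos (s * y)).

Variables (G : R -> R).
Hypothesis GN : forall y, G (- y) = G y.
Hypothesis Gd : exists2 C : R, 0 <= C & forall y, `|G y| <= C * expR (- `|y|).
Hypothesis GL : forall B : R, exists2 M : R, 0 <= M &
  forall y h, `|h| <= B -> `|G (y + h) - G y| <= M * `|h| * expR (- `|y|).
Hypothesis GS : exists2 M : R, 0 <= M & forall y h, `|h| <= 1 ->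
  `|G (y + h) + G (y - h) - 2 * G y| <= M * h ^+ 2 * expR (- `|y|).
Local Notation H := (cosine_transform G).

Lemma cosine_continuous w : continuous (fun s : R => cos (w * s)).
Proof.
move=> s; apply: continuous_comp; last exact: continuous_cos.
by apply: cvgM; [exact: cvg_cst|exact: cvg_id].
Qed.

Lemma sine_continuous w : continuous (fun s : R => sin (w * s)).
Proof.
move=> s; apply: continuous_comp; last exact: continuous_sin.
by apply: cvgM; [exact: cvg_cst|exact: cvg_id].
Qed.

Lemma norm_cos_le1 t : `|cos t| <= 1. Proof. by rewrite ler_norml cos_geN1 cos_le1. Qed.
Lemma norm_sin_le1 t : `|sin t| <= 1. Proof. by rewrite ler_norml sin_geN1 sin_le1. Qed.

Lemma lipschitz_continuous (f : R -> R) M : 0 <= M ->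
  (forall y h, `|h| <= 1 -> `|f (y + h) - f y| <= M * `|h|) -> continuous f.
Proof.
move=> M0 fM y; apply/cvgrPdist_le => e e0.
have nr d : 0 < d -> \forall z \near y, `|z - y| <= d.
  have : (fun z : R => z) z @[z --> y] --> y by exact: cvg_id.
  by move=> /cvgrPdistC_le; exact.
near=> z.
have z1 : `|z - y| <= 1 by near: z; exact: nr.
have z2 : `|z - y| <= e / (M + 1).
  by near: z; apply: nr; rewrite divr_gt0// ltr_wpDl.
have := fM y (z - y) z1; rewrite (addrC y) subrK distrC => /le_trans; apply.
apply: le_trans (ler_wpM2l M0 z2) _.
rewrite mulrA ler_pdivrMr ?ltr_wpDl// mulrC ler_pM2l//; lra.
Unshelve. all: by end_near. Qed.

Lemma G_continuous : continuous G.
Proof.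
have [M M0 hM] := GL 1; apply: (lipschitz_continuous M0) => y h h1.
by apply: le_trans (hM y h h1) _; rewrite ler_piMr ?mulr_ge0.
Qed.

Lemma Gf_integrable (f : R -> R) : measurable_fun setT f -> (forall y, `|f y| <= 1) ->
  rintegrable (fun y => G y * f y).
Proof.
move=> mf f1; have [C C0 hC] := Gd.
apply: (@rintegrable_expdecay _ _ C 1) => //.
  by apply: measurable_funM => //; apply: continuous_measurable_fun; exact: G_continuous.
move=> u; rewrite normrM mulN1r; apply: le_trans (hC u).
by rewrite ler_piMr.
Qed.

Lemma Gcos_integrable s : rintegrable (fun y => G y * cos (s * y)).
Proof.
apply: Gf_integrable => [|y]; last exact: norm_cos_le1.
by apply: continuous_measurable_fun; exact: cosine_continuous.
Qed.

Lemma Gsin_integrable s : rintegrable (fun y => G y * sin (s * y)).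
Proof.
apply: Gf_integrable => [|y]; last exact: norm_sin_le1.
by apply: continuous_measurable_fun; exact: sine_continuous.
Qed.

(** After expansion of cos(s(u - y)), the sine term vanishes by evenness of G. *)
Lemma cosine_transform_shift y s : 
  rintegrable (fun u => G (y + u) * cos (s * u)) /\
  rint (fun u => G (y + u) * cos (s * u)) = H s * cos (s * y).
Proof.
have i1 := Gcos_integrable s; have i2 := Gsin_integrable s.
pose f u := cos (s * y) * (G u * cos (s * u)) + sin (s * y) * (G u * sin (s * u)).
have fi : rintegrable f by apply: rintegrableD; exact: rintegrableZ.
have e u : f (1 * u + y) = G (y + u) * cos (s * u).
  rewrite /f mul1r (addrC u); have -> : s * u = s * (y + u) - s * y by ring.
  by rewrite cosB; ring.
have E := rint_affine y (oner_neq0 R) fi.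
have I := rintegrable_affine y (oner_neq0 R) fi.
rewrite (funext e) in E I; split; first exact: I.
move: E; rewrite normr1 mul1r => <-.
rewrite rintD; [|exact: rintegrableZ|exact: rintegrableZ].
rewrite !rintZ// (rint_odd i2) ?mulr0 ?addr0 1?mulrC//.
by move=> u; rewrite GN mulrN sinN mulrN.
Qed.

(** The second difference of G with step h = pi/s has transform -4 H(s) and is O(h^2), so H(s) is
    O(1/s^2) for |s| >= pi. Below pi the trivial bound is enough. *)
Lemma cosine_transform_decay : exists2 K : R, 0 <= K & forall s, `|H s| <= K * (1 + s ^+ 2)^-1.
Proof.
have [M M0 hM] := GS; have [C C0 hC] := Gd.
have ei : rintegrable (fun u : R => expR (- `|u|)).
  by have := @rintegrable_expabs R 1 ltr01; under eq_fun do rewrite mulN1r.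
set J := rint (fun u : R => expR (- `|u|)).
have J0 : 0 <= J by apply: rint_ge0 => u; exact: expR_ge0.
have p0 : 0 < pi :> R by exact: pi_gt0.
have p2 : 2 <= pi :> R by exact: pi_ge2.
have b1 s : `|H s| <= C * J.
  apply: le_trans (le_norm_rint (Gcos_integrable s)) _; rewrite -rintZ//; apply: le_rint.
  - by apply: rintegrable_norm; exact: Gcos_integrable.
  - exact: rintegrableZ.
  move=> u; rewrite normrM; apply: le_trans (hC u); rewrite ler_piMr//; exact: norm_cos_le1.
have b2 s : pi <= `|s| -> 4 * `|H s| <= M * (pi / s) ^+ 2 * J.
  move=> sp; have s0 : s != 0 by rewrite -normr_gt0; exact: lt_le_trans sp.
  (* With s h = pi, each of the two translates contributes H(s) cos(pi) = -H(s). *)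
  set h := pi / s; have h1 : `|h| <= 1.
    by rewrite normrM normfV ler_pdivrMr ?normr_gt0// mul1r gtr0_norm.
  have sh : s * h = pi by rewrite /h mulrC divfK.
  have [i1] := cosine_transform_shift h s; rewrite sh cospi mulrN1 => r1.
  have [i2] := cosine_transform_shift (- h) s; rewrite mulrN sh cosN cospi mulrN1 => r2.
  have i3 := Gcos_integrable s.
  have e u : G (h + u) * cos (s * u) + G (- h + u) * cos (s * u) - 2 * (G u * cos (s * u)) =
     (G (u + h) + G (u - h) - 2 * G u) * cos (s * u).
    by rewrite (addrC h) (addrC (- h)); ring.
  have i4 : rintegrable (fun u => (G (u + h) + G (u - h) - 2 * G u) * cos (s * u)).
    rewrite -(funext e); apply: rintegrableB; first exact: rintegrableD.
    exact: rintegrableZ.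
  have : rint (fun u => (G (u + h) + G (u - h) - 2 * G u) * cos (s * u)) = - (4 * H s).
    rewrite -(funext e) rintB; [|exact: rintegrableD|exact: rintegrableZ].
    by rewrite rintD// rintZ// r1 r2 /cosine_transform; ring.
  move=> /(congr1 Num.norm); rewrite normrN normrM normr_nat => <-.
  apply: le_trans (le_norm_rint i4) _; rewrite -rintZ//; apply: le_rint.
  - exact: rintegrable_norm.
  - exact: rintegrableZ.
  move=> u; rewrite normrM; apply: le_trans (hM u h h1); rewrite ler_piMr//; exact: norm_cos_le1.
exists (C * J * (1 + pi ^+ 2) + M * pi ^+ 2 * J).
  have pp : 0 <= pi ^+ 2 :> R by exact: sqr_ge0.
  have CJ : 0 <= C * J by exact: mulr_ge0.
  have MP : 0 <= M * pi ^+ 2 * J by apply: mulr_ge0 => //; exact: mulr_ge0.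
  by apply: addr_ge0 => //; apply: mulr_ge0 => //; exact: addr_ge0.
move=> s; have s1 : 0 < 1 + s ^+ 2 by rewrite ltr_pwDl// sqr_ge0.
rewrite ler_pdivlMr//.
have MJ : 0 <= M * pi ^+ 2 * J by apply: mulr_ge0 => //; apply: mulr_ge0 => //; exact: sqr_ge0.
have [sp|sp] := leP pi `|s|.
  have s0 : s != 0 by rewrite -normr_gt0; exact: lt_le_trans sp.
  have s2 : 0 < s ^+ 2 by rewrite exprn_even_gt0.
  have := ler_wpM2r (ltW s2) (b2 s sp).
  have -> : M * (pi / s) ^+ 2 * J * s ^+ 2 = M * pi ^+ 2 * J by field.
  have := b1 s; have : 0 <= C * J * pi ^+ 2 by apply: mulr_ge0; [exact: mulr_ge0|exact: sqr_ge0].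
  move: (M * pi ^+ 2 * J) MJ => MJ; nra.
have s2 : s ^+ 2 <= pi ^+ 2.
  by rewrite -(real_normK (num_real s)) ler_pXn2r ?nnegrE// ltW.
have h1 : `|H s| * (1 + s ^+ 2) <= C * J * (1 + pi ^+ 2).
  by apply: (ler_pM (normr_ge0 _) (ltW s1) (b1 s)); rewrite lerD2l.
lra.
Qed.

Lemma cosine_transform_continuous : continuous H.
Proof.
have [C C0 hC] := Gd.
have ei : rintegrable (fun u : R => expR (- (1 / 2) * `|u|)) by apply: rintegrable_expabs.
set J := rint (fun u : R => expR (- (1 / 2) * `|u|)).
have J0 : 0 <= J by apply: rint_ge0 => u; exact: expR_ge0.
have M0 : 0 <= 2 * C * J by rewrite !mulr_ge0.
apply: (lipschitz_continuous M0) => s h _.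
have i1 := Gcos_integrable (s + h); have i2 := Gcos_integrable s.
rewrite /cosine_transform -rintB//.
have i3 := rintegrableB i1 i2.
apply: le_trans (le_norm_rint i3) _.
have -> : 2 * C * J * `|h| = 2 * C * `|h| * J by ring.
rewrite -rintZ//; apply: le_rint; [exact: rintegrable_norm|exact: rintegrableZ|].
move=> u; rewrite -mulrBr normrM.
have -> : cos ((s + h) * u) - cos (s * u) = - (2 * (sin (s * u + h * u / 2) * sin (h * u / 2))).
  have -> : (s + h) * u = (s * u + h * u / 2) + h * u / 2 by field.
  have -> : cos (s * u) = cos ((s * u + h * u / 2) - h * u / 2) by congr cos; ring.
  by rewrite cosD cosB; ring.
have h1 : `|sin (h * u / 2)| <= `|h| * `|u| / 2.
  by apply: le_trans (norm_sin_le _) _; rewrite !normrM (gtr0_norm (_ : 0 < 2^-1)).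
have h2 : `|sin (s * u + h * u / 2) * sin (h * u / 2)| <= `|h| * `|u| / 2.
  by rewrite normrM; apply: le_trans h1; rewrite ler_piMl//; exact: norm_sin_le1.
rewrite normrN normrM normr_nat.
apply: (@le_trans _ _ (C * expR (- `|u|) * (`|h| * `|u|))).
  by apply: ler_pM; rewrite ?mulr_ge0//; lra.
have := @zexp_le R 1 `|u| ltr01; rewrite mul1r divr1.
have -> : - (1 / 2 * `|u|) = - (1 / 2) * `|u| by rewrite mulNr.
by move=> /(ler_wpM2l (mulr_ge0 C0 (normr_ge0 h))); lra.
Qed.

Lemma cosine_transform_bounded_integrable (f : R -> R) : measurable_fun setT f ->
  (forall s, `|f s| <= 1) -> rintegrable (fun s => H s * f s).
Proof.
move=> mf f1; have [K K0 hK] := cosine_transform_decay.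
apply: (rintegrable_le _ _ (rintegrableZ K rint_cauchy.1)).
  by apply: measurable_funM => //; apply: continuous_measurable_fun; exact: cosine_transform_continuous.
by move=> s; rewrite normrM; apply: le_trans (hK s); rewrite ler_piMr.
Qed.

Lemma cosine_transform_integrable y : rintegrable (fun s => H s * cos (s * y)).
Proof.
apply: cosine_transform_bounded_integrable => [|s]; last exact: norm_cos_le1.
apply: continuous_measurable_fun.
have -> : (fun s : R => cos (s * y)) = (fun s => cos (y * s)) by apply/funext => s; rewrite mulrC.
exact: cosine_continuous.
Qed.

Lemma sine_transform_integrable y : rintegrable (fun s => H s * sin (s * y)).
Proof.
apply: cosine_transform_bounded_integrable => [|s]; last exact: norm_sin_le1.
apply: continuous_measurable_fun.
have -> : (fun s : R => sin (s * y)) = (fun s => sin (y * s)) by apply/funext => s; rewrite mulrC.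
exact: sine_continuous.
Qed.

Lemma cosine_transformN s : H (- s) = H s.
Proof. by congr rint; apply/funext => y; rewrite mulNr cosN. Qed.

(** The damping e^{-e|s|} allows Fubini; the inner integral over s is [abel_kernel], and the scaling
    u = e w turns the Poisson kernel into the fixed Cauchy density. *)
Lemma abel_integral e y : 0 < e ->
  rint (fun s => expR (- e * `|s|) * (H s * cos (s * y))) =
  rint (fun w => 2 * G (y + e * w) * (1 + w ^+ 2)^-1).
Proof.
move=> e0; have e1 : e != 0 by rewrite gt_eqF.
pose F s u := expR (- e * `|s|) * (G (y + u) * cos (s * u)).
have ce : continuous (fun s : R => expR (- e * `|s|)).
  move=> s; apply: continuous_comp; last exact: continuous_expR.
  by apply: cvgM; [exact: cvg_cst|exact: norm_continuous].
have ie : rintegrable (fun s : R => expR (- e * `|s|)) by exact: rintegrable_expabs.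
have iG : rintegrable (fun u => `|G (y + u)|).
  have [C C0 hC] := Gd.
  have iG0 : rintegrable G.
    apply: (@rintegrable_expdecay _ _ C 1) => //.
      by apply: continuous_measurable_fun; exact: G_continuous.
    by move=> u; rewrite mulN1r.
  have := rintegrable_norm (rintegrable_affine y (oner_neq0 R) iG0).
  by under eq_fun do rewrite mul1r addrC.
have mF : measurable_fun setT (fun p : RR => F p.1 p.2).
  have m1 : measurable_fun setT (fun p : RR => p.1 : R) by exact: measurable_fst.
  have m2 : measurable_fun setT (fun p : RR => p.2 : R) by exact: measurable_snd.
  apply: measurable_funM.
    by apply: (measurableT_comp (continuous_measurable_fun ce) m1).
  apply: measurable_funM.
    apply: (measurableT_comp (continuous_measurable_fun G_continuous)).
    by apply: measurable_funD.
  apply: (measurableT_comp (continuous_measurable_fun (@continuous_cos R))).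
  exact: measurable_funM.
have [|||_ I E] := @rint_fubini R F (fun s u => expR (- e * `|s|) * `|G (y + u)|) mF.
- by move=> s; exact: rintegrableZ.
- under eq_fun do rewrite rintZ// mulrC.
  exact: rintegrableZ.
- move=> s u; rewrite !normrM ger0_norm ?expR_ge0// ler_wpM2l ?expR_ge0//.
  by rewrite ler_piMr//; exact: norm_cos_le1.
have l s : rint (F s) = expR (- e * `|s|) * (H s * cos (s * y)).
  have [i r] := cosine_transform_shift y s.
  by rewrite /F rintZ// r.
have ik u : rintegrable (fun s : R => expR (- e * `|s|) * cos (u * s)).
  apply: (rintegrable_le _ _ ie).
    by apply: continuous_measurable_fun => s; apply: cvgM; [exact: ce|exact: cosine_continuous].
  by move=> s; rewrite normrM ger0_norm ?expR_ge0// ler_piMr ?expR_ge0//; exact: norm_cos_le1.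
have r u : rint (F^~ u) = G (y + u) * (2 * (e / (e ^+ 2 + u ^+ 2))).
  rewrite -abel_kernel// -rintZ//; congr rint; apply/funext => s.
  by rewrite /F (mulrC u); ring.
rewrite -(funext l) E (funext r); rewrite (funext r) in I.
have E2 := rint_affine 0 e1 I; rewrite gtr0_norm// in E2.
have E3 := rintZ e (rintegrable_affine 0 e1 I).
apply: (etrans E2); apply: (etrans (esym E3)).
congr rint; apply/funext => w; rewrite addr0 exprMn.
have w1 : 1 + w ^+ 2 != 0 by rewrite gt_eqF// ltr_pwDl// sqr_ge0.
have -> : e ^+ 2 + e ^+ 2 * w ^+ 2 = e ^+ 2 * (1 + w ^+ 2) by ring.
by field; rewrite w1 e1.
Qed.

(** Let e -> 0 in [abel_integral], by dominated convergence on both sides: H is integrable, and G is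
    bounded and continuous. The Cauchy density has mass pi. *)
Lemma cosine_inversion y : rint (fun s => H s * cos (s * y)) = 2 * pi * G y.
Proof.
pose e (n : nat) : R := n.+1%:R^-1.
have e0 n : 0 < e n by rewrite invr_gt0.
have ecvg : e n @[n --> \oo] --> 0 by exact: cvg_harmonic.
have [C C0 hC] := Gd.
have hC' u : `|G u| <= C by apply: le_trans (hC u) _; rewrite ler_piMr.
have iH := cosine_transform_integrable y.
have mH : measurable_fun setT (fun s => H s * cos (s * y)) by exact: rintegrable_meas iH.
have [||n s|_ c1] := @rint_dominated R (fun n s => expR (- e n * `|s|) * (H s * cos (s * y)))
   (fun s => H s * cos (s * y)) (fun s => `|H s * cos (s * y)|) _ _ _ (rintegrable_norm iH).
- move=> n; apply: measurable_funM => //; apply: continuous_measurable_fun => s.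
  apply: continuous_comp; last exact: continuous_expR.
  by apply: cvgM; [exact: cvg_cst|exact: norm_continuous].
- move=> s; rewrite -[X in _ --> X]mul1r; apply: cvgM; last exact: cvg_cst.
  rewrite -expR0 -(mul0r `|s|) -oppr0; apply: continuous_cvg; first exact: continuous_expR.
  by apply: cvgM; [exact: cvgN|exact: cvg_cst].
- rewrite normrM ger0_norm ?expR_ge0// ler_piMl// -[leRHS]expR0 ler_expR.
  by rewrite mulNr oppr_le0 mulr_ge0// ltW.
have [||n w|_ c2] := @rint_dominated R (fun n w => 2 * G (y + e n * w) * (1 + w ^+ 2)^-1)
   (fun w => 2 * G y * (1 + w ^+ 2)^-1) (fun w => 2 * C * (1 + w ^+ 2)^-1) _ _ _ (rintegrableZ _ rint_cauchy.1).
- move=> n; apply: measurable_funM; last by apply: continuous_measurable_fun; exact: continuous_oneDsqrV.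
  apply: measurable_funM => //.
  apply: (measurableT_comp (continuous_measurable_fun G_continuous)).
  by apply: measurable_funD => //; apply: measurable_funM.
- move=> w; apply: cvgM; last exact: cvg_cst.
  apply: cvgM; first exact: cvg_cst.
  rewrite -[X in G X]addr0 -(mul0r w); apply: continuous_cvg; first exact: G_continuous.
  by apply: cvgD; [exact: cvg_cst|apply: cvgM => //; exact: cvg_cst].
- have w1 : 0 <= (1 + w ^+ 2)^-1 by rewrite invr_ge0 addr_ge0// sqr_ge0.
  rewrite !normrM normr_nat (ger0_norm w1) ler_wpM2r// ler_wpM2l//.
rewrite (funext (fun n => abel_integral y (e0 n))) in c1.
transitivity (rint (fun w => 2 * G y * (1 + w ^+ 2)^-1)); first by apply: (cvg_unique _ c1 c2).
rewrite rintZ; last exact: rint_cauchy.1.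
by rewrite rint_cauchy.2; ring.
Qed.

End CosineTransform.

(** * Dirichlet and Fejer kernels *)

Section FejerKernel.
Context {R : realType}.
Implicit Types (t : R) (N j k : nat).

Definition dirichlet_kernel j t : R := 1 + 2 * \sum_(1 <= k < j.+1) cos (k%:R * t).
Definition fejer_kernel N t : R :=
  N.+1%:R^-1 * \sum_(0 <= j < N.+1) dirichlet_kernel j t.

(** Multiplied by 1 - cos t the kernel telescopes; summed once more this gives the closed form of
    the Fejer kernel without a division. *)
Lemma dirichlet_kernelM j t :
  (1 - cos t) * dirichlet_kernel j t = cos (j%:R * t) - cos (j.+1%:R * t).
Proof.
elim: j => [|j IH].
  by rewrite /dirichlet_kernel big_geq// mulr0 addr0 mulr1 mul0r cos0 mul1r.
have -> : dirichlet_kernel j.+1 t = dirichlet_kernel j t + 2 * cos (j.+1%:R * t).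
  by rewrite /dirichlet_kernel big_nat_recr//= mulrDr addrA.
rewrite mulrDr IH.
have e1 : j.+2%:R * t = j.+1%:R * t + t by rewrite -[j.+2]addn1 natrD mulrDl mul1r.
have e2 : j%:R * t = j.+1%:R * t - t by rewrite -[j.+1]addn1 natrD mulrDl mul1r addrK.
by rewrite e1 e2 [cos (_ - t)]cosB cosD; ring.
Qed.

Lemma fejer_kernelM N t :
  (1 - cos t) * fejer_kernel N t = N.+1%:R^-1 * (1 - cos (N.+1%:R * t)).
Proof.
rewrite /fejer_kernel mulrCA; congr (_ * _); rewrite mulr_sumr.
under eq_bigr do rewrite dirichlet_kernelM.
elim: N => [|N IH]; first by rewrite big_nat1 mul0r cos0.
by rewrite big_nat_recr//= IH; ring.
Qed.

(** Where cos t < 1, positivity is read off [fejer_kernelM]; where cos t = 1, all the cosines in the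
    sum equal 1. *)
Lemma fejer_kernel_ge0 N t : 0 <= fejer_kernel N t.
Proof.
have [c1|c1] := eqVneq (cos t) 1; last first.
  have c0 : 0 < 1 - cos t by rewrite subr_gt0 lt_neqAle c1 cos_le1.
  by rewrite -(pmulr_rge0 _ c0) fejer_kernelM mulr_ge0 ?invr_ge0// subr_ge0 cos_le1.
have s0 : sin t = 0.
  by apply/eqP; rewrite -sqrf_eq0 sin2cos2 c1 expr1n subrr.
have ck k : cos (k%:R * t) = 1 /\ sin (k%:R * t) = 0.
  elim: k => [|k [h1 h2]]; first by rewrite mul0r cos0 sin0.
  by rewrite -[k.+1]addn1 natrD mulrDl mul1r cosD sinD h1 h2 c1 s0 !(mulr0, mul0r, mul1r, subr0, addr0).
rewrite mulr_ge0 ?invr_ge0// sumr_ge0// => j _; rewrite addr_ge0// mulr_ge0//.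
by rewrite sumr_ge0// => k _; rewrite (ck k).1.
Qed.

Lemma sin_ge_half t : 0 <= t <= 1 -> t / 2 <= sin t.
Proof.
move=> /andP[]; rewrite le_eqVlt => /predU1P[<- _|t0 t1]; first by rewrite mul0r sin0.
have [|c] := @MVT R sin cos 0 t t0.
  by apply: continuous_subspaceT; exact: continuous_sin.
rewrite in_itv/= sin0 !subr0 => /andP[c0 ct] ->.
have := cos_ge c; have : c ^+ 2 <= 1 by rewrite expr_le1 ?ltW//; lra.
by move=> h1 h2; rewrite mulrC ler_pM2r//; lra.
Qed.

(** For s = |t| <= 4, sin(s/4) >= s/8 and cos(s/4) >= 1/2 give sin(s/2) >= s/8, and 1 - cos s = 2
    sin^2(s/2) >= s^2/32. *)
Lemma sqr_le_cos t : `|t| <= pi -> t ^+ 2 <= 32 * (1 - cos t).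
Proof.
move=> tp; have p4 : pi <= 4 :> R by have := @pihalf_lt2 R; lra.
have -> : cos t = cos (`|t| / 2 + `|t| / 2).
  rewrite -splitr; case: (ger0P t) => // _; by rewrite cosN.
rewrite -(real_normK (num_real t)); move: `|t| (normr_ge0 t) tp => s s0 sp.
have h4 : s / 4 / 2 <= sin (s / 4) by apply: sin_ge_half; apply/andP; split; lra.
have c4 : 1 / 2 <= cos (s / 4).
  have := cos_ge (s / 4); have : (s / 4) ^+ 2 <= 1 by apply: exprn_ile1; lra.
  by move: ((s / 4) ^+ 2) => q; lra.
have h2 : s / 8 <= sin (s / 2).
  have -> : s / 2 = s / 4 + s / 4 by field.
  have : s / 8 * (1 / 2) <= sin (s / 4) * cos (s / 4) by apply: ler_pM; lra.
  by rewrite sinD; lra.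
rewrite cosD -!expr2 (cos2sin2 (s / 2)).
have : (s / 8) ^+ 2 <= sin (s / 2) ^+ 2 by rewrite ler_pXn2r ?nnegrE//; lra.
have -> : (s / 8) ^+ 2 = s ^+ 2 / 64 by field.
lra.
Qed.

End FejerKernel.

(** * Splitting the line into periods *)

Section Windows.
Context {R : realType}.
Local Notation leb := (@lebesgue_measure R).
Implicit Types (a b c t y : R) (f : R -> R).

(** Half-open intervals, so that translates by the period tile the line without overlap. *)
Definition window a b y : R := ((a <= y) && (y < b))%:R.

Lemma windowE a b : window a b = \1_(`[a, b[%classic).
Proof. by apply/funext => y; rewrite indicE mem_setE in_itv. Qed.

Lemma window_measurable a b : measurable_fun setT (window a b).
Proof. by rewrite windowE; apply: measurable_indic; exact: measurable_itv. Qed.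

Lemma window_ge0 a b y : 0 <= window a b y. Proof. by rewrite ler0n. Qed.
Lemma window_le1 a b y : window a b y <= 1. Proof. by rewrite /window; case: (_ && _). Qed.

Lemma window_norm_le1 a b y : `|window a b y| <= 1.
Proof. by rewrite ger0_norm ?window_ge0// window_le1. Qed.

Lemma windowD a b c y : a <= b -> b <= c -> window a b y + window b c y = window a c y.
Proof.
move=> ab bc; rewrite /window; have [yb|yb] := ltP y b.
  by rewrite andbT andFb addr0 (lt_le_trans yb bc) andbT.
by rewrite andbF andTb add0r (le_trans ab yb).
Qed.

Lemma window_shift a b t y : window a b (y - t) = window (a + t) (b + t) y.
Proof. by rewrite /window lerBrDr ltrBlDr. Qed.

Lemma windowM_integrable a b f : rintegrable f -> rintegrable (fun y => window a b y * f y).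
Proof.
move=> fi; apply: (rintegrable_le _ _ (rintegrable_norm fi)).
  by apply: measurable_funM; [exact: window_measurable|exact: rintegrable_meas fi].
by move=> y; rewrite normrM ler_piMl// window_norm_le1.
Qed.

Lemma windowM_shift a b t f : rintegrable f ->
  rint (fun y => window a b y * f (y + t)) = rint (fun y => window (a + t) (b + t) y * f y).
Proof.
move=> fi; have i := windowM_integrable (a + t) (b + t) fi.
rewrite (rint_affine t (oner_neq0 R) i) normr1 mul1r; congr rint; apply/funext => y.
by rewrite mul1r -window_shift addrK.
Qed.

Lemma window_continuous a b f : a <= b -> continuous f ->
  rintegrable (fun y => window a b y * f y) /\
  rint (fun y => window a b y * f y) = \int[leb]_(y in `[a, b]) f y.
Proof.
move=> ab cf.
have mD : measurable (`[a, b[%classic : set (measurableTypeR R)) by exact: measurable_itv.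
have ic : leb.-integrable `[a, b] (EFin \o f).
  by apply: continuous_compact_integrable; [exact: segment_compact|exact: continuous_subspaceT].
have io : leb.-integrable `[a, b[ (EFin \o f).
  by apply: integrableS ic => //; exact: subset_itv_co_cc.
have e y : window a b y * f y = (f \_ `[a, b[%classic) y.
  by rewrite patchE mem_setE in_itv/= /window; case: ifP => _; rewrite ?mul1r ?mul0r.
split.
  have G1 := iffLR (@integrable_mkcond _ (measurableTypeR R) R lebesgue_measure _ _ mD) io.
  move: G1; congr (_.-integrable _ _); apply/funext => y /=.
  by rewrite e !patchE; case: ifP.
by rewrite (funext e) /rint -Rintegral_mkcond Rintegral_itv_bndo_bndc//.
Qed.

End Windows.

Section PeriodSplitting.
Context {R : realType}.
Variable T : R.
Hypothesis T0 : 0 < T.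
Local Notation w := (window (- (T / 2)) (T / 2)).

Lemma window_sum M y :
  w y + \sum_(1 <= n < M.+1) (w (y - n%:R * T) + w (y - (- (n%:R * T)))) =
  window (- (T / 2) - M%:R * T) (T / 2 + M%:R * T) y.
Proof.
elim: M => [|M IH]; first by rewrite big_geq// mul0r subr0 !addr0.
have MT : 0 <= M%:R * T by rewrite mulr_ge0// ltW.
rewrite big_nat_recr//= addrA IH !window_shift.
have S1 : M.+1%:R * T = M%:R * T + T by rewrite -[M.+1]addn1 natrD mulrDl mul1r.
rewrite S1.
have -> : - (T / 2) + (M%:R * T + T) = T / 2 + M%:R * T by field.
have -> : T / 2 + - (M%:R * T + T) = - (T / 2) - M%:R * T by field.
move: (M%:R * T) MT => m m0; have T0' := T0.
rewrite addrA windowD; [|lra|lra].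
rewrite addrC windowD; [|lra|lra].
by congr (window _ _ _); ring.
Qed.

(** The windowed integrals of the translates add up to the integral over a growing interval;
    dominated convergence gives the limit. *)
Lemma period_splitting (f : R -> R) : rintegrable f ->
  (rint (fun y => w y * f y) + \sum_(1 <= n < M.+1)
     (rint (fun y => w y * f (y + n%:R * T)) + rint (fun y => w y * f (y - n%:R * T))))
  @[M --> \oo] --> rint f.
Proof.
move=> fi.
pose g M y := window (- (T / 2) - M%:R * T) (T / 2 + M%:R * T) y * f y.
have e M : rint (fun y => w y * f y) + \sum_(1 <= n < M.+1)
     (rint (fun y => w y * f (y + n%:R * T)) + rint (fun y => w y * f (y - n%:R * T))) = rint (g M).
  have sh c : rint (fun y => w y * f (y + c)) = rint (fun y => w (y - c) * f y).
    by rewrite windowM_shift//; congr rint; apply/funext => y; rewrite window_shift.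
  have ish c : rintegrable (fun y => w (y - c) * f y).
    rewrite (_ : (fun y => _) = (fun y => window (- (T / 2) + c) (T / 2 + c) y * f y)).
      exact: windowM_integrable.
    by apply/funext => y; rewrite window_shift.
  rewrite /g -(funext (fun y => congr1 (fun z => z * f y) (window_sum M y))).
  elim: M => [|M IH].
    by rewrite !big_geq// addr0; congr rint; apply/funext => y; rewrite big_geq// addr0.
  rewrite big_nat_recr//= addrA IH !sh.
  have iM : rintegrable (fun y => (w y + \sum_(1 <= n < M.+1) (w (y - n%:R * T) + w (y - (- (n%:R * T))))) * f y).
    rewrite (funext (fun y => congr1 (fun z => z * f y) (window_sum M y))).
    exact: windowM_integrable.
  rewrite -rintD// -rintD//; last exact: rintegrableD.
  by congr rint; apply/funext => y; rewrite [in RHS]big_nat_recr//= [in RHS]addrA -!mulrDl.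
rewrite (funext e).
apply: (rint_dominated (g := fun y => `|f y|) _ _ _ _).2.
- by move=> M; apply: measurable_funM; [exact: window_measurable|exact: rintegrable_meas fi].
- move=> y; apply: cvg_near_cst; near=> M; rewrite /g.
  suff -> : window (- (T / 2) - M%:R * T) (T / 2 + M%:R * T) y = 1 by rewrite mul1r.
  have : `|y| / T <= M%:R by near: M; exact: nbhs_infty_ger.
  rewrite ler_pdivrMr// => h; have := ler_norm y; have := ler_norm (- y); rewrite normrN => h1 h2.
  have T0' := T0; rewrite /window; have -> : - (T / 2) - M%:R * T <= y by lra.
  by have -> : y < T / 2 + M%:R * T by lra.
- by move=> M y; rewrite /g normrM ler_piMl// window_norm_le1.
- exact: rintegrable_norm.
Unshelve. all: by end_near. Qed.

End PeriodSplitting.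

Section FiniteSums.
Context {R : realType}.

Lemma rint_sum (f : nat -> R -> R) m n : (forall k, rintegrable (f k)) ->
  rintegrable (fun y => \sum_(m <= k < n) f k y) /\
  rint (fun y => \sum_(m <= k < n) f k y) = \sum_(m <= k < n) rint (f k).
Proof.
move=> fi; have z0 : rintegrable (fun _ : R => 0 : R).
  have := rintegrableZ 0 (fi 0%N); by under eq_fun do rewrite mul0r.
have z1 : rint (fun _ : R => 0 : R) = 0 by rewrite /rint Rintegral_cst// mul0r.
elim: n => [|n [i e]].
  by rewrite big_geq//; under eq_fun do rewrite big_geq//.
have [mn|mn] := leqP m n; last first.
  by rewrite big_geq//; under eq_fun do rewrite big_geq//.
rewrite big_nat_recr//= -e -rintD//.
rewrite (_ : (fun y => \sum_(m <= k < n.+1) f k y) =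
  (fun y => \sum_(m <= k < n) f k y + f n y)); last first.
  by apply/funext => y; rewrite big_nat_recr.
by split => //; exact: rintegrableD.
Qed.

Lemma continuous_sum_nat (f : nat -> R -> R) m n : (forall k, continuous (f k)) ->
  continuous (fun y => \sum_(m <= k < n) f k y).
Proof.
move=> cf; elim: n => [|n IH].
  by under eq_fun do rewrite big_geq//; move=> y; exact: cvg_cst.
have [mn|mn] := leqP m n; last first.
  by under eq_fun do rewrite big_geq//; move=> y; exact: cvg_cst.
rewrite (_ : (fun y => _) = (fun y => \sum_(m <= k < n) f k y + f n y)).
  by move=> y; apply: cvgD; [exact: IH|exact: cf].
by apply/funext => y; rewrite big_nat_recr.
Qed.

Lemma cos_period (x : R) n : cos (x + n%:R * (2 * pi)) = cos x.
Proof.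
elim: n => [|n IH]; first by rewrite mul0r addr0.
rewrite -IH -[n.+1]addn1 natrD mulrDl mul1r addrA.
by rewrite (_ : 2 * pi = pi *+ 2) ?cosD2pi// mulr_natl.
Qed.

End FiniteSums.

(** * The Fejer kernel at 2 alpha y: its period pi/alpha and its mass pi/alpha over one period *)

Section FejerPeriod.
Context {R : realType}.
Variable alpha : R.
Hypothesis alpha0 : 0 < alpha.
Local Notation T := (pi / alpha).
Local Notation w := (window (- (T / 2)) (T / 2)).

Lemma period_gt0 : 0 < T. Proof. by rewrite divr_gt0 ?pi_gt0. Qed.

Lemma dirichlet_continuous j : continuous (fun y : R => dirichlet_kernel j (2 * alpha * y)).
Proof.
move=> y; apply: cvgD; first exact: cvg_cst.
apply: cvgM; first exact: cvg_cst.
apply: continuous_sum_nat => k; under eq_fun do rewrite mulrA.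
exact: cosine_continuous.
Qed.

Lemma fejer_continuous N : continuous (fun y : R => fejer_kernel N (2 * alpha * y)).
Proof.
move=> y; apply: cvgM; first exact: cvg_cst.
apply: (@continuous_sum_nat _ (fun j y => dirichlet_kernel j (2 * alpha * y))) => j.
exact: dirichlet_continuous.
Qed.

Lemma fejer_period N n (y : R) :
  fejer_kernel N (2 * alpha * (y + n%:R * T)) = fejer_kernel N (2 * alpha * y) /\
  fejer_kernel N (2 * alpha * (y - n%:R * T)) = fejer_kernel N (2 * alpha * y).
Proof.
have a0 : alpha != 0 by rewrite gt_eqF.
split; congr (_ * _); apply: eq_bigr => j _; congr (_ + _ * _); apply: eq_bigr => k _.
  rewrite -[RHS](cos_period _ (k * n)); congr cos; rewrite natrM; by field.
rewrite -[LHS](cos_period _ (k * n)); congr cos; rewrite natrM; by field.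
Qed.

Lemma window_cos k : (0 < k)%N ->
  rintegrable (fun y => w y * cos (k%:R * (2 * alpha * y))) /\
  rint (fun y => w y * cos (k%:R * (2 * alpha * y))) = 0.
Proof.
move=> k0; have T0 := period_gt0; have TT : - (T / 2) < T / 2 by lra.
have c0 : k%:R * (2 * alpha) != 0 :> R by rewrite !mulf_neq0 ?gt_eqF// ltr0n.
have cc : continuous (fun y : R => cos (k%:R * (2 * alpha * y))).
  by under eq_fun do rewrite mulrA; exact: cosine_continuous.
have [i ->] := window_continuous (ltW TT) cc; split; first exact: i.
pose F (y : R) := (k%:R * (2 * alpha))^-1 * sin (k%:R * (2 * alpha) * y).
have dF (y : R) : is_derive y 1 F (cos (k%:R * (2 * alpha * y))).
  have d1 : is_derive y 1 (fun u : R => k%:R * (2 * alpha) * u) (k%:R * (2 * alpha)).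
    by apply: is_derive_eq; rewrite /GRing.scale /= mulr1.
  have d2 : is_derive y 1 (sin \o (fun u : R => k%:R * (2 * alpha) * u))
     (cos (k%:R * (2 * alpha) * y) * (k%:R * (2 * alpha))) by exact: is_derive1_comp.
  apply: is_derive_eq; rewrite /GRing.scale /= [LHS]mulrC mulfK//.
  by congr cos; ring.
have cF : continuous F.
  move=> y; apply: differentiable_continuous; apply/derivable1_diffP.
  by have [] := dF y.
rewrite /Rintegral (@continuous_FTC2 _ _ F)//.
- have a0 : alpha != 0 by rewrite gt_eqF.
  have sk : sin (k%:R * pi) = 0 :> R.
    elim: (k) => [|n IH]; first by rewrite mul0r sin0.
    by rewrite -[n.+1]addn1 natrD mulrDl mul1r sinD IH sinpi mulr0 mul0r addr0.
  rewrite /F -EFinB /=.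
  have -> : k%:R * (2 * alpha) * (T / 2) = k%:R * pi by field.
  have -> : k%:R * (2 * alpha) * - (T / 2) = - (k%:R * pi) by field.
  by rewrite sinN sk oppr0 mulr0 subr0.
- exact: continuous_subspaceT.
- split=> [x _||]; [by have [] := dF x| |].
  + by apply: cvg_at_right_filter; exact: cF.
  + by apply: cvg_at_left_filter; exact: cF.
- by move=> x _; rewrite derive1E; apply: derive_val.
Qed.

Lemma window_cst : rintegrable w /\ rint w = T.
Proof.
have T0 := period_gt0; have TT : - (T / 2) <= T / 2 by lra.
have [i e] := window_continuous TT (fun y => @cvg_cst _ (1 : R) _ (nbhs y) _).
have E : (fun y => w y * cst 1 y) = w by apply/funext => y; rewrite mulr1.
split; first by rewrite -E.
rewrite -[in LHS]E e /Rintegral integral_cst//= lebesgue_measure_itv/= lte_fin.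
have -> : - (T / 2) < T / 2 by lra.
by rewrite -EFinD mul1e /=; field; rewrite gt_eqF.
Qed.

Lemma window_fejer N : rintegrable (fun y => w y * fejer_kernel N (2 * alpha * y)) /\
  rint (fun y => w y * fejer_kernel N (2 * alpha * y)) = T.
Proof.
have [wi wT] := window_cst.
have D j : rintegrable (fun y => w y * dirichlet_kernel j (2 * alpha * y)) /\
    rint (fun y => w y * dirichlet_kernel j (2 * alpha * y)) = T.
  pose f k y := if (0 < k)%N then w y * cos (k%:R * (2 * alpha * y)) else 0 * w y.
  have fi k : rintegrable (f k) /\ rint (f k) = 0.
    rewrite /f; case: k => [|k]; last exact: window_cos.
    by split; [exact: rintegrableZ|rewrite rintZ// mul0r].
  have [si se] := @rint_sum R f 1 j.+1 (fun k => (fi k).1).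
  have e y : w y * dirichlet_kernel j (2 * alpha * y) = w y + 2 * \sum_(1 <= k < j.+1) f k y.
    have -> : \sum_(1 <= k < j.+1) f k y = w y * \sum_(1 <= k < j.+1) cos (k%:R * (2 * alpha * y)).
      by rewrite mulr_sumr; apply: eq_big_nat => k /andP[k1 _]; rewrite /f k1.
    by rewrite /dirichlet_kernel; move: (w y) (\sum_(1 <= k < _) _) => a b; ring.
  rewrite (funext e); split; first by apply: rintegrableD => //; exact: rintegrableZ.
  rewrite rintD//; last exact: rintegrableZ.
  rewrite rintZ// se big1 ?mulr0 ?addr0// => k _; exact: (fi k).2.
have [si se] := @rint_sum R (fun j y => w y * dirichlet_kernel j (2 * alpha * y)) 0 N.+1 (fun k => (D k).1).
have e y : w y * fejer_kernel N (2 * alpha * y) =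
    N.+1%:R^-1 * \sum_(0 <= j < N.+1) w y * dirichlet_kernel j (2 * alpha * y).
  by rewrite /fejer_kernel mulrCA mulr_sumr.
rewrite (funext e); split; first exact: rintegrableZ.
rewrite rintZ// se (eq_bigr (fun=> T)) => [|j _]; last exact: (D j).2.
by rewrite sumr_const_nat subn0 -[T *+ _]mulr_natl mulrA mulVf ?mul1r.
Qed.

End FejerPeriod.

(** * Convergence criteria for series *)

Section Summability.
Context {R : realType}.

Lemma sum1_cvg (u v : R ^nat) : (forall k, `|u k| <= v k) -> cvgn (series v) ->
  exists S : R, \sum_(1 <= k < n) u k @[n --> \oo] --> S.
Proof.
move=> uv cv; apply/cvg_ex.
rewrite (_ : cvgn _ = cvgn (series u)); last exact: is_cvg_series_restrict.
apply: normed_cvg; apply: (@series_le_cvg _ (fun n => `|u n|) v) => // n.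
exact: le_trans (normr_ge0 (u n)) (uv n).
Qed.

Lemma series_telescope_cvg (C : R) : cvgn (series (fun k : nat => C * (k.+1%:R^-1 - k.+2%:R^-1))).
Proof.
apply: (@cvgP _ _ (C * (1 - 0))).
have -> : series (fun k : nat => C * (k.+1%:R^-1 - k.+2%:R^-1)) = (fun n : nat => C * (1 - n.+1%:R^-1)).
  apply/funext; elim => [|n IH]; first by rewrite /series/= big_geq// invr1 subrr mulr0.
  by rewrite seriesSr IH -mulrDr; congr (_ * _); ring.
apply: cvgM; first exact: cvg_cst.
by apply: cvgB; [exact: cvg_cst|exact: cvg_harmonic].
Qed.

(** The difference on the right is 1/((k+1)(k+2)), and (z+1)(z+2) <= 6(1+z^2); comparison is thus
    with a telescoping series. *)
Lemma inv_quadratic_le (c : R) k : 0 < c ->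
  (1 + c * k%:R ^+ 2)^-1 <= 6 * (1 + c^-1) * (k.+1%:R^-1 - k.+2%:R^-1).
Proof.
move=> c0; have k0 : 0 <= k%:R :> R by [].
have -> : k.+1%:R^-1 - k.+2%:R^-1 = ((k%:R + 1) * (k%:R + 2))^-1 :> R.
  rewrite -[k.+2]addn2 -[k.+1]addn1 !natrD; field.
  by rewrite !gt_eqF//; lra.
have q0 : 0 < (k%:R + 1) * (k%:R + 2) :> R by rewrite mulr_gt0//; lra.
have p0 : 0 < 1 + c * k%:R ^+ 2 by rewrite ltr_pwDl// mulr_ge0 ?sqr_ge0// ltW.
rewrite -div1r ler_pdivrMr// mulrAC ler_pdivlMr// mul1r.
have h1 (z : R) : 0 <= z -> (z + 1) * (z + 2) <= 6 * (1 + z ^+ 2).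
  by move=> z0; have := sqr_ge0 (z - 1); nra.
apply: le_trans (h1 _ k0) _; rewrite -mulrA ler_pM2l//.
have cv : 0 < c^-1 by rewrite invr_gt0.
have -> : (1 + c^-1) * (1 + c * k%:R ^+ 2) = 1 + k%:R ^+ 2 + (c^-1 + c * k%:R ^+ 2).
  by field; rewrite gt_eqF.
by rewrite lerDl addr_ge0 ?(ltW cv)// mulr_ge0 ?sqr_ge0// ltW.
Qed.

Lemma geometric_sum_le (q : R) M : 0 <= q -> q < 1 -> \sum_(1 <= n < M.+1) q ^+ n <= (1 - q)^-1.
Proof.
move=> q0 q1; rewrite -[leRHS]mul1r ler_pdivlMr ?subr_gt0//.
have -> : (\sum_(1 <= n < M.+1) q ^+ n) * (1 - q) = q - q ^+ M.+1.
  elim: M => [|M IH]; first by rewrite big_geq// mul0r expr1 subrr.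
  by rewrite big_nat_recr//= mulrDl IH [q ^+ M.+2]exprS; ring.
by have := exprn_ge0 M.+1 q0; lra.
Qed.

End Summability.

(** * Poisson summation *)

Section Poisson.
Context {R : realType}.
Variables (G : R -> R) (alpha : R).
Hypothesis alpha0 : 0 < alpha.
Hypothesis GN : forall y, G (- y) = G y.
Hypothesis Gd : exists2 C : R, 0 <= C & forall y, `|G y| <= C * expR (- `|y|).
Hypothesis GL : forall B : R, exists2 M : R, 0 <= M &
  forall y h, `|h| <= B -> `|G (y + h) - G y| <= M * `|h| * expR (- `|y|).
Hypothesis GS : exists2 M : R, 0 <= M & forall y h, `|h| <= 1 ->
  `|G (y + h) + G (y - h) - 2 * G y| <= M * h ^+ 2 * expR (- `|y|).
Local Notation H := (cosine_transform G).
Local Notation T := (pi / alpha).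
Local Notation w := (window (- (T / 2)) (T / 2)).
Local Notation F N y := (fejer_kernel N (2 * alpha * y)).
Local Notation rt N := ((Num.sqrt N.+1%:R)^-1 : R).

(** With d = (N+1)^{-1/2}: |y| <= d + y^2/d, and by [sqr_le_cos] and [fejer_kernelM] the kernel
    times y^2 is at most 16 d^2/alpha^2. The kernel thus concentrates at 0 at rate d. *)
Lemma norm_fejer_le N (y : R) : `|y| <= T / 2 ->
  `|y| * F N y <= rt N * F N y + 16 / alpha ^+ 2 * rt N.
Proof.
move=> yT; set d := rt N.
have d0 : 0 < d by rewrite invr_gt0 sqrtr_gt0.
have dd : N.+1%:R^-1 = d ^+ 2 by rewrite /d exprVn sqr_sqrtr.
have f0 := fejer_kernel_ge0 N (2 * alpha * y).
have a2 : 0 < alpha ^+ 2 by rewrite exprn_gt0.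
have tp : `|2 * alpha * y| <= pi.
  rewrite !normrM normr_nat (gtr0_norm alpha0).
  have := ler_wpM2l (ltW (mulr_gt0 (ltr0Sn R 1) alpha0)) yT.
  have -> : 2 * alpha * (T / 2) = pi by field; rewrite gt_eqF.
  by [].
have sq := sqr_le_cos tp; have FM := fejer_kernelM N (2 * alpha * y).
have c2 : N.+1%:R^-1 * (1 - cos (N.+1%:R * (2 * alpha * y))) <= 2 * d ^+ 2.
  rewrite dd mulrC ler_wpM2r ?sqr_ge0//.
  by have := cos_geN1 (N.+1%:R * (2 * alpha * y)); lra.
rewrite -FM in c2; set f := F N y in f0 c2 *; set c := 1 - cos _ in sq c2.
have y2 : y ^+ 2 * f <= 16 / alpha ^+ 2 * d ^+ 2.
  have : (2 * alpha * y) ^+ 2 * f <= 32 * c * f by rewrite ler_wpM2r.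
  have -> : (2 * alpha * y) ^+ 2 * f = 4 * alpha ^+ 2 * (y ^+ 2 * f) by ring.
  have -> : 16 / alpha ^+ 2 * d ^+ 2 = 16 * d ^+ 2 / alpha ^+ 2 by ring.
  rewrite ler_pdivlMr//; lra.
have yd : `|y| * d <= d ^+ 2 + y ^+ 2.
  rewrite -(real_normK (num_real y)); have := sqr_ge0 (`|y| - d); have := sqr_ge0 `|y|; have := sqr_ge0 d.
  by rewrite sqrrB; lra.
rewrite -(ler_pM2r d0); have := ler_wpM2r f0 yd.
move: y2; move: (16 / _) => q; lra.
Qed.

(** On the window, |G(y + c) - G(c)| <= M |y| e^{-|c|}, and [norm_fejer_le] is integrated. The
    factor e^{-|c|} keeps the errors summable over all translates c. *)
Lemma window_fejer_estimate : exists2 M0 : R, 0 <= M0 & forall N c,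
  `|rint (fun y => w y * (G (y + c) * F N y)) - T * G c| <= M0 * rt N * expR (- `|c|).
Proof.
have [M M0 hM] := GL (T / 2); have T0 := period_gt0 alpha0.
have a2 : 0 < alpha ^+ 2 by rewrite exprn_gt0.
exists (M * (T + 16 / alpha ^+ 2 * T)).
  apply: mulr_ge0 => //; apply: addr_ge0; first exact: ltW.
  by apply: mulr_ge0; [apply: divr_ge0 => //|]; exact: ltW.
move=> N c; have [wfi wfe] := window_fejer alpha0 N; have [wi we] := window_cst alpha0.
have TT : - (T / 2) <= T / 2 by lra.
have Gc := G_continuous GL.
have [i1 _] : rintegrable (fun y => w y * (G (y + c) * F N y)) /\ True.
  split => //; apply: (window_continuous TT _).1 => y; apply: cvgM; last exact: fejer_continuous.
  apply: continuous_comp; last exact: Gc.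
  by apply: cvgD; [exact: cvg_id|exact: cvg_cst].
have -> : T * G c = rint (fun y => G c * (w y * F N y)) by rewrite rintZ// wfe mulrC.
have i2 := rintegrableZ (G c) wfi.
rewrite -rintB//; apply: le_trans (le_norm_rint (rintegrableB i1 i2)) _.
set d := rt N; set E := expR _; have E0 : 0 <= E by exact: expR_ge0.
have ME : 0 <= M * E by exact: mulr_ge0.
pose g y := M * E * (d * (w y * F N y) + 16 / alpha ^+ 2 * d * w y).
have gi : rintegrable g by apply: rintegrableZ; apply: rintegrableD; exact: rintegrableZ.
have -> : M * (T + 16 / alpha ^+ 2 * T) * d * E = rint g.
  by rewrite rintZ ?rintD ?rintZ ?wfe ?we; [ring|..]; try apply: rintegrableD; try exact: rintegrableZ.
apply: le_rint => //; first by apply: rintegrable_norm; exact: rintegrableB.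
move=> y; rewrite /g /window; case: (boolP (_ && _)) => [/andP[y1 y2]|_]; last first.
  by rewrite !mul0r !mulr0 subrr normr0 addr0 mulr0.
rewrite !mul1r mulr1.
have yT : `|y| <= T / 2 by rewrite ler_norml y1 ltW.
have f0 := fejer_kernel_ge0 N (2 * alpha * y).
rewrite -mulrBl normrM (ger0_norm f0).
apply: (@le_trans _ _ (M * E * (`|y| * F N y))); last by rewrite ler_wpM2l// norm_fejer_le.
by rewrite [leRHS]mulrA ler_wpM2r// mulrAC (addrC y); exact: hM.
Qed.

Local Notation s j := (H 0 + 2 * \sum_(1 <= k < j.+1) H (2 * alpha * k%:R)).

(** By linearity, the integral of G against the Fejer kernel is the Cesaro mean of the symmetric
    partial sums of H. *)
Lemma fejer_mean N : rintegrable (fun y => G y * F N y) /\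
  rint (fun y => G y * F N y) = N.+1%:R^-1 * \sum_(0 <= j < N.+1) s j.
Proof.
have ic := Gcos_integrable Gd GL.
have iG : rintegrable G.
  by have := ic 0; under eq_fun do rewrite mul0r cos0 mulr1.
have D j : rintegrable (fun y => G y * dirichlet_kernel j (2 * alpha * y)) /\
    rint (fun y => G y * dirichlet_kernel j (2 * alpha * y)) = s j.
  pose f k y := G y * cos (2 * alpha * k%:R * y).
  have [si se] := @rint_sum R f 1 j.+1 (fun k => ic _).
  have e y : G y * dirichlet_kernel j (2 * alpha * y) = G y + 2 * \sum_(1 <= k < j.+1) f k y.
    have -> : \sum_(1 <= k < j.+1) f k y = G y * \sum_(1 <= k < j.+1) cos (k%:R * (2 * alpha * y)).
      rewrite mulr_sumr; apply: eq_bigr => k _; rewrite /f; congr (_ * cos _); ring.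
    rewrite /dirichlet_kernel; move: (\sum_(1 <= k < _) _) => b; ring.
  rewrite (funext e); split; first by apply: rintegrableD => //; exact: rintegrableZ.
  rewrite rintD//; last exact: rintegrableZ.
  rewrite rintZ// se; congr (_ + _); congr rint; apply/funext => y.
  by rewrite mul0r cos0 mulr1.
have [si se] := @rint_sum R (fun j y => G y * dirichlet_kernel j (2 * alpha * y)) 0 N.+1 (fun k => (D k).1).
have e y : G y * F N y =
    N.+1%:R^-1 * \sum_(0 <= j < N.+1) G y * dirichlet_kernel j (2 * alpha * y).
  by rewrite /fejer_kernel mulrCA mulr_sumr.
rewrite (funext e); split; first exact: rintegrableZ.
rewrite rintZ// se; congr (_ * _); apply: eq_bigr => j _; exact: (D j).2.
Qed.

Lemma poisson_transform_summable : exists S : R,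
  \sum_(1 <= k < n) H (2 * alpha * k%:R) @[n --> \oo] --> S.
Proof.
have [K K0 hK] := cosine_transform_decay GN Gd GL GS.
have c0 : 0 < 4 * alpha ^+ 2 by rewrite mulr_gt0// exprn_gt0.
apply: (sum1_cvg (v := fun k => K * (6 * (1 + (4 * alpha ^+ 2)^-1)) * (k.+1%:R^-1 - k.+2%:R^-1))).
  move=> k; apply: le_trans (hK _) _; rewrite -[leRHS]mulrA ler_wpM2l//.
  have -> : (2 * alpha * k%:R) ^+ 2 = 4 * alpha ^+ 2 * k%:R ^+ 2 by ring.
  exact: inv_quadratic_le.
exact: series_telescope_cvg.
Qed.

Lemma poisson_samples_summable : exists S : R,
  \sum_(1 <= n < m) G (n%:R * T) @[m --> \oo] --> S.
Proof.
have [C C0 hC] := Gd; have T0 := period_gt0 alpha0.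
have q1 : `|expR (- T)| < 1 by rewrite ger0_norm ?expR_ge0// -[ltRHS]expR0 ltr_expR oppr_lt0.
apply: (sum1_cvg (v := geometric C (expR (- T)))); last exact: is_cvg_geometric_series.
move=> n; have nT : 0 <= n%:R * T by rewrite mulr_ge0// ltW.
by apply: le_trans (hC _) _; rewrite /geometric/= (ger0_norm nT) -expRM_natl mulrN.
Qed.

(** Both sides are limits of the integral of G against the Fejer kernel. As a Cesaro mean it tends
    to the sum of H, which already converges by [poisson_transform_summable]. Split into periods, it
    is close to T times the sum of the samples of G, because the kernel has period T and mass T
    concentrated at the sample points. *)
Theorem poisson_summation : exists Sa Sb : R,
  [/\ \sum_(1 <= k < n) H (2 * alpha * k%:R) @[n --> \oo] --> Sa,
      \sum_(1 <= n < m) G (n%:R * T) @[m --> \oo] --> Sb &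
      H 0 + 2 * Sa = T * (G 0 + 2 * Sb)].
Proof.
have [Sa ca] := poisson_transform_summable; have [Sb cb] := poisson_samples_summable.
exists Sa, Sb; split => //; have T0 := period_gt0 alpha0.
have [M0 M00 hM] := window_fejer_estimate.
set q := expR (- T); have q0 : 0 <= q by exact: expR_ge0.
have q1 : q < 1 by rewrite -[ltRHS]expR0 ltr_expR oppr_lt0.
(* Bounds the sum of e^{-|n|T} over all integers n: one central term and two geometric series. *)
pose Q := 1 + 2 * (1 - q)^-1.
have shift1 (u : R ^nat) (S : R) : \sum_(1 <= k < n) u k @[n --> \oo] --> S ->
    \sum_(1 <= k < n.+1) u k @[n --> \oo] --> S.
  move=> h; have := h; rewrite -(cvg_shiftS (fun n => \sum_(1 <= k < n) u k)); exact.
have sa : (fun j => s j) @ \oo --> H 0 + 2 * Sa.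
  apply: cvgD; first exact: cvg_cst.
  by apply: cvgM; [exact: cvg_cst|exact: shift1].
have c1 : rint (fun y => G y * F N y) @[N --> \oo] --> H 0 + 2 * Sa.
  have -> : (fun N => rint (fun y => G y * F N y)) = arithmetic_mean (fun j => s j).
    by apply/funext => N; rewrite (fejer_mean N).2 /arithmetic_mean/= seriesEnat.
  exact: cesaro sa.
have est N : `|rint (fun y => G y * F N y) - T * (G 0 + 2 * Sb)| <= M0 * Q * rt N.
  pose f y := G y * F N y.
  have sp := period_splitting T0 (fejer_mean N).1.
  have sG : T * (G 0 + 2 * \sum_(1 <= n < M.+1) G (n%:R * T)) @[M --> \oo] --> T * (G 0 + 2 * Sb).
    apply: cvgM; first exact: cvg_cst.
    apply: cvgD; first exact: cvg_cst.
    by apply: cvgM; [exact: cvg_cst|exact: shift1].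
  (* The estimate is proved for the finite number M of periods with a bound independent of M, which
     then survives the limit. *)
  apply: (cvgr_to_le (cvg_norm (cvgB sp sG))); apply: nearW => M.
  suff : `|(rint (fun y => w y * f y) + \sum_(1 <= n < M.+1)
     (rint (fun y => w y * f (y + n%:R * T)) + rint (fun y => w y * f (y - n%:R * T)))) -
     T * (G 0 + 2 * \sum_(1 <= n < M.+1) G (n%:R * T))| <= M0 * Q * rt N by exact.
  rewrite /f.
  have nT n : 0 <= n%:R * T by rewrite mulr_ge0// ltW.
  have E n : expR (- `|n%:R * T|) = q ^+ n by rewrite ger0_norm// /q -expRM_natl mulrN.
  have h0 : `|rint (fun y => w y * (G y * F N y)) - T * G 0| <= M0 * rt N.
    have := hM N 0; rewrite normr0 oppr0 expR0 mulr1.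
    by under eq_fun do rewrite addr0.
  have hp n : `|rint (fun y => w y * (G (y + n%:R * T) * F N (y + n%:R * T))) - T * G (n%:R * T)| <= M0 * rt N * q ^+ n.
    rewrite -E; apply: le_trans (hM N (n%:R * T)); rewrite le_eqVlt; apply/orP; left; apply/eqP.
    congr (`|rint _ - _|); apply/funext => y; by rewrite (fejer_period alpha0 N n y).1.
  have hm n : `|rint (fun y => w y * (G (y - n%:R * T) * F N (y - n%:R * T))) - T * G (n%:R * T)| <= M0 * rt N * q ^+ n.
    have := hM N (- (n%:R * T)); rewrite normrN E GN; apply: le_trans; rewrite le_eqVlt; apply/orP; left; apply/eqP.
    congr (`|rint _ - _|); apply/funext => y; by rewrite (fejer_period alpha0 N n y).2.
  have -> : T * (G 0 + 2 * \sum_(1 <= n < M.+1) G (n%:R * T)) =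
     T * G 0 + \sum_(1 <= n < M.+1) (T * G (n%:R * T) + T * G (n%:R * T)).
    by rewrite mulrDr big_split/= -!mulr_sumr; ring.
  rewrite opprD addrACA -sumrN -big_split/=.
  apply: le_trans (ler_normD _ _) _.
  have -> : M0 * Q * rt N = M0 * rt N + 2 * (M0 * rt N) * (1 - q)^-1 by rewrite /Q; ring.
  apply: lerD => //; apply: le_trans (ler_norm_sum _ _ _) _.
  have MN : 0 <= 2 * (M0 * rt N) by rewrite !mulr_ge0// invr_ge0 sqrtr_ge0.
  apply: le_trans (ler_wpM2l MN (geometric_sum_le M q0 q1)).
  rewrite mulr_sumr; apply: ler_sum => n _.
  rewrite opprD addrACA; apply: le_trans (ler_normD _ _) _.
  have := hp n; have := hm n; lra.
have c2 : rint (fun y => G y * F N y) @[N --> \oo] --> T * (G 0 + 2 * Sb).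
  have r0 : rt N @[N --> \oo] --> 0.
    have -> : (fun N => rt N) = (fun N => Num.sqrt (N.+1%:R^-1)) by apply/funext => N; rewrite sqrtrV.
    rewrite -(@sqrtr0 R); apply: continuous_cvg; first exact: sqrt_continuous.
    exact: cvg_harmonic.
  have b0 : M0 * Q * rt N @[N --> \oo] --> 0.
    by rewrite -(mulr0 (M0 * Q)); apply: cvgM; [exact: cvg_cst|exact: r0].
  have n0 : `|rint (fun y => G y * F N y) - T * (G 0 + 2 * Sb)| @[N --> \oo] --> 0.
    apply: (squeeze_cvgr _ (@cvg_cst _ (0 : R) _ _ _) b0); apply: nearW => N.
    by rewrite normr_ge0 est.
  by move/norm_cvg0P : n0 => /subr_cvg0.
exact: cvg_unique c1 c2.
Qed.

End Poisson.

(** * The three formulas for Whittaker functions *)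

Lemma csum_real {R : realType} (u : nat -> R) (S : R) m :
  \sum_(m <= k < n) u k @[n --> \oo] --> S ->
  csummable m (fun k => (u k)%:C) /\ csum m (fun k => (u k)%:C) = S%:C.
Proof.
move=> uS; have e n : \sum_(m <= k < n) (u k)%:C = (\sum_(m <= k < n) u k)%:C :> R[i].
  by rewrite rmorph_sum.
have h := ccvg_topology (ccvgR uS).
split.
  by rewrite /csummable (funext e); exact: cvgP h.
rewrite /csum (funext e); apply: cvg_lim h; exact: norm_hausdorff.
Qed.

Section BesselTransform.
Context {R : realType}.
Variable x : R.
Hypothesis x0 : 0 < x.
Local Notation G := (gbessel x).
Local Notation H := (hbessel x).
Local Notation c := (x / (Num.sqrt 2 * pi)).

Lemma gbessel_norm_decay : exists2 C : R, 0 <= C & forall y, `|G y| <= C * expR (- `|y|).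
Proof.
have [C C0 hC] := gbessel_decay x0; exists C => // y.
by rewrite ger0_norm ?gbessel_ge0.
Qed.

Lemma rint_scale (a : R) (f : R -> R) : 0 < a -> rintegrable f ->
  rintegrable (fun y => f (a * y)) /\ rint (fun y => f (a * y)) = rint f / a.
Proof.
move=> a0 fi; have an0 : a != 0 by rewrite gt_eqF.
have i := rintegrable_affine 0 an0 fi; have e := rint_affine 0 an0 fi.
have E : (fun y => f (a * y + 0)) = (fun y => f (a * y)) by apply/funext => y; rewrite addr0.
rewrite E in i e; split => //; rewrite e gtr0_norm// mulrC mulKf//.
Qed.

Lemma sqrt2_neq0 : Num.sqrt 2 != 0 :> R.
Proof. by rewrite gt_eqF// sqrtr_gt0. Qed.

Lemma pi_neq0 : pi != 0 :> R.
Proof. by rewrite gt_eqF// pi_gt0. Qed.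

(** Poisson summation for [gbessel x]: the terms on the left are c H(2 alpha n), and c times the
    period pi/alpha is x/(sqrt 2 alpha). *)
Lemma whittaker_summation alpha : 0 < alpha ->
  let W n : R[i] := whittakerW (- (1 / 4)) ((alpha * n%:R)*i) x *
     whittakerW (1 / 4) ((alpha * n%:R)*i) x in
  let k n : R[i] := (expR (- (x / 2) * cosh (pi * n%:R / alpha)))%:C *
     besselK 0 (x / 2 * cosh (pi * n%:R / alpha)) in
  [/\ csummable 1 W, csummable 1 k &
    whittakerW (- (1 / 4)) 0 x * whittakerW (1 / 4) 0 x + 2 * csum 1 W =
    (x / (Num.sqrt 2 * alpha))%:C *
      ((expR (- (x / 2)))%:C * besselK 0 (x / 2) + 2 * csum 1 k)].
Proof.
move=> alpha0 W k.
have [Sa [Sb [ca cb E]]] := poisson_summation alpha0 (@gbesselN R x)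
  gbessel_norm_decay (fun B => gbessel_lipschitz B x0) (gbessel_second_difference x0).
have WE n : W n = (c * H (2 * alpha * n%:R))%:C.
  by rewrite /W (whittaker_product (alpha * n%:R) x0) mulrA.
have kE n : k n = (G (n%:R * (pi / alpha)))%:C.
  rewrite /k (besselK_gbessel (pi * n%:R / alpha) x0); congr (gbessel _ _)%:C; ring.
have ca' : \sum_(1 <= k < n) c * H (2 * alpha * k%:R) @[n --> \oo] --> c * Sa.
  under eq_fun do rewrite -mulr_sumr.
  by apply: cvgM; [exact: cvg_cst|exact: ca].
have [s1 e1] := csum_real ca'; have [s2 e2] := csum_real cb.
rewrite (funext WE) (funext kE); split; [exact: s1|exact: s2|].
rewrite e1 e2.
(* The central term is the product formula at t = 0. *)
have -> : (0 : R[i]) = 0*i by [].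
rewrite (whittaker_product 0 x0) mulr0.
have -> : (expR (- (x / 2)))%:C * besselK 0 (x / 2) = (G 0)%:C :> R[i].
  have := besselK_gbessel 0 x0; have -> : cosh (0 : R) = 1 by rewrite /cosh oppr0 expR0; field.
  by rewrite !mulr1.
have -> : (2 : R[i]) = (2 : R)%:C by rewrite rmorph_nat.
rewrite -!rmorphM -!rmorphD -rmorphM; congr (_%:C).
have -> : c * H 0 + 2 * (c * Sa) = c * (H 0 + 2 * Sa) by ring.
rewrite -[H 0]/(cosine_transform G 0) E.
move: (Num.sqrt 2) sqrt2_neq0 (pi) pi_neq0 => q q0 p p0.
by field; rewrite q0 p0 gt_eqF.
Qed.

(** [cosine_inversion] at y = xi/2 after the scaling s = 2 tau: c times 2 pi / 2 is x/sqrt 2. The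
    imaginary part is odd in tau. *)
Lemma whittaker_fourier xi :
  let f tau : R[i] := whittakerW (- (1 / 4)) (tau*i) x * whittakerW (1 / 4) (tau*i) x *
     cexp ((- (tau * xi))*i) in
  cintegrable setT f /\
  cintegral setT f = (x / Num.sqrt 2)%:C *
    ((expR (- (x / 2) * cosh (xi / 2)))%:C * besselK 0 (x / 2 * cosh (xi / 2))).
Proof.
move=> f; rewrite (besselK_gbessel (xi / 2) x0).
have inv := cosine_inversion (@gbesselN R x) gbessel_norm_decay
  (fun B => gbessel_lipschitz B x0) (gbessel_second_difference x0) (xi / 2).
have iH := cosine_transform_integrable (@gbesselN R x) gbessel_norm_decay
  (fun B => gbessel_lipschitz B x0) (gbessel_second_difference x0) (xi / 2).
have iS := sine_transform_integrable (@gbesselN R x) gbessel_norm_decay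
  (fun B => gbessel_lipschitz B x0) (gbessel_second_difference x0) (xi / 2).
have fE tau : f tau = (c * (H (2 * tau) * cos (2 * tau * (xi / 2)))) +i*
    (- (c * (H (2 * tau) * sin (2 * tau * (xi / 2))))).
  rewrite /f (whittaker_product tau x0).
  have -> : 2 * tau * (xi / 2) = tau * xi by field.
  rewrite !mulrA; move: (c * H (2 * tau)) => q.
  apply: complex_eqP; rewrite ?cReM ?cImM ?Re_cexp ?Im_cexp /= expR0 cosN sinN; ring.
have t0 : 0 < 2 :> R by [].
have [i1 e1] := rint_scale t0 iH; have [i2 e2] := rint_scale t0 iS.
have [j1 j2] : rintegrable (fun tau => c * (H (2 * tau) * cos (2 * tau * (xi / 2)))) /\
    rintegrable (fun tau => - (c * (H (2 * tau) * sin (2 * tau * (xi / 2))))).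
  split; first exact: rintegrableZ.
  have := rintegrableZ (- c) i2; congr rintegrable; apply/funext => tau; exact: mulNr.
rewrite (funext fE); split; first by split.
apply: complex_eqP => /=.
  rewrite -[LHS]/(rint _) rintZ//; apply: (etrans (f_equal _ (etrans e1 (f_equal (fun z => z / 2) inv)))).
  rewrite !mul0r subr0; move: (Num.sqrt 2) sqrt2_neq0 (pi) pi_neq0 => q q0 p p0.
  by field; rewrite q0 p0.
rewrite mulr0 mul0r addr0; apply: rint_odd; first exact: j2.
move=> tau; rewrite mulrN -[H (- _)]/(cosine_transform G _) cosine_transformN !mulNr sinN.
by rewrite !mulrN.
Qed.

(** The product formula itself with y = xi/2; the sine part of the integral vanishes because
    [gbessel x] is even. *)
Lemma whittaker_inverse_fourier tau :
  let g xi : R[i] := (expR (- (x / 2) * cosh (xi / 2)))%:C *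
     besselK 0 (x / 2 * cosh (xi / 2)) * cexp ((tau * xi)*i) in
  cintegrable setT g /\
  whittakerW (- (1 / 4)) (tau*i) x * whittakerW (1 / 4) (tau*i) x =
    (x / (2 * Num.sqrt 2 * pi))%:C * cintegral setT g.
Proof.
move=> g.
have iC := Gcos_integrable gbessel_norm_decay (fun B => gbessel_lipschitz B x0) (2 * tau).
have iS := Gsin_integrable gbessel_norm_decay (fun B => gbessel_lipschitz B x0) (2 * tau).
have gE xi : g xi = (G (2^-1 * xi) * cos (2 * tau * (2^-1 * xi))) +i*
    (G (2^-1 * xi) * sin (2 * tau * (2^-1 * xi))).
  rewrite /g (besselK_gbessel (xi / 2) x0) (mulrC xi).
  have -> : 2 * tau * (2^-1 * xi) = tau * xi by field.
  move: (G (2^-1 * xi)) => q.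
  apply: complex_eqP; rewrite ?cReM ?cImM ?Re_cexp ?Im_cexp /= expR0; ring.
have h0 : 0 < 2^-1 :> R by rewrite invr_gt0.
have [i1 e1] := rint_scale h0 iC; have [i2 e2] := rint_scale h0 iS.
rewrite (funext gE); split; first by split.
rewrite (whittaker_product tau x0).
have -> : cintegral setT (fun xi => (G (2^-1 * xi) * cos (2 * tau * (2^-1 * xi))) +i*
    (G (2^-1 * xi) * sin (2 * tau * (2^-1 * xi)))) = (H (2 * tau) / 2^-1)%:C.
  apply: complex_eqP => /=; first exact: e1.
  apply: (etrans e2); rewrite (rint_odd iS) ?mul0r// => y.
  by rewrite gbesselN mulrN sinN mulrN.
rewrite -rmorphM; congr (_%:C).
move: (Num.sqrt 2) sqrt2_neq0 (pi) pi_neq0 => q q0 p p0.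
by field; rewrite q0 p0.
Qed.

End BesselTransform.

Theorem corollary3p7 (R : realType) :
  (forall x alpha : R, 0 < x -> 0 < alpha ->
     let w (n : nat) : R[i] :=
       whittakerW (- (1 / 4)) ((alpha * n%:R)*i) x *
       whittakerW (1 / 4) ((alpha * n%:R)*i) x in
     let k (n : nat) : R[i] :=
       (expR (- (x / 2) * cosh (pi * n%:R / alpha)))%:C *
       besselK 0 (x / 2 * cosh (pi * n%:R / alpha)) in
     [/\ csummable 1 w,
         csummable 1 k &
         whittakerW (- (1 / 4)) 0 x * whittakerW (1 / 4) 0 x + 2 * csum 1 w =
         (x / (Num.sqrt 2 * alpha))%:C *
         ((expR (- (x / 2)))%:C * besselK 0 (x / 2) + 2 * csum 1 k)])
  /\
  (forall x xi : R, 0 < x ->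
     let f (tau : R) : R[i] :=
       whittakerW (- (1 / 4)) (tau*i) x * whittakerW (1 / 4) (tau*i) x *
       cexp ((- (tau * xi))*i) in
     cintegrable setT f /\
     cintegral setT f =
       (x / Num.sqrt 2)%:C *
       ((expR (- (x / 2) * cosh (xi / 2)))%:C *
        besselK 0 (x / 2 * cosh (xi / 2))))
  /\
  (forall x tau : R, 0 < x ->
     let g (xi : R) : R[i] :=
       (expR (- (x / 2) * cosh (xi / 2)))%:C *
       besselK 0 (x / 2 * cosh (xi / 2)) *
       cexp ((tau * xi)*i) in
     cintegrable setT g /\
     whittakerW (- (1 / 4)) (tau*i) x * whittakerW (1 / 4) (tau*i) x =
       (x / (2 * Num.sqrt 2 * pi))%:C * cintegral setT g).
Proof.
split; first by move=> x alpha x0 alpha0; exact: whittaker_summation.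
split; first by move=> x xi x0; exact: whittaker_fourier.
by move=> x tau x0; exact: whittaker_inverse_fourier.
Qed.
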